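(* Every closed set $\Gamma\subset\mathbb{C}^n$ of area zero is a set of tangential approximation by meromorphic functions in $\mathbb{C}^n$.
   Context: The area of a subset of $\mathbb{C}^n$ is its Hausdorff $2$-measure. $\mathcal{C}(\Gamma)$ is the set of continuous complex-valued functions on $\Gamma$. The closed set $\Gamma$ is a set of tangential approximation by meromorphic functions in $\mathbb{C}^n$ if for every $f\in\mathcal{C}(\Gamma)$ and every positive continuous function $\epsilon$ on $\Gamma$ there is a meromorphic function $F$ on $\mathbb{C}^n$ whose singularities do not meet $\Gamma$ and such that $|f-F|<\epsilon$ on $\Gamma$. (Such meromorphic functions can be expressed as quotients $F=p/q$ of entire functions $p,q$ on $\mathbb{C}^n$ with $q(z)\neq 0$ for all $z\in\Gamma$.) *)

(* Defs.v *)
From HB Require Import structures.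
From mathcomp Require Import all_boot all_order all_algebra.
From mathcomp Require Import all_classical all_reals all_analysis.
From mathcomp Require Import complex.

Set Implicit Arguments.
Unset Strict Implicit.
Unset Printing Implicit Defensive.
Import Order.TTheory GRing.Theory Num.Theory numFieldNormedType.Exports.
Local Open Scope classical_set_scope.
Local Open Scope ring_scope.
Local Open Scope complex_scope.

(* MathComp-Analysis equips only the alias [R[i]^o] with the topology given by
   the modulus; this makes it canonical on [R[i]] itself, so that it agrees with
   the one underlying the normed module ['rV[R[i]]_n]. *)
HB.instance Definition _ (R : rcfType) := NormedModule.copy R[i] R[i]^o.

Section HausdorffArea.
Context {R : realType} {n : nat}.
Implicit Types (z w : 'rV[R[i]]_n) (A : set 'rV[R[i]]_n).

(* The library norm on row vectors is the sup norm, hence this definition; both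
   induce the same topology. *)
Definition eucl_dist z w : R :=
  Num.sqrt (\sum_(i < n) ComplexField.Normc.normc (z ord0 i - w ord0 i) ^+ 2).

(* The value 0 is adjoined so that the empty set has diameter 0, not -oo. *)
Definition diam A : \bar R :=
  ereal_sup ([set 0%E] `|` [set (eucl_dist z w)%:E | z in A & w in A]).

Definition area_delta (delta : R) A : \bar R :=
  ereal_inf
    [set (\sum_(0 <= k <oo) ((pi / 4)%:E * diam (U k) ^+ 2))%E
    | U in [set U : nat -> set 'rV[R[i]]_n |
              A `<=` \bigcup_k U k /\
              forall k, (diam (U k) <= delta%:E)%E]].

(* Hausdorff 2-measure, normalised by pi / 4 so that a disc of diameter d in a
   real plane has area pi * d ^ 2 / 4. The supremum over delta is the limit as
   delta tends to 0, since area_delta is nonincreasing in delta. *)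
Definition area A : \bar R :=
  ereal_sup [set area_delta delta A | delta in [set delta : R | 0 < delta]].

End HausdorffArea.

Section Meromorphic.
Context {R : realType} {n : nat}.
Implicit Types (F : 'rV[R[i]]_n -> R[i]) (z : 'rV[R[i]]_n).

(* [differentiable] is Frechet differentiability over the scalar field R[i],
   that is, with a complex-linear differential. *)
Definition holomorphic_at F z : Prop := \forall w \near z, differentiable F w.

(* Locally a quotient of two holomorphic functions whose denominator is not
   identically zero near the point. [F] is a total function: its values where
   such a quotient is undefined carry no information. *)
Definition meromorphic F : Prop :=
  forall z, exists p q : 'rV[R[i]]_n -> R[i],
    [/\ holomorphic_at p z,
        holomorphic_at q z,
        ~ (\forall w \near z, q w = 0)
      & \forall w \near z, q w != 0 -> F w = p w / q w].

(* For meromorphic [F] this contains all poles and points of indeterminacy. *)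
Definition singularities F : set 'rV[R[i]]_n :=
  [set z | ~ holomorphic_at F z].

Definition tangential_meromorphic_approximation (G : set 'rV[R[i]]_n) : Prop :=
  forall (f : 'rV[R[i]]_n -> R[i]) (eps : 'rV[R[i]]_n -> R),
    {within G, continuous f} ->
    {within G, continuous eps} ->
    (forall z, G z -> 0 < eps z) ->
    exists F : 'rV[R[i]]_n -> R[i],
      [/\ meromorphic F,
          singularities F `&` G = set0
        & forall z, G z -> `|f z - F z| < (eps z)%:C].

End Meromorphic.

(* Main.v *)
(* A set of area zero has a null image in the plane under every locally Lipschitz complex function.
   If [u] is Lipschitz and [N] is a compact null set in the plane, discretising the Cauchy transform
   of the d-bar derivative of [u] and dropping the few lattice points close to [N] approximates [u]
   uniformly on [N] by sums of simple poles off [N]; when [u] vanishes around a disc, the poles avoid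
   that disc as well (Hartogs-Rosenthal).  Composing with rational functions, whose poles can be
   moved off [Gamma] since their values on [Gamma] form a null set, shows that the rational functions
   without poles on [Gamma] and uniformly approximable by polynomials on a polydisc [B] are dense
   in a lattice of real functions separating the points of a compact piece of [Gamma] off [B]; by
   Stone-Weierstrass every continuous function vanishing around [B] can be approximated on [B] and
   on that piece simultaneously.  Exhausting the space by polydiscs, one corrects the error on larger
   and larger pieces of [Gamma] by rational functions that are small on smaller polydiscs.  The tails
   of the resulting series are locally uniform limits of polynomials, hence holomorphic. *)

From HB Require Import structures.
Require Import Defs.
From mathcomp Require Import all_boot all_order all_algebra.
From mathcomp Require Import all_classical all_reals all_analysis.
From mathcomp Require Import cyclic separable cyclotomic.
From mathcomp Require Import complex zify ring lra.
Set Implicit Arguments.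
Unset Strict Implicit.
Unset Printing Implicit Defensive.
Import Order.TTheory GRing.Theory Num.Theory numFieldNormedType.Exports.
Import ComplexField.Normc.
Local Open Scope classical_set_scope.
Local Open Scope ring_scope.
Local Open Scope complex_scope.

(** * Moduli and sums along arithmetic progressions *)

(** Plane integrals are replaced throughout by finite lattice sums: summation by parts stands for
    Green's formula, and counting lattice points in discs stands for measuring them. Likewise
    contour integrals become means over roots of unity, and several complex variables are reached
    only through restrictions to complex lines. The obstacle is the polydisc [B]: its image under a
    polynomial has interior in general, so Hartogs-Rosenthal does not apply to arbitrary functions
    of the coordinates. Two cases remain. A function of one coordinate that vanishes around the disc
    covered by [B] is allowed, and yields cut-offs that are zero on [B]. A coordinate times such a
    cut-off takes a single value on [B], so its values on [B] and on a piece of [Gamma] form a null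
    set, and any Lipschitz function of it is allowed. This gives absolute values, hence maxima and
    minima. Uniform approximability by polynomials on [B], rather than mere holomorphy, is carried
    along because it passes to sums, products, inverses and limits by elementary estimates. *)

Section Modulus.
Context {R : realType}.
Implicit Types (x y : R) (z w : R[i]).

Definition cm z : R := normc z.
Arguments cm : simpl never.

Lemma cm_ge0 z : 0 <= cm z. Proof. by case: z => a b; exact: sqrtr_ge0. Qed.
Lemma cm0 : cm (0 : R[i]) = 0. Proof. exact: normc0. Qed.
Lemma cm1 : cm (1 : R[i]) = 1. Proof. exact: normc1. Qed.
Lemma cmM z w : cm (z * w) = cm z * cm w. Proof. exact: normcM. Qed.
Lemma cmD z w : cm (z + w) <= cm z + cm w. Proof. exact: le_normcD. Qed.
Lemma cmN z : cm (- z) = cm z. Proof. exact: normcN. Qed.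
Lemma cmV z : cm z^-1 = (cm z)^-1. Proof. exact: normcV. Qed.
Lemma cm_eq0 z : (cm z == 0) = (z == 0).
Proof.
by apply/eqP/eqP => [|->]; [exact: eq0_normc | exact: cm0].
Qed.
Lemma cm_gt0 z : (0 < cm z) = (z != 0).
Proof. by rewrite lt_def cm_ge0 andbT cm_eq0. Qed.
Lemma cmB z w : cm (z - w) = cm (w - z). Proof. by rewrite -cmN opprB. Qed.
Lemma cm_dist z w v : cm (z - w) <= cm (z - v) + cm (v - w).
Proof. by rewrite -[X in cm X](subrKA v) cmD. Qed.
Lemma cmX z k : cm (z ^+ k) = cm z ^+ k.
Proof. by elim: k => [|k IH]; rewrite ?expr0 ?cm1// !exprS cmM IH. Qed.
Lemma cm_sum (I : Type) (s : seq I) (P : pred I) (F : I -> R[i]) :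
  cm (\sum_(i <- s | P i) F i) <= \sum_(i <- s | P i) cm (F i).
Proof.
elim/big_rec2: _ => [|i x y _ le]; first by rewrite cm0.
by apply: le_trans (cmD _ _) _; rewrite lerD2l.
Qed.
Lemma cmE x y : cm (x +i* y) = Num.sqrt (x ^+ 2 + y ^+ 2). Proof. by []. Qed.
Lemma sqr_cm x y : cm (x +i* y) ^+ 2 = x ^+ 2 + y ^+ 2.
Proof. by rewrite cmE sqr_sqrtr// addr_ge0 ?sqr_ge0. Qed.
Lemma cm_real x : cm x%:C = `|x|.
Proof. by rewrite cmE expr0n addr0 sqrtr_sqr. Qed.
Lemma ler_cm x y (b : R) : 0 <= b -> x ^+ 2 + y ^+ 2 <= b ^+ 2 -> cm (x +i* y) <= b.
Proof. by move=> b0 le; rewrite cmE -(ger0_norm b0) -sqrtr_sqr ler_wsqrtr. Qed.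
Lemma Re_le_cm z : `|complex.Re z| <= cm z.
Proof.
case: z => a b /=; rewrite -sqrtr_sqr cmE ler_wsqrtr// lerDl sqr_ge0 //.
Qed.
Lemma Im_le_cm z : `|complex.Im z| <= cm z.
Proof.
case: z => a b /=; rewrite -sqrtr_sqr cmE ler_wsqrtr// lerDr sqr_ge0 //.
Qed.
Lemma cm_le_ReIm z : cm z <= `|complex.Re z| + `|complex.Im z|.
Proof.
case: z => a b /=; apply: ler_cm; first by rewrite addr_ge0.
rewrite sqrrD !real_normK ?num_real// -addrA lerD2l lerDr.
by rewrite mulrn_wge0 ?mulr_ge0.
Qed.
Lemma normcE z : `|z| = (cm z)%:C. Proof. by []. Qed.

Definition dist_lip (u : R[i] -> R) (L : R) :=
  forall z w, `|u z - u w| <= L * cm (z - w).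

End Modulus.
Arguments cm : simpl never.

Section LatticeSums.
Context {R : realType}.
Implicit Types (x y h s : R).

(** A discrete integral bound: [phi] acts as an antiderivative, the sum telescopes to a difference
    of two of its values, and the result does not depend on the number of terms. *)
Lemma sum_telescope_le (phi f : R -> R) (y0 h B : R) n :
  (forall y, f y <= phi (y + h) - phi y) -> (forall y, `|phi y| <= B) ->
  \sum_(a < n) f (y0 + a%:R * h) <= 2 * B.
Proof.
move=> hf hB.
have le : \sum_(a < n) f (y0 + a%:R * h) <= phi (y0 + n%:R * h) - phi y0.
  elim: n => [|n IH]; first by rewrite big_ord0 mul0r addr0 subrr.
  rewrite big_ord_recr /=.
  have := hf (y0 + n%:R * h).
  have -> : y0 + n%:R * h + h = y0 + n.+1%:R * h by rewrite mulrSr; ring.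
  by move: IH; lra.
have := hB (y0 + n%:R * h); have := hB y0; rewrite !ler_norml.
by move=> /andP[? ?] /andP[? ?]; lra.
Qed.

(** For [b >= 0] this is also an antiderivative of the indicator of [[-b, b]], which makes it the
    right [phi] for counting lattice points in an interval. *)
Definition clamp (b y : R) := Num.max (- b) (Num.min b y).

Lemma clamp_norm b y : 0 <= b -> `|clamp b y| <= b.
Proof.
move=> b0; rewrite ler_norml /clamp le_max lexx/= ge_max ge_min lexx /=.
by rewrite andbT; lra.
Qed.

Lemma clamp_nd b y y' : y <= y' -> clamp b y <= clamp b y'.
Proof. by move=> le; rewrite /clamp le_max2 ?le_min2. Qed.

Lemma clamp_id b y : `|y| <= b -> clamp b y = y.
Proof.
rewrite ler_norml => /andP[h1 h2]; rewrite /clamp (min_idPr _)// (max_idPr _)//.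
Qed.

Lemma clamp_hi b y : 0 <= b -> b <= y -> clamp b y = b.
Proof. by move=> b0 le; rewrite /clamp (min_idPl _)// (max_idPr _)//; lra. Qed.

Lemma clamp_lo b y : 0 <= b -> y <= - b -> clamp b y = - b.
Proof. by move=> b0 le; rewrite /clamp (min_idPr _) ?(max_idPl _)//; lra. Qed.

Lemma clamp_step b y h : 0 <= h -> clamp b (y + h) <= clamp b y + h.
Proof.
move=> h0; rewrite /clamp ge_max; apply/andP; split.
  by apply: (@le_trans _ _ (- b + h)); rewrite ?lerDl// lerD2r le_max lexx.
apply: (@le_trans _ _ (Num.min b y + h)); last by rewrite lerD2r le_max lexx orbT.
by rewrite ge_min; case: (leP b y) => _; rewrite ?lerDl ?h0 ?lexx ?orbT.
Qed.

Lemma sum_near_le (y0 h r : R) n : 0 < h -> h <= r ->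
  \sum_(a < n) h * (`|y0 + a%:R * h| < r)%R%:R <= 4 * r.
Proof.
move=> h0 hr.
apply: (@le_trans _ _ (2 * (2 * r))); last by lra.
(* The clamp is at [2 * r], not [r]: as [h <= r], a step that starts in []-r, r[] stays where the
   clamp is the identity. *)
apply: (@sum_telescope_le (clamp (2 * r)) (fun y => h * (`|y| < r)%R%:R)); last first.
  by move=> y; apply: clamp_norm; lra.
move=> y; case: ltP => [yr|_]; rewrite /= ?mulr1 ?mulr0.
  move: yr; rewrite ltr_norml => /andP[y1 y2].
  by rewrite !clamp_id ?ler_norml; [lra| apply/andP; split; lra|apply/andP; split; lra].
by rewrite subr_ge0 clamp_nd// lerDl ltW.
Qed.

(* An antiderivative of [1 / sqrt |y|]. *)
Definition sgsqrt y : R := 2 * (Num.sqrt (Num.max y 0) - Num.sqrt (Num.max (- y) 0)).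

Lemma sgsqrt_nd y y' : y <= y' -> sgsqrt y <= sgsqrt y'.
Proof.
move=> le; rewrite /sgsqrt ler_pM2l// lerB// ler_wsqrtr// le_max2// lerN2//.
Qed.

(** Let [a], [b] be the square roots at the two ends and [m = max(|y|, h)]. If the ends have the
    same sign, the increment of [sgsqrt] is [2 * h / (a + b)] with [a + b] at most [3 * sqrt m]. If
    the step crosses 0, then [m = h] and the increment is [2 * (a + b)] with
    [a ^+ 2 + b ^+ 2 = h]. *)
Lemma sgsqrt_step y h : 0 < h ->
  h / Num.sqrt (Num.max `|y| h) <= 2 * (sgsqrt (y + h) - sgsqrt y).
Proof.
move=> h0.
set m := Num.max `|y| h.
have m0 : 0 < m by rewrite lt_max h0 orbT.
have hm : h <= m by rewrite le_max lexx orbT.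
have ym : `|y| <= m by rewrite le_max lexx.
have [q0 qm] : 0 < Num.sqrt m /\ Num.sqrt m ^+ 2 = m.
  by rewrite sqrtr_gt0 m0 sqr_sqrtr// ltW.
set q := Num.sqrt m in q0 qm *.
rewrite ler_pdivrMr// /sgsqrt.
have sq2 (x : R) : 0 <= x -> Num.sqrt x ^+ 2 = x by exact: sqr_sqrtr.
case/orP: (le_total 0 y) => y0.
  rewrite (max_idPl _); last by lra.
  rewrite (max_idPr _); last by lra.
  rewrite (max_idPl _); last by lra.
  rewrite (max_idPr _); last by lra.
  rewrite sqrtr0 !subr0.
  have := sq2 _ y0; have yh0 : 0 <= y + h by lra.
  have := sq2 _ yh0.
  have a0 := sqrtr_ge0 (y + h); have b0 := sqrtr_ge0 y.
  move: a0 b0; set a := Num.sqrt (y + h); set b := Num.sqrt y => a0 b0 ea eb.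
  have yy : y <= m by move: ym; rewrite ger0_norm.
  have ab : b <= a by nra.
  have a2q : a <= 2 * q by nra.
  have b2q : b <= q by nra.
  nra.
case/orP: (le_total (y + h) 0) => yh0.
  rewrite (max_idPr _); last by lra.
  rewrite (max_idPl _); last by lra.
  rewrite (max_idPr _); last by lra.
  rewrite (max_idPl _); last by lra.
  rewrite sqrtr0 !sub0r.
  have y0' : 0 <= - y by lra.
  have yh0' : 0 <= - (y + h) by lra.
  have := sq2 _ y0'; have := sq2 _ yh0'.
  have a0 := sqrtr_ge0 (- (y + h)); have b0 := sqrtr_ge0 (- y).
  move: a0 b0; set a := Num.sqrt (- (y + h)); set b := Num.sqrt (- y) => a0 b0 ea eb.
  have yy : - y <= m by move: ym; rewrite ler0_norm.
  have ab : a <= b by nra.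
  have a2q : a <= q by nra.
  have b2q : b <= q by nra.
  nra.
rewrite (max_idPl _); last by lra.
rewrite (max_idPr _); last by lra.
rewrite (max_idPr _); last by lra.
rewrite (max_idPl _); last by lra.
rewrite sqrtr0 sub0r subr0.
have y0' : 0 <= - y by lra.
have yh0' : 0 <= (y + h) by lra.
have := sq2 _ y0'; have := sq2 _ yh0'.
have a0 := sqrtr_ge0 (y + h); have b0 := sqrtr_ge0 (- y).
move: a0 b0; set a := Num.sqrt (y + h); set b := Num.sqrt (- y) => a0 b0 ea eb.
have mh : m = h.
  apply/eqP; rewrite eq_le hm andbT ge_max lexx andbT ler0_norm//; lra.
have abq : q <= a + b by nra.
nra.
Qed.

Lemma sum_sqrt_le (y0 h s : R) n : 0 < h -> h <= s ->
  \sum_(a < n) h * ((`|y0 + a%:R * h| < s)%R%:R / Num.sqrt (Num.max `|y0 + a%:R * h| h))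
  <= 8 * Num.sqrt (2 * s).
Proof.
move=> h0 hs.
apply: (@le_trans _ _ (2 * (4 * Num.sqrt (2 * s)))); last by lra.
apply: (@sum_telescope_le (fun y => 2 * sgsqrt (clamp (2 * s) y))
  (fun y => h * ((`|y| < s)%R%:R / Num.sqrt (Num.max `|y| h)))).
  move=> y; case: ltP => [ys|_]; rewrite /= ?mul0r ?mulr0 ?mul1r; last first.
    by rewrite subr_ge0 ler_pM2l// sgsqrt_nd// clamp_nd// lerDl ltW.
  rewrite -mulrBr !clamp_id ?sgsqrt_step// ler_norml; move: ys; rewrite ltr_norml => /andP[? ?]; apply/andP; split; lra.
move=> y.
have : `|clamp (2 * s) y| <= 2 * s by apply: clamp_norm; lra.
rewrite ler_norml => /andP[c1 c2].
have m1 : Num.max (clamp (2 * s) y) 0 <= 2 * s by rewrite ge_max c2 /=; lra.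
have m2 : Num.max (- clamp (2 * s) y) 0 <= 2 * s.
  by rewrite ge_max; apply/andP; split; lra.
have := ler_wsqrtr m1; have := ler_wsqrtr m2.
have := sqrtr_ge0 (Num.max (clamp (2 * s) y) 0).
have := sqrtr_ge0 (Num.max (- clamp (2 * s) y) 0).
by rewrite /sgsqrt ler_norml => *; apply/andP; split; lra.
Qed.

End LatticeSums.

(** * A discrete Cauchy-Pompeiu formula *)

Section Kernel.
Context {R : realType}.
Implicit Types (x y t e h B : R) (z w : R[i]).

(** [1 / t] continued to the left of [e] by its tangent line at [e]: this removes the singularity
    and keeps the derivative [invcut' e] Lipschitz. *)
Definition invcut e t : R := if t <= e then (2 * e - t) / e ^+ 2 else t^-1.
Definition invcut' e t : R := if t <= e then - (e ^+ 2)^-1 else - (t ^+ 2)^-1.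
(** With [t = |z| ^+ 2] the integral over the plane is [2 * pi], the mass of twice the d-bar
    derivative of [1 / z], whatever [e > 0]. *)
Definition tent e t : R := 4 * Num.max 0 (e - t) / e ^+ 2.
(* [regker e] equals [1 / z] off the disc of radius [sqrt e] and is C^1 across its boundary;
   its d-bar derivative is [tent e / 2], supported in that disc. *)
Definition regker e z : R[i] :=
  let: x +i* y := z in let g := invcut e (x ^+ 2 + y ^+ 2) in (x * g) +i* (- (y * g)).
Arguments regker : simpl never.

(** Off [e] the second derivative is at most [2 / e ^+ 3], and the first one is continuous at [e].
    The four cases record on which side of [e] the two points lie. *)
Lemma invcut_taylor e t t' : 0 < e -> 0 <= t -> 0 <= t' ->
  `|invcut e t' - invcut e t - invcut' e t * (t' - t)| <= (t' - t) ^+ 2 / e ^+ 3.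
Proof.
move=> e0 t0 t'0; rewrite /invcut /invcut'.
have e3 : 0 < e ^+ 3 by rewrite exprn_gt0.
have en : e != 0 by rewrite gt_eqF.
have [te|te] := leP t e; have [t'e|t'e] := leP t' e.
- have -> : (2 * e - t') / e ^+ 2 - (2 * e - t) / e ^+ 2 - - (e ^+ 2)^-1 * (t' - t) = 0.
    by field.
  by rewrite normr0 divr_ge0 ?sqr_ge0// ltW.
- have t'p : 0 < t' by lra.
  have -> : t'^-1 - (2 * e - t) / e ^+ 2 - - (e ^+ 2)^-1 * (t' - t)
         = (t' - e) ^+ 2 / (t' * e ^+ 2).
    by field; rewrite en gt_eqF.
  rewrite ger0_norm; last by rewrite divr_ge0 ?sqr_ge0// mulr_ge0 ?sqr_ge0.
  apply: ler_pM; rewrite ?sqr_ge0 ?invr_ge0 ?mulr_ge0 ?(ltW e0)//.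
by rewrite ler_sqr ?nnegrE; lra.
  rewrite lef_pV2 ?posrE ?mulr_gt0 ?exprn_gt0//.
  by rewrite exprS ler_wpM2r ?sqr_ge0// ltW.
- have tp : 0 < t by lra.
  have -> : (2 * e - t') / e ^+ 2 - t^-1 - - (t ^+ 2)^-1 * (t' - t)
     = (t - e) * (t * (e - t') + e * (t - t')) / (e ^+ 2 * t ^+ 2).
    by field; rewrite en gt_eqF.
  have h1 : 0 <= (t - e) * (t * (e - t') + e * (t - t')).
    by apply: mulr_ge0; [lra | apply: addr_ge0; apply: mulr_ge0; lra].
  rewrite ger0_norm; last by rewrite divr_ge0 // mulr_ge0 ?sqr_ge0.
  have -> : (t' - t) ^+ 2 / e ^+ 3 = (t' - t) ^+ 2 * t ^+ 2 / e / (e ^+ 2 * t ^+ 2).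
    by field; rewrite en gt_eqF.
  rewrite ler_pM2r ?invr_gt0 ?mulr_gt0 ?exprn_gt0// ler_pdivlMr//.
  have b0 : 0 <= t - e by lra.
  have a0 : 0 <= e - t' by lra.
  have -> : (t' - t) ^+ 2 = (e - t' + (t - e)) ^+ 2 by ring.
  have -> : t - t' = (t - e) + (e - t') by ring.
  move: (t - e) (e - t') b0 a0 => b a b0 a0.
  have le1 : t * a + e * (b + a) <= t * (2 * a + b).
    have : e * (b + a) <= t * (b + a) by apply: ler_wpM2r; lra.
    by lra.
  have le2 : (t * a + e * (b + a)) * e <= t * (2 * a + b) * t.
    by apply: ler_pM; rewrite ?addr_ge0 ?mulr_ge0 ?addr_ge0// ltW.
  rewrite -mulrA; apply: (le_trans (ler_wpM2l b0 le2)).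
  have -> : b * (t * (2 * a + b) * t) = (b * (2 * a + b)) * t ^+ 2 by ring.
  rewrite ler_wpM2r ?sqr_ge0//; nra.
- have tp : 0 < t by lra.
  have t'p : 0 < t' by lra.
  have -> : t'^-1 - t^-1 - - (t ^+ 2)^-1 * (t' - t) = (t' - t) ^+ 2 / (t' * t ^+ 2).
    by field; rewrite !gt_eqF.
  rewrite ger0_norm; last by rewrite divr_ge0 ?sqr_ge0// mulr_ge0 ?sqr_ge0// ltW.
  apply: ler_wpM2l; rewrite ?sqr_ge0//.
  rewrite lef_pV2 ?posrE ?mulr_gt0 ?exprn_gt0// exprS.
  apply: ler_pM; rewrite ?sqr_ge0 ?ltW// ltr_sqr ?nnegrE; lra.
Qed.

Lemma invcut'_norm e t : 0 < e -> `|invcut' e t| <= (e ^+ 2)^-1.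
Proof.
move=> e0; rewrite /invcut'; have [te|te] := leP t e; rewrite normrN ger0_norm ?invr_ge0 ?sqr_ge0//.
rewrite lef_pV2 ?posrE ?exprn_gt0//; last by lra.
by rewrite ler_sqr ?nnegrE; lra.
Qed.

Lemma invcut_ge0 e t : 0 < e -> 0 <= t -> 0 <= invcut e t.
Proof.
move=> e0 t0; rewrite /invcut; have [te|te] := leP t e; rewrite ?invr_ge0//.
by rewrite divr_ge0 ?sqr_ge0//; lra.
Qed.

(** The left side is twice the derivative of [t * invcut e t]; with [t = |z| ^+ 2] it is
    [d/dx + i d/dy] applied to the kernel [regker e]. *)
Lemma invcut_tentE e t : 0 < e -> 0 <= t ->
  2 * invcut e t + 2 * t * invcut' e t = tent e t.
Proof.
move=> e0 t0; rewrite /invcut /invcut' /tent.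
have [te|te] := leP t e.
  rewrite (max_idPr _); last by lra.
  by field; rewrite gt_eqF.
rewrite (max_idPl _); last by lra.
by rewrite mulr0 mul0r; field; rewrite gt_eqF//; lra.
Qed.

Lemma tent_ge0 e t : 0 <= tent e t.
Proof. by rewrite /tent divr_ge0 ?sqr_ge0// mulr_ge0// le_max lexx. Qed.

Lemma tent_eq0 e t : e <= t -> tent e t = 0.
Proof. by move=> et; rewrite /tent (max_idPl _) ?mulr0 ?mul0r//; lra. Qed.

Lemma tent_lip e t t' : 0 < e -> `|tent e t - tent e t'| <= 4 * `|t - t'| / e ^+ 2.
Proof.
move=> e0; rewrite /tent -mulrBl normrM.
rewrite (ger0_norm (x := _^-1)) ?invr_ge0 ?sqr_ge0//.
rewrite ler_wpM2r ?invr_ge0 ?sqr_ge0// -mulrBr normrM ger0_norm//.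
rewrite ler_pM2l//.
case: (leP 0 (e - t)) => h1; case: (leP 0 (e - t')) => h2;
  rewrite ?subr0 ?sub0r ?subrr ?normr0 ?normrN//.
- by rewrite distrC (_ : e - t' - (e - t) = t - t'); [|ring].
- by rewrite ger0_norm// distrC ger0_norm; lra.
- by rewrite ger0_norm// ger0_norm; lra.
Qed.

Lemma tent_lower e t : 0 < e -> t <= e / 2 -> 2 / e <= tent e t.
Proof.
move=> e0 te; rewrite /tent (max_idPr _); last by lra.
rewrite ler_pdivlMr ?exprn_gt0// expr2 mulrA divfK ?gt_eqF//; lra.
Qed.

Lemma regkerE e z : 0 < e -> e <= cm z ^+ 2 -> regker e z = z^-1.
Proof.
case: z => x y e0; rewrite sqr_cm /regker /invcut => le.
have t0 : 0 < x ^+ 2 + y ^+ 2 by lra.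
suff -> : (if x ^+ 2 + y ^+ 2 <= e then (2 * e - (x ^+ 2 + y ^+ 2)) / e ^+ 2
   else (x ^+ 2 + y ^+ 2)^-1) = (x ^+ 2 + y ^+ 2)^-1.
  by apply/eqP; rewrite eq_complex /= !eqxx.
case: leP => // le'; have -> : x ^+ 2 + y ^+ 2 = e by lra.
by field; rewrite gt_eqF.
Qed.

Lemma cm_regker e z : 0 < e -> cm (regker e z) = cm z * invcut e (cm z ^+ 2).
Proof.
case: z => x y e0; rewrite sqr_cm /regker.
have t0 : 0 <= x ^+ 2 + y ^+ 2 by rewrite addr_ge0 ?sqr_ge0.
set g := invcut _ _; have g0 : 0 <= g by apply: invcut_ge0.
rewrite !cmE sqrrN !exprMn -mulrDl sqrtrM// sqrtr_sqr ger0_norm//.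
Qed.

(** The inequality [|z| ^+ 2 * invcut e (|z| ^+ 2) <= 1] gives the bound [1 / |z|] everywhere. The
    second alternative covers points nearer than [m], where the smoothing caps the kernel at
    [2 / sqrt e]. *)
Lemma cm_regker_le e m z : 0 < e -> 0 < m ->
  m <= cm z \/ (2 * m) ^+ 2 <= e -> cm (regker e z) <= m^-1.
Proof.
move=> e0 m0 H; rewrite cm_regker// -[leRHS]mul1r ler_pdivlMr//.
have q0 := cm_ge0 z; set q := cm z in q0 H *.
have qg : q * q * invcut e (q ^+ 2) <= 1.
  rewrite /invcut -expr2; have [le|le] := leP (q ^+ 2) e.
    rewrite mulrA ler_pdivrMr ?exprn_gt0// mul1r; nra.
  by rewrite divff// gt_eqF//; lra.
have g0 : 0 <= invcut e (q ^+ 2) by rewrite invcut_ge0// sqr_ge0.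
case: H => [mq|me].
  apply: le_trans qg; rewrite mulrAC ler_wpM2r// ler_wpM2l//.
have [le|le] := leP (q ^+ 2) e; last first.
  apply: le_trans qg; rewrite mulrAC ler_wpM2r// ler_wpM2l//.
  rewrite -(@ler_pXn2r _ 2)// ?nnegrE//; nra.
rewrite /invcut le mulrAC mulrA ler_pdivrMr ?exprn_gt0// mul1r.
apply: (@le_trans _ _ (q * m * 2 * e)).
  rewrite -(mulrA (q * m)); apply: ler_wpM2l; last by nra.
  by rewrite mulr_ge0// ltW.
have : q * m * 2 <= e.
  have : (q * (2 * m)) ^+ 2 <= e ^+ 2.
    by rewrite exprMn [leRHS]expr2; apply: ler_pM; rewrite ?sqr_ge0.
  rewrite ler_pXn2r// ?nnegrE ?mulr_ge0//; lra.
nra.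
Qed.

(** Forward differences reproduce [d/dx + i d/dy] of the kernel up to order [h ^+ 2]. In the
    constants, [10 = 8 + 2] collects the terms with [invcut'] in the real and the imaginary part;
    [54 = 6 * 9] comes from Taylor remainders of size [9 * B ^+ 2 * h ^+ 2 / e ^+ 3] with total
    weight [6 * B]. *)
Lemma regker_discrete_dbar e B h x y : 0 < e -> 0 < h -> h <= 1 -> 1 <= B ->
  `|x| <= B -> `|y| <= B ->
  cm (regker e ((x + h) +i* y) - regker e (x +i* y)
     + 'i * (regker e (x +i* (y + h)) - regker e (x +i* y))
     - (h * tent e (x ^+ 2 + y ^+ 2))%:C)
  <= h ^+ 2 * (10 * B / e ^+ 2 + 54 * B ^+ 3 / e ^+ 3).
Proof.
move=> e0 h0 h1 B1; rewrite !ler_norml => /andP[x1 x2] /andP[y1 y2].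
have := @invcut_tentE e (x ^+ 2 + y ^+ 2) e0.
have t0 : 0 <= x ^+ 2 + y ^+ 2 by rewrite addr_ge0 ?sqr_ge0.
move=> /(_ t0) <-.
have := @invcut_taylor e (x ^+ 2 + y ^+ 2) ((x + h) ^+ 2 + y ^+ 2) e0 t0.
rewrite addr_ge0 ?sqr_ge0// => /(_ isT).
have := @invcut_taylor e (x ^+ 2 + y ^+ 2) (x ^+ 2 + (y + h) ^+ 2) e0 t0.
rewrite addr_ge0 ?sqr_ge0// => /(_ isT).
have := @invcut'_norm e (x ^+ 2 + y ^+ 2) e0.
rewrite /regker.
set g0 := invcut e (x ^+ 2 + y ^+ 2).
set g1 := invcut e ((x + h) ^+ 2 + y ^+ 2).
set g2 := invcut e (x ^+ 2 + (y + h) ^+ 2).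
set g' := invcut' e (x ^+ 2 + y ^+ 2).
have -> : (x + h) ^+ 2 + y ^+ 2 - (x ^+ 2 + y ^+ 2) = (2 * x + h) * h by ring.
have -> : x ^+ 2 + (y + h) ^+ 2 - (x ^+ 2 + y ^+ 2) = (2 * y + h) * h by ring.
set e1 := g1 - g0 - g' * ((2 * x + h) * h).
set e2 := g2 - g0 - g' * ((2 * y + h) * h).
move=> G' E2 E1.
have a0 : 0 <= (e ^+ 2)^-1 by rewrite invr_ge0 sqr_ge0.
have b0 : 0 <= (e ^+ 3)^-1 by rewrite invr_ge0 exprn_ge0// ltW.
set a := (e ^+ 2)^-1 in a0 G' *; set b := (e ^+ 3)^-1 in b0 E1 E2 *.
have bd v : - B <= v -> v <= B -> ((2 * v + h) * h) ^+ 2 * b <= 9 * B ^+ 2 * b * h ^+ 2.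
  move=> v1 v2.
  have -> : 9 * B ^+ 2 * b * h ^+ 2 = (3 * B * h) ^+ 2 * b by ring.
  have nb : `|(2 * v + h) * h| <= 3 * B * h.
    by rewrite ler_norml; apply/andP; split; nra.
  rewrite ler_wpM2r//; have := ler_pM (normr_ge0 _) (normr_ge0 _) nb nb.
  by rewrite -!expr2 real_normK ?num_real.
have {E1} E1 := le_trans E1 (bd x x1 x2).
have {E2} E2 := le_trans E2 (bd y y1 y2).
have h20 : 0 <= h ^+ 2 by exact: sqr_ge0.
have prod_le u v c d : `|u| <= c -> `|v| <= d -> `|u * v| <= c * d.
  by move=> ? ?; rewrite normrM; apply: ler_pM.
have nB v : - B <= v -> v <= B -> `|v| <= B by move=> ? ?; rewrite ler_norml; apply/andP.
set E := 9 * B ^+ 2 * b * h ^+ 2 in E1 E2.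
apply: le_trans (cm_le_ReIm _) _.
have -> : complex.Re ((((x + h) * g1) +i* (- (y * g1))) - ((x * g0) +i* (- (y * g0)))
   + 'i * ((x * g2) +i* (- ((y + h) * g2)) - (x * g0) +i* (- (y * g0)))
   - (h * (2 * g0 + 2 * (x ^+ 2 + y ^+ 2) * g'))%:C)
   = g' * (h ^+ 2 * (3 * x + 3 * y + 2 * h)) + (x + h) * e1 + (y + h) * e2.
  by rewrite /e1 /e2 /=; ring.
have -> : complex.Im ((((x + h) * g1) +i* (- (y * g1))) - ((x * g0) +i* (- (y * g0)))
   + 'i * ((x * g2) +i* (- ((y + h) * g2)) - (x * g0) +i* (- (y * g0)))
   - (h * (2 * g0 + 2 * (x ^+ 2 + y ^+ 2) * g'))%:C)
   = g' * (h ^+ 2 * (x - y)) + x * e2 - y * e1.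
  by rewrite /e1 /e2 /=; ring.
have R1 : `|g' * (h ^+ 2 * (3 * x + 3 * y + 2 * h))| <= a * (h ^+ 2 * (8 * B)).
  apply: (prod_le) => //; apply: (prod_le); first by rewrite ger0_norm.
  by rewrite ler_norml; apply/andP; split; lra.
have R2 : `|(x + h) * e1| <= 2 * B * E.
  by apply: (prod_le) => //; rewrite ler_norml; apply/andP; split; lra.
have R3 : `|(y + h) * e2| <= 2 * B * E.
  by apply: (prod_le) => //; rewrite ler_norml; apply/andP; split; lra.
have I1 : `|g' * (h ^+ 2 * (x - y))| <= a * (h ^+ 2 * (2 * B)).
  apply: (prod_le) => //; apply: (prod_le); first by rewrite ger0_norm.
  by rewrite ler_norml; apply/andP; split; lra.
have I2 : `|x * e2| <= B * E by apply: (prod_le) => //; apply: nB.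
have I3 : `|y * e1| <= B * E by apply: (prod_le) => //; apply: nB.
have := ler_normD (g' * (h ^+ 2 * (3 * x + 3 * y + 2 * h)) + (x + h) * e1) ((y + h) * e2).
have := ler_normD (g' * (h ^+ 2 * (3 * x + 3 * y + 2 * h))) ((x + h) * e1).
have := ler_normB (g' * (h ^+ 2 * (x - y)) + x * e2) (y * e1).
have := ler_normD (g' * (h ^+ 2 * (x - y))) (x * e2).
have -> : h ^+ 2 * (10 * B * a + 54 * B ^+ 3 * b) =
  a * (h ^+ 2 * (8 * B)) + a * (h ^+ 2 * (2 * B)) + 2 * B * E + 2 * B * E + B * E + B * E.
  by rewrite /E; ring.
lra.
Qed.

End Kernel.
Arguments regker : simpl never.

(** * Summation by parts, and sums under translation of the lattice *)

Section Periodic.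
Context {R : realType}.
Implicit Types (x y t h : R).

(** Abel summation; the shifted copy [k'] avoids speaking of [k] at index [-1]. *)
Lemma sum_parts (A : comRingType) (u k k' : nat -> A) n :
  u 0%N = 0 -> u n = 0 -> (forall a, k' a.+1 = k a) ->
  \sum_(a < n) (u a.+1 - u a) * k a = \sum_(a < n) u a * (k' a - k a).
Proof.
move=> u0 un kk.
under eq_bigr do rewrite mulrBl.
under [RHS]eq_bigr do rewrite mulrBr.
rewrite !big_split/= !sumrN; congr (_ - _).
under eq_bigr do rewrite -kk.
have := erefl (\sum_(a < n.+1) u a * k' a).
by rewrite [in LHS]big_ord_recl [in RHS]big_ord_recr /= u0 un !mul0r add0r addr0.
Qed.

Lemma sum_shift (t : R -> R) h n x :
  \sum_(a < n) t (x + h - a%:R * h) + t (x + h - n%:R * h)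
  = \sum_(a < n) t (x - a%:R * h) + t (x + h).
Proof.
have := erefl (\sum_(a < n.+1) t (x + h - a%:R * h)).
rewrite [in LHS]big_ord_recr [in RHS]big_ord_recl /= mul0r subr0 => ->.
rewrite addrC; congr (_ + _).
by apply: eq_bigr => a _; rewrite /bump /= add1n mulrSr; congr (t _); ring.
Qed.

(** By [sum_shift] a translation by one step trades one end term for another, and both lie outside
    the support of [t] while the centre keeps its distance [r] from the ends of the grid. *)
Lemma sum_periodic (t : R -> R) h r n k x : 0 <= h ->
  (forall y, r <= `|y| -> t y = 0) ->
  r <= x -> x + k%:R * h <= n%:R * h - r ->
  \sum_(a < n) t (x + k%:R * h - a%:R * h) = \sum_(a < n) t (x - a%:R * h).
Proof.
move=> h0 t0 rx; elim: k => [|k IH] xk; first by rewrite mul0r addr0.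
rewrite mulrSr in xk.
have kh : 0 <= k%:R * h by rewrite mulr_ge0.
rewrite -IH; last by lra.
have := sum_shift t h n (x + k%:R * h).
rewrite [X in _ + X = _]t0; last by rewrite ler_normr; apply/orP; right; lra.
rewrite [X in _ = _ + X]t0; last by rewrite ler_normr; apply/orP; left; lra.
by rewrite !addr0 => <-; apply: eq_bigr => a _; rewrite mulrSr mulrDl mul1r addrA.
Qed.

(** With the clamp lowered to [r - h], a step that starts outside [[-r, r]] contributes nothing even
    when it moves towards the interval. *)
Lemma sum_near_ge (y0 h r : R) n : 0 < h -> h <= r ->
  y0 <= - (r - h) -> r - h <= y0 + n%:R * h ->
  2 * (r - h) <= \sum_(a < n) h * (`|y0 + a%:R * h| <= r)%R%:R.
Proof.
move=> h0 hr yl yr.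
have le m : clamp (r - h) (y0 + m%:R * h) - clamp (r - h) y0
   <= \sum_(a < m) h * (`|y0 + a%:R * h| <= r)%R%:R.
  elim: m => [|m IH]; first by rewrite big_ord0 mul0r addr0 subrr.
  rewrite big_ord_recr /=.
  have -> : y0 + m.+1%:R * h = y0 + m%:R * h + h by rewrite mulrSr; ring.
  move: IH; set y := y0 + m%:R * h => IH.
  suff : clamp (r - h) (y + h) - clamp (r - h) y <= h * (`|y| <= r)%R%:R by lra.
  have [_|yr'] := leP `|y| r; first by rewrite mulr1 lerBlDl clamp_step ?ltW.
  rewrite mulr0 subr_le0; move: yr'; rewrite ltNge ler_norml negb_and -!ltNge.
  by case/orP => yr'; [rewrite !clamp_lo|rewrite !clamp_hi]; lra.
have := le n.
by rewrite clamp_hi ?clamp_lo; lra.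
Qed.

Lemma sum_near_center (h r B X : R) n : 0 < h -> n%:R * h = 2 * X ->
  0 < r -> r + B <= X -> 0 <= B -> 4 * h <= r ->
  r / 2 <= \sum_(a < n) h * (`|(B - X) + a%:R * h| <= r / 2)%R%:R.
Proof.
move=> h0 nh r0 rB B0 hr.
have := @sum_near_ge (B - X) h (r / 2) n h0; rewrite nh => H.
by apply: le_trans _ (H _ _ _); lra.
Qed.

End Periodic.

(** * Riemann sums of the tent over a square lattice *)

Section LatticePlane.
Context {R : realType} (X h e : R) (n : nat).
Hypotheses (h_gt0 : 0 < h) (h_le1 : h <= 1) (e_gt0 : 0 < e) (nhE : n%:R * h = 2 * X)
  (X_ge1 : 1 <= X).

Implicit Types (x y r B c : R) (k l a b : nat).

(** A Riemann sum for the integral of the tent centred at [(x, y)], which is [2 * pi]. The exact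
    value is never computed: near independence of the centre and the lower bound [1 / 2] are enough
    to normalise the Cauchy formula. *)
Definition tentsum (x y : R) : R :=
  \sum_(a < n) \sum_(b < n)
    h ^+ 2 * tent e ((x + X - a%:R * h) ^+ 2 + (y + X - b%:R * h) ^+ 2).

Lemma tentsum_ge0 x y : 0 <= tentsum x y.
Proof.
by rewrite !sumr_ge0// => a _; rewrite sumr_ge0// => b _; rewrite mulr_ge0 ?sqr_ge0 ?tent_ge0.
Qed.

Lemma tentsumC x y : tentsum x y = tentsum y x.
Proof.
rewrite /tentsum exchange_big; apply: eq_bigr => a _; apply: eq_bigr => b _.
by rewrite addrC.
Qed.

Lemma sum_lattice_const (c : R) : \sum_(a < n) \sum_(b < n) h ^+ 2 * c = (2 * X) ^+ 2 * c.
Proof.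
by rewrite !sumr_const !card_ord -[LHS]mulr_natr -[X in X * _ = _]mulr_natr -nhE; ring.
Qed.

Lemma tentsum_shift1 r k x y : 0 <= r -> e = r ^+ 2 ->
  r - X <= x -> x + k%:R * h <= X - r -> tentsum (x + k%:R * h) y = tentsum x y.
Proof.
move=> r0 er xl xr.
have := @sum_periodic R (fun v => \sum_(b < n)
    h ^+ 2 * tent e (v ^+ 2 + (y + X - b%:R * h) ^+ 2)) h r n k (x + X).
rewrite nhE (ltW h_gt0) => /(_ isT) H.
rewrite /tentsum -H; [|move=> v rv|lra|lra].
  by apply: eq_bigr => a _; apply: eq_bigr => b _; do 3 congr (_ _ _); ring.
apply: big1 => b _; rewrite tent_eq0 ?mulr0// er.
have : r ^+ 2 <= v ^+ 2.
  by rewrite -[leRHS]real_normK ?num_real// ler_pXn2r ?nnegrE.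
have := sqr_ge0 (y + X - b%:R * h); lra.
Qed.

Lemma tentsum_shift r k l x y : 0 <= r -> e = r ^+ 2 ->
  r - X <= x -> x + k%:R * h <= X - r ->
  r - X <= y -> y + l%:R * h <= X - r ->
  tentsum (x + k%:R * h) (y + l%:R * h) = tentsum x y.
Proof.
move=> *; rewrite (@tentsum_shift1 r)// tentsumC (@tentsum_shift1 r)//.
exact: tentsumC.
Qed.

Lemma lattice_norm_le (a : 'I_n) : 0 <= a%:R * h <= 2 * X.
Proof.
by rewrite mulr_ge0 ?(ltW h_gt0)//= -nhE ler_pM2r// ler_nat ltnW.
Qed.

Lemma tentsum_cont B x y x' y' : B <= X -> `|x| <= B -> `|y| <= B ->
  0 <= x' <= h -> 0 <= y' <= h -> `|x + x'| <= B -> `|y + y'| <= B ->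
  `|tentsum (x + x') (y + y') - tentsum x y| <= h * ((2 * X) ^+ 2 * (4 * (16 * X) / e ^+ 2)).
Proof.
move=> BX xB yB x'h y'h xB' yB'.
rewrite -sumrB; apply: le_trans (ler_norm_sum _ _ _) _.
rewrite mulrCA -sum_lattice_const; apply: ler_sum => a _.
rewrite -sumrB; apply: le_trans (ler_norm_sum _ _ _) _; apply: ler_sum => b _.
rewrite -mulrBr normrM ger0_norm ?sqr_ge0// ler_wpM2l ?sqr_ge0//.
apply: le_trans (tent_lip _ _ e_gt0) _.
rewrite [leRHS]mulrA ler_wpM2r ?invr_ge0 ?sqr_ge0// [leRHS]mulrCA ler_pM2l//.
have /andP[a0 a1] := lattice_norm_le a; have /andP[b0 b1] := lattice_norm_le b.
move: xB yB xB' yB'; do 4 (rewrite ler_norml => /andP[? ?]).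
move/andP: x'h => [? ?]; move/andP: y'h => [? ?].
have key u v : - (2 * X) <= u -> u <= 2 * X -> - (2 * X) <= u + v -> u + v <= 2 * X ->
   0 <= v -> v <= h -> `|(u + v) ^+ 2 - u ^+ 2| <= h * (4 * X).
  move=> *; have -> : (u + v) ^+ 2 - u ^+ 2 = v * ((u + v) + u) by ring.
  rewrite normrM; apply: ler_pM => //; first by rewrite ger0_norm.
  by rewrite ler_norml; apply/andP; split; lra.
have k1 := key (x + X - a%:R * h) x'; have k2 := key (y + X - b%:R * h) y'.
have -> : (x + x' + X - a%:R * h) ^+ 2 + (y + y' + X - b%:R * h) ^+ 2 -
   ((x + X - a%:R * h) ^+ 2 + (y + X - b%:R * h) ^+ 2) =
  ((x + X - a%:R * h + x') ^+ 2 - (x + X - a%:R * h) ^+ 2) +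
  ((y + X - b%:R * h + y') ^+ 2 - (y + X - b%:R * h) ^+ 2) by ring.
apply: le_trans (ler_normD _ _) _.
apply: (@le_trans _ _ (h * (4 * X) + h * (4 * X))); last by nra.
by apply: lerD; [apply: k1|apply: k2]; lra.
Qed.

Lemma ex_lattice_below B x : - B <= x ->
  exists k (x' : R), [/\ x = - B + x' + k%:R * h, 0 <= x' & x' <= h].
Proof.
move=> Bx.
have q0 : 0 <= (x + B) / h by rewrite divr_ge0 ?(ltW h_gt0)//; lra.
exists (Num.truncn ((x + B) / h)), (x + B - (Num.truncn ((x + B) / h))%:R * h).
have /andP[] := truncn_itv q0; rewrite ler_pdivlMr// ltr_pdivrMr// => h1 h2.
by split; [ring|lra|move: h2; rewrite mulrSr; lra].
Qed.

(** Every point considered is a lattice translate of a point in the cell at the corner [(- B, - B)].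
    The translation changes nothing, so only the oscillation over one cell remains. *)
Lemma tentsum_const B r x y : 0 <= r -> e = r ^+ 2 -> r + B <= X -> h <= B ->
  `|x| <= B -> `|y| <= B ->
  `|tentsum x y - tentsum (- B) (- B)| <= h * ((2 * X) ^+ 2 * (4 * (16 * X) / e ^+ 2)).
Proof.
move=> r0 er rB hB; rewrite !ler_norml => /andP[x1 x2] /andP[y1 y2].
have [k [x' [ex x'0 x'h]]] := ex_lattice_below x1.
have [l [y' [ey y'0 y'h]]] := ex_lattice_below y1.
rewrite -ler_norml ex ey (@tentsum_shift r)//; [|lra|lra|lra|lra].
have B0 : 0 <= B by lra.
apply: (@tentsum_cont B); rewrite ?normrN ?(ger0_norm B0) ?x'0 ?y'0 ?x'h ?y'h//; first by lra.
all: by rewrite ler_norml; apply/andP; split; lra.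
Qed.

(** On the square of half-side [r / 2] about the centre the tent is at least [2 / e], and the
    lattice points there weigh at least [(r / 2) ^+ 2]; the product is [1 / 2] since
    [e = r ^+ 2]. *)
Lemma tentsum_ge B r : 0 < r -> e = r ^+ 2 -> r + B <= X -> 0 <= B -> 4 * h <= r ->
  2^-1 <= tentsum (- B) (- B).
Proof.
move=> r0 er rB B0 hr.
set S := \sum_(a < n) h * (`|(B - X) + a%:R * h| <= r / 2)%R%:R.
have S_ge : r / 2 <= S by exact: sum_near_center h_gt0 nhE r0 rB B0 hr.
have S0 : 0 <= S by rewrite (le_trans _ S_ge)// divr_ge0// ltW.
apply: (@le_trans _ _ (S * S * (2 / e))).
  apply: (@le_trans _ _ (r / 2 * (r / 2) * (2 / e))).
    by rewrite er le_eqVlt; apply/orP; left; apply/eqP; field; rewrite gt_eqF.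
  rewrite ler_wpM2r ?divr_ge0 ?(ltW e_gt0)//; apply: ler_pM => //; rewrite divr_ge0 ?(ltW r0)//.
rewrite /tentsum mulr_suml mulr_suml; apply: ler_sum => a _.
rewrite mulr_sumr mulr_suml; apply: ler_sum => b _.
have -> (u v c : R) : h * u * (h * v) * c = h ^+ 2 * (u * v * c) by ring.
rewrite ler_wpM2l ?sqr_ge0//.
have [h1|_] := leP (`|_|) _; last by rewrite mul0r mul0r tent_ge0.
have [h2|_] := leP (`|_|) _; last by rewrite mulr0 mul0r tent_ge0.
rewrite !mul1r tent_lower//.
have le (v : R) : `|B - X + v| <= r / 2 -> (- B + X - v) ^+ 2 <= r ^+ 2 / 4.
  rewrite ler_norml => /andP[? ?]; nra.
by have := le _ h1; have := le _ h2; rewrite er; lra.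
Qed.

End LatticePlane.

(** * Lattice points in discs, and the formula for a Lipschitz function *)

Section DiscreteCauchy.
Context {R : realType}.
Implicit Types (x y h e s r X L B : R) (z w : R[i]).

Definition lpt (x0 y0 h : R) (a b : nat) : R[i] := (x0 + a%:R * h) +i* (y0 + b%:R * h).

Lemma real_complexB x y : (x - y)%:C = x%:C - y%:C :> R[i].
Proof. exact: rmorphB. Qed.
Lemma real_complexD x y : (x + y)%:C = x%:C + y%:C :> R[i].
Proof. exact: rmorphD. Qed.
Lemma real_complexM x y : (x * y)%:C = x%:C * y%:C :> R[i].
Proof. exact: rmorphM. Qed.
Lemma real_complex_sum (I : Type) (r : seq I) (F : I -> R) :
  (\sum_(i <- r) F i)%:C = \sum_(i <- r) (F i)%:C :> R[i].
Proof. exact: rmorph_sum. Qed.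

Definition in_discs (s : seq (R[i] * R)) z := has (fun p => cm (z - p.1) < p.2) s.

(** A disc lies in a square, and [sum_near_le] gives at most [4 * p.2] in each direction. The mesh
    may not exceed the radii, because a very small disc can still hold a lattice point. *)
Lemma sum_in_discs_le x0 y0 h n (s : seq (R[i] * R)) : 0 < h ->
  (forall p, p \in s -> h <= p.2) ->
  \sum_(a < n) \sum_(b < n) h ^+ 2 * (in_discs s (lpt x0 y0 h a b))%:R
  <= 16 * \sum_(p <- s) p.2 ^+ 2.
Proof.
move=> h0; elim: s => [|p s IH] hs.
  rewrite [X in 16 * X]big_nil [leRHS]mulr0; apply: sumr_le0 => a _; apply: sumr_le0 => b _.
  by rewrite /= mulr0.
have hp : h <= p.2 by apply: hs; rewrite mem_head.
have {}IH := IH (fun q qs => hs q (mem_behead (s := p :: s) qs)).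
rewrite big_cons mulrDr.
apply: le_trans (lerD _ IH).
  instantiate (1 := \sum_(a < n) \sum_(b < n) h ^+ 2 * (cm (lpt x0 y0 h a b - p.1) < p.2)%R%:R).
  rewrite -big_split; apply: ler_sum => a _; rewrite -big_split; apply: ler_sum => b _.
  rewrite /= -mulrDr ler_wpM2l ?sqr_ge0// -natrD ler_nat.
  by case: (_ < _)%R => //=; case: in_discs.
apply: (@le_trans _ _ ((4 * p.2) * (4 * p.2))); last by rewrite le_eqVlt; apply/orP; left; apply/eqP; ring.
have H1 := @sum_near_le R (x0 - complex.Re p.1) h p.2 n h0 hp.
have H2 := @sum_near_le R (y0 - complex.Im p.1) h p.2 n h0 hp.
apply: le_trans (ler_pM _ _ H1 H2); last 2 first.
- by apply: sumr_ge0 => a _; rewrite mulr_ge0// ltW.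
- by apply: sumr_ge0 => a _; rewrite mulr_ge0// ltW.
rewrite mulr_suml; apply: ler_sum => a _; rewrite mulr_sumr; apply: ler_sum => b _.
have -> (u v : R) : h * u * (h * v) = h ^+ 2 * (u * v) by ring.
rewrite ler_wpM2l ?sqr_ge0// -natrM ler_nat.
case: ltP => //= lt.
have := le_lt_trans (Re_le_cm _) lt; have := le_lt_trans (Im_le_cm _) lt.
case: (p.1) => c d /=.
have -> : x0 + a%:R * h - c = x0 - c + a%:R * h by ring.
have -> : y0 + b%:R * h - d = y0 - d + b%:R * h by ring.
by move=> -> ->.
Qed.

(** Lattice bound for the Cauchy transform of a set [U]. Where a coordinate of the offset is at
    least [s], the kernel is at most [1 / s]. Elsewhere [1 / max(|x|, |y|) <= 1 / (sqrt |x| * sqrt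
    |y|)], with both moduli capped below by [h], splits the double sum into two simple ones, each at
    most [8 * sqrt (2 * s)]. *)
Lemma sum_regker_le x0 y0 h e s n (U : nat -> nat -> bool) z :
  0 < h -> h <= s -> (2 * h) ^+ 2 <= e ->
  \sum_(a < n) \sum_(b < n) h ^+ 2 * ((U a b)%:R * cm (regker e (z - lpt x0 y0 h a b)))
  <= 128 * s + s^-1 * \sum_(a < n) \sum_(b < n) h ^+ 2 * (U a b)%:R.
Proof.
move=> h0 hs he; have s0 : 0 < s by lra.
have e0 : 0 < e by apply: lt_le_trans he; rewrite exprn_gt0// mulr_gt0.
case: z => x y.
pose f (c : R) (a : nat) := (`|c - a%:R * h| < s)%R%:R / Num.sqrt (Num.max `|c - a%:R * h| h).
have f0 c a : 0 <= f c a by rewrite /f divr_ge0 ?sqrtr_ge0.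
apply: (@le_trans _ _ (\sum_(a < n) \sum_(b < n)
    (h ^+ 2 * (f (x - x0) a * f (y - y0) b) + s^-1 * (h ^+ 2 * (U a b)%:R)))).
  apply: ler_sum => a _; apply: ler_sum => b _.
  rewrite [s^-1 * _]mulrCA -mulrDr ler_wpM2l ?sqr_ge0//.
  case: (U a b); last by rewrite mul0r mulr0 addr0 mulr_ge0.
  rewrite mul1r mulr1 /lpt.
  have -> : (x +i* y - (x0 + a%:R * h) +i* (y0 + b%:R * h)) =
     (x - x0 - a%:R * h) +i* (y - y0 - b%:R * h).
    by apply/eqP; rewrite eq_complex /=; apply/andP; split; apply/eqP; ring.
  rewrite /f; move: (x - x0 - a%:R * h) (y - y0 - b%:R * h) => {}x {}y.
  have := Re_le_cm (x +i* y); have := Im_le_cm (x +i* y) => /= yw xw.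
  have far : s <= cm (x +i* y) -> cm (regker e (x +i* y)) <= s^-1.
    by move=> sw; apply: cm_regker_le => //; left.
  case: (ltP `|x| s) => xs; last first.
    by rewrite mul0r mul0r add0r; apply: far; apply: le_trans xw.
  case: (ltP `|y| s) => ys; last first.
    by rewrite mul0r mulr0 add0r; apply: far; apply: le_trans yw.
  rewrite !div1r; apply: (@le_trans _ _ (Num.max (Num.max `|x| `|y|) h)^-1).
    apply: cm_regker_le => //; first by rewrite lt_max h0 orbT.
    case: (leP (Num.max `|x| `|y|) h) => _; [by right|left].
    by rewrite ge_max xw yw.
  rewrite -invfM -[leLHS]addr0 lerD ?invr_ge0 ?(ltW s0)//.
  set m := Num.max (Num.max _ _) _.
  have m0 : 0 < m by rewrite lt_max h0 orbT.
  have hx0 : 0 < Num.max `|x| h by rewrite lt_max h0 orbT.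
  have hy0 : 0 < Num.max `|y| h by rewrite lt_max h0 orbT.
  rewrite lef_pV2 ?posrE ?mulr_gt0 ?sqrtr_gt0//.
  rewrite -[leRHS](sqr_sqrtr (ltW m0)) expr2.
  apply: ler_pM; rewrite ?sqrtr_ge0// ler_wsqrtr// ge_max !le_max !lexx ?orbT//.
under eq_bigr do rewrite big_split.
rewrite big_split /= lerD//; last first.
  by rewrite mulr_sumr; apply: ler_sum => a _; rewrite mulr_sumr.
have S c : \sum_(a < n) h * f c a <= 8 * Num.sqrt (2 * s).
  apply: le_trans (@sum_sqrt_le R (- c) h s n h0 hs).
  apply: ler_sum => a _; rewrite /f.
  have -> : - c + a%:R * h = - (c - a%:R * h) by ring.
  by rewrite normrN.
have S0 c : 0 <= \sum_(a < n) h * f c a.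
  by apply: sumr_ge0 => a _; rewrite mulr_ge0// ltW.
have := ler_pM (S0 _) (S0 _) (S (x - x0)) (S (y - y0)).
have -> : 8 * Num.sqrt (2 * s) * (8 * Num.sqrt (2 * s)) = 64 * (Num.sqrt (2 * s) ^+ 2) by ring.
rewrite sqr_sqrtr; last by rewrite mulr_ge0// ltW.
have -> : 64 * (2 * s) = 128 * s by ring.
apply: le_trans; rewrite mulr_suml; apply: ler_sum => a _.
rewrite mulr_sumr; apply: ler_sum => b _.
by rewrite le_eqVlt; apply/orP; left; apply/eqP; ring.
Qed.

(** For smooth [u], [2 * h] times the d-bar derivative to first order in [h]. *)
Definition ddbar (u : R[i] -> R) (x0 y0 h : R) (a b : nat) : R[i] :=
  (u (lpt x0 y0 h a.+1 b) - u (lpt x0 y0 h a b))%:C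
  + 'i * (u (lpt x0 y0 h a b.+1) - u (lpt x0 y0 h a b))%:C.

Lemma cm_i : cm ('i : R[i]) = 1.
Proof. by rewrite cmE expr0n add0r expr1n sqrtr1. Qed.

Lemma cm_lpt_stepx x0 y0 h a b : 0 <= h -> cm (lpt x0 y0 h a.+1 b - lpt x0 y0 h a b) = h.
Proof.
move=> h0; have -> : lpt x0 y0 h a.+1 b - lpt x0 y0 h a b = h%:C.
  by apply/eqP; rewrite eq_complex /=; apply/andP; split; apply/eqP; rewrite ?mulrSr; ring.
by rewrite cm_real ger0_norm.
Qed.

Lemma cm_lpt_stepy x0 y0 h a b : 0 <= h -> cm (lpt x0 y0 h a b.+1 - lpt x0 y0 h a b) = h.
Proof.
move=> h0; have -> : lpt x0 y0 h a b.+1 - lpt x0 y0 h a b = 'i * h%:C.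
  by apply/eqP; rewrite eq_complex /=; apply/andP; split; apply/eqP; rewrite ?mulrSr; ring.
by rewrite cmM cm_i mul1r cm_real ger0_norm.
Qed.

Lemma cm_ddbar u L x0 y0 h a b : 0 <= h -> dist_lip u L ->
  cm (ddbar u x0 y0 h a b) <= 2 * L * h.
Proof.
move=> h0 uL; apply: le_trans (cmD _ _) _.
rewrite cmM cm_i mul1r !cm_real.
have := uL (lpt x0 y0 h a.+1 b) (lpt x0 y0 h a b).
have := uL (lpt x0 y0 h a b.+1) (lpt x0 y0 h a b).
by rewrite cm_lpt_stepx// cm_lpt_stepy//; lra.
Qed.

(** Summation by parts in each direction moves the differences from [u] to the kernel. There are no
    boundary terms: points on the sides of the square have modulus at least [X]. *)
Lemma sum_ddbar (u : R[i] -> R) X h n z (K : R[i] -> R[i]) :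
  n%:R * h = 2 * X -> (forall w, X <= cm w -> u w = 0) ->
  \sum_(a < n) \sum_(b < n) ddbar u (- X) (- X) h a b * K (z - lpt (- X) (- X) h a b)
  = \sum_(a < n) \sum_(b < n) (u (lpt (- X) (- X) h a b))%:C *
    let w := z - lpt (- X) (- X) h a b in
    (K (w + h%:C) - K w) + 'i * (K (w + 'i * h%:C) - K w).
Proof.
move=> nh u0.
have ux b : u (lpt (- X) (- X) h 0 b) = 0 /\ u (lpt (- X) (- X) h n b) = 0.
  split; apply: u0; apply: le_trans (Re_le_cm _); rewrite /= ?nh ?mul0r ?addr0 ler_normr; apply/orP; [right|left]; lra.
have uy a : u (lpt (- X) (- X) h a 0) = 0 /\ u (lpt (- X) (- X) h a n) = 0.
  split; apply: u0; apply: le_trans (Im_le_cm _); rewrite /= ?nh ?mul0r ?addr0 ler_normr; apply/orP; [right|left]; lra.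
have stepx a b w : z - lpt (- X) (- X) h a.+1 b + h%:C = z - lpt (- X) (- X) h a b.
  apply/eqP; case: (z) => p q; rewrite eq_complex /=; apply/andP; split; apply/eqP; rewrite ?mulrSr; ring.
have stepy a b w : z - lpt (- X) (- X) h a b.+1 + 'i * h%:C = z - lpt (- X) (- X) h a b.
  apply/eqP; case: (z) => p q; rewrite eq_complex /=; apply/andP; split; apply/eqP; rewrite ?mulrSr; ring.
under eq_bigr do under eq_bigr do rewrite /ddbar mulrDl -mulrA.
under eq_bigr do rewrite big_split -mulr_sumr.
under [RHS]eq_bigr do under eq_bigr do rewrite mulrDr [_%:C * ('i * _)]mulrCA.
under [RHS]eq_bigr do rewrite big_split -mulr_sumr.
rewrite !big_split /=; congr (_ + _).
  rewrite exchange_big [RHS]exchange_big /=; apply: eq_bigr => b _.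
  under eq_bigr do rewrite real_complexB.
  rewrite (@sum_parts _ (fun a => (u (lpt (- X) (- X) h a b))%:C)
    (fun a => K (z - lpt (- X) (- X) h a b)) (fun a => K (z - lpt (- X) (- X) h a b + h%:C)))//.
  - by rewrite (ux b).1.
  - by rewrite (ux b).2.
  - by move=> a; rewrite stepx.
apply: eq_bigr => a _; congr (_ * _).
under eq_bigr do rewrite real_complexB.
rewrite (@sum_parts _ (fun b => (u (lpt (- X) (- X) h a b))%:C)
    (fun b => K (z - lpt (- X) (- X) h a b)) (fun b => K (z - lpt (- X) (- X) h a b + 'i * h%:C)))//.
- by rewrite (uy a).1.
- by rewrite (uy a).2.
- by move=> b; rewrite stepy.
Qed.

(** After summation by parts the kernel differences are [h * tent], up to the error of
    [regker_discrete_dbar]. The tent lives in the disc of radius [r], so replacing [u] at the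
    lattice points by its value at the centre costs [L * r] per unit of mass: the first term of the
    bound. *)
Lemma discrete_cauchy (u : R[i] -> R) L Bu X h e r n x y :
  0 < h -> h <= 1 -> 0 < r -> e = r ^+ 2 -> n%:R * h = 2 * X -> 1 <= X ->
  `|x| <= X -> `|y| <= X ->
  dist_lip u L -> (forall w, `|u w| <= Bu) -> (forall w, X <= cm w -> u w = 0) ->
  cm (h%:C * \sum_(a < n) \sum_(b < n)
        ddbar u (- X) (- X) h a b * regker e (x +i* y - lpt (- X) (- X) h a b)
      - (tentsum X h e n x y * u (x +i* y))%:C)
  <= L * r * tentsum X h e n x y
    + h * ((2 * X) ^+ 2 * (Bu * (10 * (2 * X) / e ^+ 2 + 54 * (2 * X) ^+ 3 / e ^+ 3))).
Proof.
move=> h0 h1 r0 er nh X1 xX yX uL uB u0.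
have e0 : 0 < e by rewrite er exprn_gt0.
rewrite (@sum_ddbar u X h n (x +i* y) (regker e))//.
set C := 10 * _ / _ + _.
rewrite {1}/tentsum mulr_suml real_complex_sum mulr_sumr -sumrB.
apply: le_trans (cm_sum _ _ _) _.
apply: (@le_trans _ _ (\sum_(a < n) \sum_(b < n)
   (L * r * (h ^+ 2 * tent e ((x + X - a%:R * h) ^+ 2 + (y + X - b%:R * h) ^+ 2))
    + h ^+ 2 * (h * (Bu * C))))); last first.
  under eq_bigr do rewrite big_split.
  rewrite big_split /= (sum_lattice_const nh) mulrCA lerD//.
  by rewrite /tentsum mulr_sumr; apply: ler_sum => a _; rewrite mulr_sumr.
apply: ler_sum => a _; rewrite mulr_suml real_complex_sum mulr_sumr -sumrB.
apply: le_trans (cm_sum _ _ _) _; apply: ler_sum => b _.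
set l := lpt _ _ _ _ _.
have wE : x +i* y - l = (x + X - a%:R * h) +i* (y + X - b%:R * h).
  by apply/eqP; rewrite eq_complex /=; apply/andP; split; apply/eqP; ring.
have bd (v : R) (c : 'I_n) : `|v| <= X -> `|v + X - c%:R * h| <= 2 * X.
  rewrite !ler_norml => /andP[v1 v2].
  have c0 : 0 <= c%:R * h by rewrite mulr_ge0// ltW.
  have c1 : c%:R * h <= 2 * X by rewrite -nh ler_pM2r// ler_nat ltnW.
  by apply/andP; split; lra.
have := @regker_discrete_dbar R e (2 * X) h (x + X - a%:R * h) (y + X - b%:R * h) e0 h0 h1.
rewrite !bd// => H; have {H} := H _ isT isT.
have X2 : 1 <= 2 * X by lra.
move=> /(_ X2); rewrite -/C /=.
set dK := _ + 'i * _.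
have -> : regker e (x +i* y - l + h%:C) - regker e (x +i* y - l) +
   'i * (regker e (x +i* y - l + 'i * h%:C) - regker e (x +i* y - l)) = dK.
  rewrite /dK wE; congr (regker _ _ - _ + 'i * (regker _ _ - _));
    apply/eqP; rewrite eq_complex /=; apply/andP; split; apply/eqP; ring.
set t := tent _ _ => dKt.
have -> : h%:C * ((u l)%:C * dK) - (h ^+ 2 * t * u (x +i* y))%:C =
   h%:C * (u l)%:C * (dK - (h * t)%:C) + (h ^+ 2 * t * (u l - u (x +i* y)))%:C.
  by rewrite !real_complexM real_complexB; ring.
rewrite addrC; apply: le_trans (cmD _ _) _; apply: lerD.
  rewrite cm_real normrM ger0_norm; last by rewrite mulr_ge0 ?sqr_ge0 ?tent_ge0.
  rewrite [leRHS]mulrC.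
  have [wr|wr] := leP e (cm (x +i* y - l) ^+ 2).
    by rewrite /t tent_eq0 ?mulr0 ?mul0r//; rewrite wE sqr_cm in wr.
  have t0 : 0 <= t by exact: tent_ge0.
  rewrite (ler_wpM2l (mulr_ge0 (sqr_ge0 h) t0))//.
  apply: le_trans (uL _ _) _; rewrite cmB ler_wpM2l//.
    by have := uL 0 1; have := normr_ge0 (u 0 - u 1); rewrite sub0r cmN cm1; lra.
  by move: wr; rewrite er ltr_pXn2r// ?nnegrE ?cm_ge0 ?(ltW r0)// => /ltW.
rewrite !cmM !cm_real (ger0_norm (ltW h0)).
have -> : h ^+ 2 * (h * (Bu * C)) = h * Bu * (h ^+ 2 * C) by ring.
apply: ler_pM => //; rewrite ?mulr_ge0 ?cm_ge0 ?(ltW h0)//.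
by rewrite ler_wpM2l// ltW.
Qed.

End DiscreteCauchy.

(** * Hartogs-Rosenthal approximation in the plane *)

Section Planar.
Context {R : realType}.
Implicit Types (N D : set R[i]) (z w : R[i]).

(* Finite covers are enough: only bounded closed sets occur. *)
Definition null2 N := forall eta : R, 0 < eta -> exists s : seq (R[i] * R),
  [/\ forall p, p \in s -> 0 < p.2,
      forall z, N z -> exists2 p, p \in s & cm (z - p.1) < p.2
    & \sum_(p <- s) p.2 ^+ 2 <= eta].

Lemma seq_gt0_lower (T : eqType) (s : seq T) (f : T -> R) : (forall p, p \in s -> 0 < f p) ->
  exists2 m, 0 < m & forall p, p \in s -> m <= f p.
Proof.
elim: s => [_|p s IH pos]; first by exists 1.
have [q qs|m m0 hm] := IH; first by apply: pos; rewrite inE qs orbT.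
have p0 : 0 < f p by apply: pos; rewrite mem_head.
exists (Num.min (f p) m); first by rewrite lt_min p0.
by move=> q; rewrite inE ge_min => /orP[/eqP->|/hm ->]; rewrite ?lexx ?orbT.
Qed.

Lemma ex_quotient (K eta : R) : 0 < K -> 0 < eta -> exists2 s, 0 < s & s * K = eta.
Proof. by move=> K0 eta0; exists (eta / K); rewrite ?divr_gt0 ?divfK ?gt_eqF. Qed.

Lemma ex_mesh (X h0 : R) : 0 < X -> 0 < h0 ->
  exists n (h : R), [/\ 0 < h, h <= h0 & n%:R * h = 2 * X].
Proof.
move=> X0 h00; set q := 2 * X / h0.
have q0 : 0 <= q by rewrite divr_ge0 ?mulr_ge0 ?(ltW X0) ?(ltW h00).
exists (Num.truncn q).+1, (2 * X / (Num.truncn q).+1%:R); split.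
- by rewrite divr_gt0// mulr_gt0.
- rewrite ler_pdivrMr// [leRHS]mulrC -ler_pdivrMr//; apply: ltW.
  by have /andP[] := truncn_itv q0.
- by rewrite mulrC divfK.
Qed.

(* Discretised Cauchy-Pompeiu formula: the mass of the lattice points close to the null set [N]
   is small, so they can be dropped from the Cauchy transform of the d-bar derivative of [u]. *)
Lemma cauchy_approx_supp (u : R[i] -> R) (L Bu T B rho : R) N D :
  0 <= L -> dist_lip u L -> (forall w, `|u w| <= Bu) -> 0 <= T ->
  (forall w, T <= cm w -> u w = 0) -> 1 <= B ->
  null2 N -> 0 < rho -> (forall z w, D z -> cm (z - w) < rho -> u w = 0) ->
  (forall z, N z \/ D z -> cm z <= B) ->
  forall eta : R, 0 < eta -> exists (I : finType) (P : pred I) (a l : I -> R[i]) (d : R),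
   [/\ 0 < d, forall z i, N z \/ D z -> P i -> d <= cm (z - l i)
     & forall z, N z \/ D z -> cm ((u z)%:C - \sum_(i | P i) a i / (z - l i)) <= eta].
Proof.
move=> L0 uL uB T0 uT B1 Nnull rho0 uD ND eta eta0.
have Bu0 : 0 <= Bu by apply: le_trans (uB 0).
have L1 : 0 < L + 1 by lra.
have K0 (k : R) : 0 < k -> 0 < 20 * (k * (L + 1)) by move=> k0; rewrite !mulr_gt0.
have h128 : 0 < 128 :> R by rewrite ltr0n.
have h64 : 0 < 64 :> R by rewrite ltr0n.
have [s s0 sE] := ex_quotient (K0 _ h128) eta0.
have [q q0 qE] := ex_quotient (K0 _ h64) eta0.
(* [A] will bound the squared radii of the discs around [N]. The lattice points in the doubled discs
   then contribute at most [2 * L * (128 * s + 64 * A / s)]; [s] and [q = A / s] are such that each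
   of the two terms is at most [eta / 10]. *)
pose A := s * q; have A0 : 0 < A by rewrite mulr_gt0.
have Aq : A / s = q by rewrite /A mulrC mulKf// gt_eqF.
have [S [S0 SN SA]] := Nnull _ A0.
have [m m0 mS] := seq_gt0_lower S0.
(* The kernel radius. By [r <= m] the kept poles are at least [r] away from [N], where the kernel is
   exactly [1 / z]; [rho / 2] leaves room for a lattice step inside the zone where [u] vanishes; the
   last bound makes the smoothing error [L * r] at most [eta / 10]. *)
pose r := Num.min (Num.min m (rho / 2)) (Num.min 1 (eta / (10 * (L + 1)))).
have r0 : 0 < r.
  by rewrite !lt_min m0 ltr01 !divr_gt0// mulr_gt0.
have [rm rrho r1 rL] : [/\ r <= m, r <= rho / 2, r <= 1 & r <= eta / (10 * (L + 1))].
  by rewrite !ge_min !lexx !orbT.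
have {}rL : L * r <= eta / 10.
  have : r * (10 * (L + 1)) <= eta by rewrite -ler_pdivlMr// mulr_gt0.
  nra.
pose e := r ^+ 2.
have e0 : 0 < e by rewrite exprn_gt0.
have B0 : 0 <= B by lra.
pose X := T + B + 1.
have X1 : 1 <= X by rewrite /X; lra.
have X0 : 0 < X by lra.
pose C2 := (2 * X) ^+ 2 * (4 * (16 * X) / e ^+ 2).
pose C3 := (2 * X) ^+ 2 * (Bu * (10 * (2 * X) / e ^+ 2 + 54 * (2 * X) ^+ 3 / e ^+ 3)).
have C20 : 0 <= C2.
  by rewrite /C2 !(exprn_ge0, divr_ge0, mulr_ge0)// ltW.
have C30 : 0 <= C3.
  by rewrite /C3 !(exprn_ge0, addr_ge0, divr_ge0, mulr_ge0)// ?ltW.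
pose M := 20 * (C2 * Bu + C3) + 2 * C2 + 1.
have M0 : 0 < M by have := mulr_ge0 C20 Bu0; rewrite /M; lra.
pose h0 := Num.min (Num.min (r / 4) s) (Num.min (eta / M) M^-1).
have h00 : 0 < h0 by rewrite !lt_min invr_gt0 M0 s0 !divr_gt0.
have [n [h [hp hh0 nh]]] := ex_mesh X0 h00.
have [hr hs hM1 hM2] : [/\ h <= r / 4, h <= s, h <= eta / M & h <= M^-1].
  by move: hh0; rewrite !le_min => /andP[/andP[-> ->] /andP[-> ->]].
have {}hM1 : h * M <= eta by rewrite -ler_pdivlMr.
have {}hM2 : h * M <= 1 by rewrite -ler_pdivlMr// div1r.
have hC2 : h * C2 <= 2^-1.
  have := mulr_ge0 (ltW hp) (mulr_ge0 C20 Bu0); have := mulr_ge0 (ltW hp) C30; have := mulr_ge0 (ltW hp) C20.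
  by move: hM2; rewrite /M; lra.
have hC3 : h * (C2 * Bu + C3) <= eta / 20.
  have := mulr_ge0 (ltW hp) (mulr_ge0 C20 Bu0); have := mulr_ge0 (ltW hp) C30; have := mulr_ge0 (ltW hp) C20.
  by move: hM1; rewrite /M; lra.
have h1 : h <= 1 by lra.
(* The discrete counterpart of [2 * pi] in Cauchy's formula. *)
pose c := tentsum X h e n (- B) (- B).
have c_ge : 2^-1 <= c by apply: (@tentsum_ge _ _ _ _ _ hp e0 nh B r) => //; rewrite /X; lra.
have c0 : 0 < c by lra.
(* Discs are doubled so that a lattice point outside them is at least one radius, hence at least
   [m], away from every point of [N]. *)
pose S2 := [seq (p.1, 2 * p.2) | p <- S].
pose l (p : 'I_n * 'I_n) := lpt (- X) (- X) h p.1 p.2.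
pose dd (p : 'I_n * 'I_n) := ddbar u (- X) (- X) h p.1 p.2.
(* Discarding the zero coefficients keeps the poles away from [D]: at lattice points near [D] both
   differences of [u] vanish. *)
exists ('I_n * 'I_n)%type, (fun p => ~~ in_discs S2 (l p) && (dd p != 0)),
  (fun p => (h / c)%:C * dd p), l, r.
have far z p : N z \/ D z -> ~~ in_discs S2 (l p) -> dd p != 0 -> r <= cm (z - l p).
  case=> [Nz|Dz] nU ddp.
    have [d dS zd] := SN _ Nz; have := hasPn nU (d.1, 2 * d.2).
    rewrite map_f// => /(_ isT) /=; rewrite -leNgt => lq.
    have := mS _ dS; have := cm_dist (l p) d.1 z; rewrite (cmB (l p) z); lra.
  rewrite leNgt; apply: contra ddp => lt; apply/eqP.
  have near w : cm (w - l p) <= h -> u w = 0.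
    by move=> wl; apply: (uD z) => //; have := cm_dist z w (l p); rewrite (cmB (l p)); lra.
  rewrite /dd /ddbar !near ?subrr ?mulr0 ?addr0 ?cm0 ?(ltW hp)//.
    by rewrite cm_lpt_stepy// ltW.
  by rewrite cm_lpt_stepx// ltW.
split=> // [z p NDz /andP[]|z NDz]; first exact: far.
have hL : cm (h%:C * \sum_(a < n) \sum_(b < n)
   ddbar u (- X) (- X) h a b * ((in_discs S2 (lpt (- X) (- X) h a b))%:R * regker e (z - lpt (- X) (- X) h a b)))
   <= eta / 5.
  have SA' : \sum_(p <- S2) p.2 ^+ 2 <= 4 * A.
    rewrite big_map /=; under eq_bigr do rewrite exprMn.
    by rewrite -mulr_sumr expr2 -natrM ler_pM2l.
  have S2h p : p \in S2 -> h <= p.2.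
    by case/mapP=> d dS -> /=; have := mS _ dS; lra.
  have := @sum_in_discs_le _ (- X) (- X) h n S2 hp S2h.
  have := @sum_regker_le _ (- X) (- X) h e s n (fun a b => in_discs S2 (lpt (- X) (- X) h a b)) z hp hs.
  have -> : (2 * h) ^+ 2 <= e by rewrite /e ler_pXn2r// ?nnegrE; lra.
  move=> /(_ isT) k1 k2.
  rewrite cmM cm_real (ger0_norm (ltW hp)).
  apply: (@le_trans _ _ (2 * L * (128 * s + s^-1 * (16 * (4 * A))))).
    apply: (@le_trans _ _ (2 * L * \sum_(a < n) \sum_(b < n) h ^+ 2 * ((in_discs S2 (lpt (- X) (- X) h a b))%:R * cm (regker e (z - lpt (- X) (- X) h a b))))).
      rewrite -ler_pdivlMl//; apply: le_trans (cm_sum _ _ _) _.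
      rewrite mulr_sumr mulr_sumr; apply: ler_sum => a _.
      apply: le_trans (cm_sum _ _ _) _.
      rewrite mulr_sumr mulr_sumr; apply: ler_sum => b _.
      rewrite !cmM; have -> (x y : R) : h^-1 * (2 * L * (h ^+ 2 * (x * y))) = 2 * L * h * (x * y).
        by field; rewrite gt_eqF.
      apply: ler_pM; rewrite ?mulr_ge0 ?cm_ge0//; first exact: cm_ddbar (ltW hp) uL.
      by case: (in_discs _ _); rewrite ?cm1 ?cm0.
    apply: ler_wpM2l; first by rewrite mulr_ge0.
    apply: le_trans k1 _; rewrite lerD2l ler_pM2l ?invr_gt0//.
    by apply: le_trans k2 _; rewrite ler_pM2l.
  have -> : s^-1 * (16 * (4 * A)) = 64 * q by rewrite -Aq; ring.
  by move: sE qE (mulr_ge0 L0 (ltW s0)) (mulr_ge0 L0 (ltW q0)); lra.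
case: z NDz hL => x y NDz hL.
have zB := ND _ NDz.
have [xB yB] : `|x| <= B /\ `|y| <= B.
  by split; [exact: le_trans (Re_le_cm (x +i* y)) zB | exact: le_trans (Im_le_cm (x +i* y)) zB].
have BX : B <= X by rewrite /X; lra.
have uX w : X <= cm w -> u w = 0 by move=> Xw; apply: uT; move: Xw; rewrite /X; lra.
have K1 := @discrete_cauchy _ u L Bu X h e r n x y hp h1 r0 erefl nh X1 (le_trans xB BX) (le_trans yB BX) uL uB uX.
rewrite -/C3 in K1.
have r0' := ltW r0.
have rBX : r + B <= X by rewrite /X; lra.
have hB : h <= B by lra.
have := @tentsum_const _ X h e n hp e0 nh B r x y r0' erefl rBX hB xB yB.
rewrite -/C2 -/c.
move: K1; set cc := tentsum X h e n x y; set z := x +i* y => K1 K2.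
have cE : c%:C * \sum_(i | ~~ in_discs S2 (l i) && (dd i != 0)) (h / c)%:C * dd i / (z - l i)
  = h%:C * (\sum_(a < n) \sum_(b < n) ddbar u (- X) (- X) h a b * regker e (z - lpt (- X) (- X) h a b))
   - h%:C * (\sum_(a < n) \sum_(b < n)
   ddbar u (- X) (- X) h a b * ((in_discs S2 (lpt (- X) (- X) h a b))%:R * regker e (z - lpt (- X) (- X) h a b))).
  rewrite -mulrBr -sumrB; under [in RHS]eq_bigr do rewrite -sumrB.
  rewrite (pair_bigA _ (fun (a b : 'I_n) => ddbar u (- X) (- X) h a b * regker e (z - lpt (- X) (- X) h a b) -
    ddbar u (- X) (- X) h a b * ((in_discs S2 (lpt (- X) (- X) h a b))%:R * regker e (z - lpt (- X) (- X) h a b)))) /=.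
  rewrite mulr_sumr mulr_sumr big_mkcond; apply: eq_bigr => p _.
  rewrite -/(l p) -/(dd p); case: ifPn => [/andP[nU ddp]|].
    rewrite (negbTE nU) mul0r mulr0 subr0 regkerE//; last first.
      by rewrite /e ler_pXn2r// ?nnegrE ?cm_ge0// far.
    by rewrite -[h in RHS](divfK (lt0r_neq0 c0)) real_complexM; ring.
  rewrite negb_and !negbK => /orP[->|/eqP->]; first by rewrite mul1r subrr mulr0.
  by rewrite !mul0r subrr mulr0.
have {}hL : cm ((c - cc) * u z)%:C + cm (h%:C * (\sum_(a < n) \sum_(b < n) ddbar u (- X) (- X) h a b * regker e (z - lpt (- X) (- X) h a b)) - (cc * u z)%:C) + eta / 5 >=
  c * cm ((u z)%:C - \sum_(i | ~~ in_discs S2 (l i) && (dd i != 0)) (h / c)%:C * dd i / (z - l i)).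
  rewrite -{1}(gtr0_norm c0) -cm_real -cmM mulrBr [X in _ - X]cE.
  set Q := h%:C * _; set Q' := h%:C * _ in hL *.
  have -> : c%:C * (u z)%:C - (Q - Q') = ((c - cc) * u z)%:C - (Q - (cc * u z)%:C) + Q'.
    by rewrite !real_complexM real_complexB; ring.
  apply: le_trans (cmD _ _) _; rewrite lerD//.
  by apply: le_trans (cmD _ _) _; rewrite cmN.
have u1 : cm ((c - cc) * u z)%:C <= h * C2 * Bu.
  by rewrite cm_real normrM; apply: ler_pM => //; rewrite distrC.
have cc2 : cc <= 2 * c.
  move: K2; rewrite ler_norml => /andP[_]; lra.
have Lrcc : L * r * cc <= c * eta / 5.
  apply: (@le_trans _ _ (eta / 10 * (2 * c))); last by lra.
  by apply: ler_pM => //; [rewrite mulr_ge0|exact: tentsum_ge0].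
(* After multiplication by [c] the budget is [eta / 20 + c * eta / 5 + eta / 5 <= c * eta], because
   [c >= 1 / 2]. *)
rewrite -(ler_pM2l c0).
have : eta * 2^-1 <= eta * c by rewrite ler_pM2l.
lra.
Qed.

End Planar.

(** * Compactness and null sets *)

Section Bridge.
Context {R : realType} {n : nat}.
Notation C := R[i].
Notation V := 'rV[R[i]]_n.
Implicit Types (z w : V).

(** The sup norm valued in [R], whereas [|z|] is an element of [R[i]]; the neighbourhoods are the
    same by [nbhs_nrmP]. *)
Definition nrm z : R := \big[Num.max/0]_(j < n) cm (z ord0 j).

Lemma nrm_ge0 z : 0 <= nrm z.
Proof. by rewrite /nrm; elim/big_ind: _ => // [x y x0 y0|j _]; rewrite ?le_max ?x0 ?cm_ge0. Qed.

Lemma cm_le_nrm z j : cm (z ord0 j) <= nrm z.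
Proof. exact: (le_bigmax _ (fun j => cm (z ord0 j))). Qed.

Lemma nrm_leP z (b : R) : 0 <= b -> reflect (forall j, cm (z ord0 j) <= b) (nrm z <= b).
Proof.
move=> b0; apply: (iffP idP) => [le j|le]; first exact: le_trans (cm_le_nrm z j) le.
by apply/bigmax_leP; split=> // j _; exact: le.
Qed.

Lemma nrm_ltP z (b : R) : 0 < b -> reflect (forall j, cm (z ord0 j) < b) (nrm z < b).
Proof.
move=> b0; apply: (iffP idP) => [le j|le]; first exact: le_lt_trans (cm_le_nrm z j) le.
by apply/bigmax_ltP; split=> // j _; exact: le.
Qed.

Lemma nrmD z w : nrm (z + w) <= nrm z + nrm w.
Proof.
apply/nrm_leP; first by rewrite addr_ge0 ?nrm_ge0.
by move=> j; rewrite mxE; apply: le_trans (cmD _ _) _; rewrite lerD ?cm_le_nrm.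
Qed.

Lemma nrmZ (t : C) z : nrm (t *: z) <= cm t * nrm z.
Proof.
apply/nrm_leP; first by rewrite mulr_ge0 ?nrm_ge0 ?cm_ge0.
by move=> j; rewrite mxE cmM ler_wpM2l ?cm_ge0 ?cm_le_nrm.
Qed.

Lemma nrmN z : nrm (- z) = nrm z.
Proof. by apply: eq_bigr => j _; rewrite mxE cmN. Qed.

Lemma nrmB z w : nrm (z - w) = nrm (w - z).
Proof. by rewrite -nrmN opprB. Qed.

Lemma nrm_dist z w v : nrm (z - w) <= nrm (z - v) + nrm (v - w).
Proof. by rewrite -[X in nrm X](subrKA v) nrmD. Qed.

Lemma nrm0 : nrm 0 = 0.
Proof.
by apply/eqP; rewrite eq_le nrm_ge0 andbT; apply/nrm_leP => // j; rewrite mxE cm0.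
Qed.

Lemma lt_complex0 (e : C) : 0 < e -> 0 < complex.Re e /\ e = (complex.Re e)%:C.
Proof. by case: e => a b; rewrite ltcE /= => /andP[/eqP-> ->]. Qed.

Lemma nbhs_cmP (z : C) (P : set C) :
  nbhs z P <-> exists2 e : R, 0 < e & forall u : C, cm (z - u) < e -> P u.
Proof.
split=> [/nbhs_ballP[e /= e0]|[e e0 zP]].
  have [e0' ->] := lt_complex0 e0 => zP; exists (complex.Re e) => // u zu.
  by apply: zP; rewrite /ball /= normcE ltcR.
apply/nbhs_ballP; exists e%:C; first by rewrite /= ltcR.
by move=> w; rewrite /ball /= normcE ltcR => /zP.
Qed.

Lemma nbhs_nrmP z (P : set V) :
  nbhs z P <-> exists2 e : R, 0 < e & forall w, nrm (z - w) < e -> P w.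
Proof.
split=> [/nbhs_ballP[e /= e0]|[e e0 zP]].
  have [e0' ->] := lt_complex0 e0 => zP; exists (complex.Re e) => // w /nrm_ltP zw.
  apply: zP; split=> [|i j]; first by rewrite ltcR.
  rewrite ord1 /ball /= normcE ltcR.
  by have := zw e0' j; rewrite !mxE.
apply/nbhs_ballP; exists e%:C; first by rewrite /= ltcR.
move=> w [_ zw]; apply/zP/nrm_ltP => // j.
by have := zw ord0 j; rewrite /ball /= normcE ltcR !mxE.
Qed.

Definition gauge_compact (K : set V) := forall r : V -> R, (forall z, K z -> 0 < r z) ->
  exists s : seq V, (forall y, y \in s -> K y) /\
    forall z, K z -> exists2 y, y \in s & nrm (z - y) < r y.

Lemma compact_gauge (K : set V) : compact K -> gauge_compact K.
Proof.
move=> /compact_near_coveringP cK r r0.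
(* Finite families of points of [K], directed by inclusion, generate a filter; near-covering
   compactness along it yields one family that serves every point. *)
pose le (s : seq V) := [set t : seq V | {subset s <= t} /\ forall y, y \in t -> K y].
pose F := filter_from [set s : seq V | forall y, y \in s -> K y] le.
have FF : Filter F.
  apply: filter_from_filter; first by exists [::].
  move=> s t /= sK tK; exists (s ++ t).
    by move=> y; rewrite mem_cat => /orP[/sK|/tK].
  move=> u [su uK]; split; split=> // y ys; apply: su; rewrite mem_cat ys ?orbT//.
have [|s sK H] := cK _ F (fun (s : seq V) z => exists2 y, y \in s & nrm (z - y) < r y) FF.
  move=> z Kz; exists ([set w | nrm (z - w) < r z], le [:: z]); last first.
    move=> [w s] /= [zw [zs _]]; exists z; last by rewrite nrmB.
    by apply: zs; rewrite mem_head.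
  split; last by exists [:: z] => // y /=; rewrite inE => /eqP->.
  by apply/nbhs_nrmP; exists (r z) => //; exact: r0.
exists s; split=> // z Kz.
exact: (H s (conj (fun _ => id) sK) z Kz).
Qed.

Lemma compact_square (M : R) :
  compact [set z : C | `|complex.Re z| <= M /\ `|complex.Im z| <= M].
Proof.
have cI : compact `[- M, M]%classic by exact: segment_compact.
have := compact_setX cI cI => cII.
pose f (p : R * R) : C := p.1 +i* p.2.
have -> : [set z : C | `|complex.Re z| <= M /\ `|complex.Im z| <= M] =
   f @` (`[- M, M]%classic `*` `[- M, M]%classic).
  apply/seteqP; split=> [[x y] /= [xM yM]|z [[x y]] /=].
    by exists (x, y) => //=; rewrite !in_itv /= -!ler_norml.
  by rewrite !in_itv /= -!ler_norml => -[xM yM] <-.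
apply: continuous_compact => //; apply: continuous_subspaceT => -[x y].
move=> A /nbhs_cmP[e e0 zA].
exists (ball x (e / 2), ball y (e / 2)).
  by split; apply: nbhsx_ballx; rewrite divr_gt0.
move=> [x' y'] [] /= xx' yy'; apply: zA.
apply: le_lt_trans (cm_le_ReIm _) _; rewrite /= [ltRHS]splitr.
by rewrite ltrD.
Qed.

Lemma compact_closed_nrm (G : set V) (M : R) : closed G ->
  compact (G `&` [set z | nrm z <= M]).
Proof.
move=> cG.
have clB : closed [set z | nrm z <= M].
  rewrite -[X in closed X]setCK; apply/open_closedC; rewrite openE => z /= /negP.
  rewrite -ltNge => Mz; apply/nbhs_nrmP; exists (nrm z - M); first by rewrite subr_gt0.
  move=> w zw /=; apply/negP; rewrite -ltNge.
  by have := nrmD (z - w) w; rewrite subrK; lra.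
have cK : compact [set z : V | forall j, [set u : C | `|complex.Re u| <= M /\ `|complex.Im u| <= M] (z ord0 j)].
  by apply: (@rV_compact C n (fun=> _)) => _; exact: compact_square.
apply: (subclosed_compact _ cK); first exact: closedI.
move=> z [_ /= zM] j; have le := le_trans (cm_le_nrm z j) zM.
by split; apply: le_trans le; [exact: Re_le_cm|exact: Im_le_cm].
Qed.

Definition null2V (K : set V) := forall eta : R, 0 < eta -> exists s : seq (V * R),
  [/\ forall p, p \in s -> 0 < p.2,
      forall z, K z -> exists2 p, p \in s & nrm (z - p.1) < p.2
    & \sum_(p <- s) p.2 ^+ 2 <= eta].

Lemma null2_lip_image (K : set V) (g : V -> C) (L : R) : null2V K ->
  (forall z w, K z -> K w -> cm (g z - g w) <= L * nrm (z - w)) ->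
  null2 [set u | exists2 z, K z & u = g z].
Proof.
move=> K2 gL eta eta0.
pose L' := `|L| + 1; have L'0 : 0 < L' by rewrite ltr_wpDl.
have LL' : L <= L' by rewrite /L'; have := ler_norm L; lra.
pose c := 2 * L'; have c0 : 0 < c by rewrite mulr_gt0.
have [s [s0 sK ss]] := K2 (eta / c ^+ 2) (divr_gt0 eta0 (exprn_gt0 2 c0)).
(* The centres of the cover need not lie in [K], where alone [g] is known to be Lipschitz. Each ball
   meeting [K] is recentred at one of its points in [K], which doubles the radius. *)
pose pick (p : V * R) : V := if pselect (exists2 z, K z & nrm (z - p.1) < p.2) is left H
  then projT1 (cid2 H) else 0.
exists [seq (g (pick p), c * p.2) | p <- s]; split.
- by move=> _ /mapP[p ps ->] /=; rewrite mulr_gt0 ?s0.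
- move=> _ [z Kz ->]; have [p ps zp] := sK _ Kz.
  exists (g (pick p), c * p.2); first exact: (map_f (fun p => (g (pick p), c * p.2))).
  rewrite /pick; case: pselect => [H|[]]; last by exists z.
  case: cid2 => w Kw wp /=.
  apply: le_lt_trans (gL _ _ Kz Kw) _.
  have := nrm_dist z w p.1; rewrite (nrmB p.1 w) => zw.
  apply: (@le_lt_trans _ _ (L' * nrm (z - w))); first by rewrite ler_wpM2r ?nrm_ge0.
  have {}zw : nrm (z - w) < 2 * p.2 by lra.
  by rewrite /c [2 * L']mulrC -mulrA ltr_pM2l.
- rewrite big_map /=; under eq_bigr do rewrite exprMn.
  by rewrite -mulr_sumr mulrC -ler_pdivlMr// exprn_gt0.
Qed.

Lemma nrm_le_eucl z w : nrm (z - w) <= eucl_dist z w.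
Proof.
apply/nrm_leP; first exact: sqrtr_ge0.
move=> j; rewrite /eucl_dist -(ger0_norm (cm_ge0 _)) -sqrtr_sqr ler_wsqrtr//.
rewrite (bigD1 j)//= !mxE lerDl sumr_ge0// => i _; exact: sqr_ge0.
Qed.

(** Each set of a countable cover is put in a ball about one of its points, enlarged by [e k] to be
    open even when the diameter is 0; compactness then leaves finitely many. As [pi / 4 >= 1 / 2],
    the squared diameters and the squared enlargements each sum to at most [eta / 4], and
    [(d + e) ^+ 2 <= 2 * d ^+ 2 + 2 * e ^+ 2]. *)
Lemma area0_null2 (G : set V) (M : R) : closed G -> area G = 0%E ->
  null2V (G `&` [set z | nrm z <= M]).
Proof.
move=> cG aG eta eta0.
(* Taking [delta = 1] makes all diameters finite, so that they can be treated as reals. *)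
have : (area_delta 1 G < (eta / 8)%:E)%E.
  apply: (@le_lt_trans _ _ 0%E); last by rewrite lte_fin divr_gt0.
  by rewrite -aG; apply: ereal_sup_ubound; exists 1 => //=.
move=> /ereal_inf_lt[_ [U [GU U1]] <-] sU.
have d_ge0 k : (0 <= diam (U k))%E by apply: ereal_sup_ubound; left.
have d_fin k : diam (U k) \is a fin_num.
  by rewrite ge0_fin_numE// (le_lt_trans (U1 k))// ltry.
pose d k : R := fine (diam (U k)).
have d0 k : 0 <= d k by rewrite fine_ge0.
have dE k : diam (U k) = (d k)%:E by rewrite fineK.
have dU k z w : U k z -> U k w -> nrm (z - w) <= d k.
  move=> zU wU; apply: le_trans (nrm_le_eucl z w) _.
  rewrite -lee_fin -dE; apply: ereal_sup_ubound; right.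
  by exists z => //; exists w.
have sumd N : \sum_(k < N) (pi / 4 * d k ^+ 2) <= eta / 8.
  rewrite -lee_fin -sumEFin; apply/ltW; apply: le_lt_trans sU.
  rewrite -(big_mkord xpredT (fun k => (pi / 4 * d k ^+ 2)%:E)).
  under eq_bigr do rewrite EFinM EFin_expe -dE.
  apply: nneseries_lim_ge => k _ _.
  by rewrite mule_ge0 ?lee_fin ?divr_ge0 ?pi_ge0// expe_ge0.
pose e k : R := Num.sqrt (eta / 4 * 2^-1 ^+ k.+1).
have e0' k : 0 < eta / 4 * 2^-1 ^+ k.+1 by rewrite mulr_gt0 ?exprn_gt0 ?divr_gt0 ?invr_gt0.
have e0 k : 0 < e k by rewrite sqrtr_gt0.
pose c k : V := if pselect (exists z, U k z) is left H then projT1 (cid H) else 0.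
have cU k z : U k z -> nrm (z - c k) < d k + e k.
  move=> Uz; rewrite /c; case: pselect => [H|[]]; last by exists z.
  by case: cid => w Uw /=; have := dU _ _ _ Uz Uw; have := e0 k; lra.
have /compact_near_coveringP cK := @compact_closed_nrm G M cG.
have [|N _ /(_ N (leqnn N)) HN] := cK _ \oo (fun N z => exists2 k, (k < N)%N & nrm (z - c k) < d k + e k) _.
  move=> z [Gz _]; have [k _ Uz] := GU _ Gz; have := cU _ _ Uz => zc.
  exists ([set w | nrm (z - w) < d k + e k - nrm (z - c k)], [set N | (k < N)%N]).
    split; last by exists k.+1.
    by apply/nbhs_nrmP; exists (d k + e k - nrm (z - c k)) => //; rewrite subr_gt0.
  move=> [w N] /= [zw kN]; exists k => //.
  have := nrm_dist w (c k) z; rewrite (nrmB w z); lra.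
exists [seq (c k, d k + e k) | k <- iota 0 N]; split.
- by move=> _ /mapP[k _ ->] /=; have := d0 k; have := e0 k; lra.
- move=> z Kz; have [k kN zk] := HN _ Kz.
  exists (c k, d k + e k) => //.
  by apply: (map_f (fun k => (c k, d k + e k))); rewrite mem_iota.
rewrite big_map /=.
have sume m : \sum_(k < m) e k ^+ 2 <= eta / 4 * (1 - 2^-1 ^+ m).
  elim: m => [|m IH]; first by rewrite big_ord0 expr0 subrr mulr0.
  rewrite big_ord_recr /=; apply: le_trans (lerD IH (lexx _)) _.
  rewrite /e sqr_sqrtr ?(ltW (e0' m))// -mulrDr.
  by rewrite le_eqVlt; apply/orP; left; apply/eqP; rewrite exprS; field.
have sumd' : \sum_(k < N) d k ^+ 2 <= eta / 4.
  have := sumd N; rewrite -mulr_sumr.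
  have : 0 <= \sum_(k < N) d k ^+ 2 by apply: sumr_ge0 => k _; exact: sqr_ge0.
  by have := @pi_ge2 R; nra.
have e2 : \sum_(k < N) e k ^+ 2 <= eta / 4.
  apply: le_trans (sume N) _.
  have : 0 <= 2^-1 ^+ N :> R by rewrite exprn_ge0// invr_ge0.
  by move: eta0; nra.
rewrite -{1}(subn0 N) -/(index_iota 0 N) big_mkord.
apply: (@le_trans _ _ (2 * \sum_(k < N) d k ^+ 2 + 2 * \sum_(k < N) e k ^+ 2)); last by lra.
rewrite !mulr_sumr -big_split /=; apply: ler_sum => k _.
have := sqr_ge0 (d k - e k); rewrite sqrrB sqrrD; lra.
Qed.

End Bridge.

(** * Unbounded Lipschitz functions, and points off countably many null sets *)

Section PlanarGeneral.
Context {R : realType}.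
Implicit Types (N D : set R[i]) (z w : R[i]) (b y : R).

Lemma max_dist (p q p' q' c : R) : `|p - p'| <= c -> `|q - q'| <= c ->
  `|Num.max p q - Num.max p' q'| <= c.
Proof.
rewrite !ler_norml => /andP[? ?] /andP[? ?]; apply/andP.
by case: (leP p q) => ?; case: (leP p' q') => ?; split; lra.
Qed.

Lemma min_dist (p q p' q' c : R) : `|p - p'| <= c -> `|q - q'| <= c ->
  `|Num.min p q - Num.min p' q'| <= c.
Proof.
rewrite !ler_norml => /andP[? ?] /andP[? ?]; apply/andP.
by case: (leP p q) => ?; case: (leP p' q') => ?; split; lra.
Qed.

Lemma clamp_dist b b' y y' : `|clamp b y - clamp b' y'| <= `|b - b'| + `|y - y'|.
Proof.
have b1 : `|b - b'| <= `|b - b'| + `|y - y'| by rewrite lerDl.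
apply: max_dist; last by apply: min_dist => //; rewrite lerDr.
by rewrite -opprD normrN.
Qed.

(** Clamping [u] to [[-tau, tau]] with the cone [tau = max(0, T - |w|)] keeps it Lipschitz and makes
    it bounded and supported in a disc. The choice of [T] gives [|u| <= tau] on [N] and [D], so [u]
    is unchanged there. *)
Lemma cauchy_approx (u : R[i] -> R) (L B rho : R) N D :
  0 <= L -> dist_lip u L ->
  null2 N -> 0 < rho -> (forall z w, D z -> cm (z - w) < rho -> u w = 0) ->
  (forall z, N z \/ D z -> cm z <= B) ->
  forall eta : R, 0 < eta -> exists (I : finType) (P : pred I) (a l : I -> R[i]) (d : R),
   [/\ 0 < d, forall z i, N z \/ D z -> P i -> d <= cm (z - l i)
     & forall z, N z \/ D z -> cm ((u z)%:C - \sum_(i | P i) a i / (z - l i)) <= eta].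
Proof.
move=> L0 uL N2 rho0 uD NDB eta eta0.
pose B' := Num.max B 1.
have B'1 : 1 <= B' by rewrite le_max lexx orbT.
have NDB' z : N z \/ D z -> cm z <= B' by move=> /NDB zB; rewrite le_max zB.
pose T := B' + `|u 0| + L * B'.
have LB0 : 0 <= L * B' by rewrite mulr_ge0//; lra.
have u00 := normr_ge0 (u 0).
have T0 : 0 <= T by rewrite /T; lra.
pose tau w : R := Num.max 0 (T - cm w).
have tau0 w : 0 <= tau w by rewrite le_max lexx.
have tau_lip z w : `|tau z - tau w| <= cm (z - w).
  rewrite ler_norml; have := cm_dist z 0 w; have := cm_dist w 0 z.
  rewrite !subr0 (cmB w z); have := cm_ge0 (z - w); rewrite /tau.
  by case: (leP 0 (T - cm z)) => ?; case: (leP 0 (T - cm w)) => ? *; apply/andP; split; lra.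
pose v w := clamp (tau w) (u w).
have uv z : N z \/ D z -> v z = u z.
  move=> NDz; rewrite /v clamp_id//; have zB := NDB' _ NDz.
  have := uL z 0; rewrite subr0 => uz.
  have : L * cm z <= L * B' by rewrite ler_wpM2l.
  have := ler_normD (u z - u 0) (u 0); rewrite subrK.
  by rewrite /tau le_max => *; apply/orP; right; rewrite /T; lra.
have [|||||I [P [a [l [d [d0 Pd app]]]]]] := @cauchy_approx_supp R v (1 + L) T T B' rho N D _ _ _ T0 _ B'1 N2 rho0 _ NDB' eta eta0.
- by lra.
- move=> z w; apply: le_trans (clamp_dist _ _ _ _) _.
  by rewrite mulrDl mul1r lerD.
- move=> w; apply: le_trans (clamp_norm _ (tau0 w)) _.
  by rewrite /tau ge_max T0 /=; have := cm_ge0 w; lra.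
- move=> w Tw; rewrite /v /tau (max_idPl _); last by lra.
  by rewrite /clamp oppr0; apply/max_idPl; rewrite ge_min lexx.
- move=> z w Dz zw; rewrite /v (uD z w)// clamp_id// normr0//.
exists I, P, a, l, d; split=> // z NDz; rewrite -uv//; exact: app.
Qed.

(** Otherwise the null sets cover a closed square of half-side [l]. Compactness leaves finitely many
    discs, and counting a lattice in the square gives [(2 * l) ^+ 2 <= 16 * (l ^+ 2 / 8)], which is
    absurd. *)
Lemma null2_generic (N : nat -> set R[i]) (mu : R[i]) (delta : R) :
  (forall k, null2 (N k)) -> 0 < delta ->
  exists mu', cm (mu' - mu) < delta /\ forall k, ~ N k mu'.
Proof.
move=> N2 delta0; apply: contrapT => nex.
pose l := delta / 4; have l0 : 0 < l by rewrite divr_gt0.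
have covered z : `|complex.Re z| <= l -> `|complex.Im z| <= l -> exists k, N k (mu + z).
  move=> z1 z2; apply: contrapT => nk; apply: nex; exists (mu + z); split.
    by rewrite addrAC subrr add0r; apply: le_lt_trans (cm_le_ReIm _) _; rewrite /l in z1 z2; lra.
  by move=> k Nk; apply: nk; exists k.
pose e k : R := l ^+ 2 / 8 * 2^-1 ^+ k.+1.
have e0 k : 0 < e k by rewrite mulr_gt0 ?divr_gt0 ?exprn_gt0// invr_gt0.
pose s k := projT1 (cid (N2 k _ (e0 k))).
have sP k : [/\ forall p, p \in s k -> 0 < p.2,
      forall z, N k z -> exists2 p, p \in s k & cm (z - p.1) < p.2
    & \sum_(p <- s k) p.2 ^+ 2 <= e k] by rewrite /s; case: cid.
have /compact_near_coveringP cK := @compact_square R l.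
have [|M _ /(_ M (leqnn M)) HM] := cK _ \oo (fun M z => in_discs (flatten [seq s k | k <- iota 0 M]) (mu + z)) _.
  move=> z [z1 z2]; have [k Nk] := covered z z1 z2.
  have [_ /(_ _ Nk)[p pk zp] _] := sP k.
  exists ([set w | cm (z - w) < p.2 - cm (mu + z - p.1)], [set M | (k < M)%N]).
    split; last by exists k.+1.
    by apply/nbhs_cmP; exists (p.2 - cm (mu + z - p.1)) => //; rewrite subr_gt0.
  move=> [w M] /= [zw kM]; apply/hasP; exists p.
    by apply/flattenP; exists (s k) => //; apply: map_f; rewrite mem_iota.
  have := cm_dist (mu + w) p.1 (mu + z); rewrite opprD addrACA subrr add0r (cmB w z); lra.
pose S := flatten [seq s k | k <- iota 0 M].
have S0 p : p \in S -> 0 < p.2.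
  by move/flattenP => [_ /mapP[k _ ->]]; have [+ _ _] := sP k; exact.
have SS : \sum_(p <- S) p.2 ^+ 2 <= l ^+ 2 / 8.
  have sume m : \sum_(k < m) e k <= l ^+ 2 / 8 * (1 - 2^-1 ^+ m).
    elim: m => [|m IH]; first by rewrite big_ord0 expr0 subrr mulr0.
    rewrite big_ord_recr /=; apply: le_trans (lerD IH (lexx _)) _.
    by rewrite /e le_eqVlt; apply/orP; left; apply/eqP; rewrite [2^-1 ^+ m.+1]exprS; field.
  apply: (@le_trans _ _ (\sum_(k < M) e k)); last first.
    apply: le_trans (sume M) _.
    have : 0 <= 2^-1 ^+ M :> R by rewrite exprn_ge0// invr_ge0.
    by have := sqr_ge0 l; nra.
  rewrite /S big_flatten big_map -{1}(subn0 M) -/(index_iota 0 M) big_mkord.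
  by apply: ler_sum => k _; have [] := sP k.
have [m m0 mS] := seq_gt0_lower S0.
have [n [h [h0 hm nh]]] := ex_mesh l0 m0.
have := @sum_in_discs_le R (complex.Re mu - l) (complex.Im mu - l) h n S h0.
have hS p : p \in S -> h <= p.2 by move=> /mS; apply: le_trans.
move=> /(_ hS).
have inD (a b : 'I_n) : in_discs S (lpt (complex.Re mu - l) (complex.Im mu - l) h a b).
  have bd (c : 'I_n) : `|- l + c%:R * h| <= l.
    have c0 : 0 <= c%:R * h by rewrite mulr_ge0// ltW.
    have c1 : c%:R * h <= 2 * l by rewrite -nh ler_pM2r// ler_nat ltnW.
    by rewrite ler_norml; apply/andP; split; lra.
  have := HM ((- l + a%:R * h) +i* (- l + b%:R * h)) (conj (bd a) (bd b)).
  congr (in_discs _ _); case: (mu) => x y.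
  by apply/eqP; rewrite eq_complex /=; apply/andP; split; apply/eqP; ring.
under eq_bigr do under eq_bigr do rewrite inD.
rewrite (sum_lattice_const nh) mulr1 => le.
have : 0 < l ^+ 2 by rewrite exprn_gt0.
by move: le SS; rewrite exprMn; lra.
Qed.

End PlanarGeneral.

(** * Uniform limits of polynomials *)

Section CauchyEstimates.
Context {R : realType}.
Notation C := R[i].

Lemma prim_root_exists (F : numClosedFieldType) k : (0 < k)%N ->
  exists w : F, k.-primitive_root w.
Proof.
move=> k0; have [r rE] := closed_field_poly_normal ('X^k - 1 : {poly F}).
rewrite (monicP _) ?monicXnsubC// scale1r in rE.
have unity : all k.-unity_root r by apply/allP => z; rewrite -root_prod_XsubC -rE.
have size_r : (k < (size r).+1)%N by rewrite -(size_prod_XsubC r id) -rE size_XnsubC.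
have [|w _ wk] := hasP (has_prim_root k0 unity _ size_r); last by exists w.
by rewrite -separable_prod_XsubC -rE separable_Xn_sub_1// pnatr_eq0 -lt0n.
Qed.

(** Cauchy's formula for a coefficient, with the contour integral replaced by a mean over the [N]-th
    roots of unity; it is exact because the degree is below [N]. The exponent [j * (N - k)] stands
    for [- j * k]. *)
Lemma coef_roots_of_unity (F : numClosedFieldType) (q : {poly F}) (rho : F) k N :
  (size q <= N)%N -> (k < N)%N -> exists w : F, w ^+ N = 1 /\
    N%:R * (q`_k * rho ^+ k) = \sum_(j < N) q.[rho * w ^+ j] * w ^+ (j * (N - k)).
Proof.
move=> sq kN; have N0 : (0 < N)%N by apply: leq_trans kN.
have [w wN] := prim_root_exists F N0; exists w; split; first exact: prim_expr_order.
under eq_bigr do rewrite (horner_coef_wide _ sq) mulr_suml.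
rewrite exchange_big /= (bigD1 (Ordinal kN))//= [X in _ = _ + X]big1 ?addr0.
  under eq_bigr => j _.
    rewrite exprMn -exprM -!mulrA -exprD -mulnDr subnKC; last exact: ltnW.
    rewrite mulnC exprM (prim_expr_order wN) expr1n mulr1; over.
  by rewrite sumr_const card_ord mulr_natl.
move=> i ik.
under eq_bigr do rewrite exprMn -exprM -!mulrA -exprD -mulnDr mulnC exprM mulrA.
rewrite -mulr_sumr; set x := w ^+ _.
have x1 : x != 1.
  rewrite /x -(expr0 w) (eq_prim_root_expr wN) mod0n.
  apply: contra ik => /dvdnP[c]; move: (ltn_ord i) => iN cE; apply/eqP/val_inj => /=.
  move: cE; case: c => [|[|c]]; rewrite ?mul0n ?mul1n ?mulSn; lia.
have : (x - 1) * \sum_(j < N) x ^+ j = 0.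
  by rewrite -subrX1 -exprM mulnC exprM (prim_expr_order wN) expr1n subrr.
by move/eqP; rewrite mulf_eq0 subr_eq0 (negbTE x1) /= => /eqP ->; rewrite mulr0.
Qed.

Lemma cauchy_coef (q : {poly C}) (rho M : R) k : 0 <= rho ->
  (forall t, cm t <= rho -> cm q.[t] <= M) -> cm q`_k * rho ^+ k <= M.
Proof.
move=> rho0 qM.
have M0 : 0 <= M by apply: le_trans (qM 0 _); rewrite ?cm_ge0// cm0.
have [sk|ks] := leqP (size q) k; first by rewrite nth_default// cm0 mul0r.
have [w [wN sumE]] := @coef_roots_of_unity C q rho%:C k (size q) (leqnn _) ks.
have cw : cm w = 1.
  apply/eqP; rewrite -(@pexpr_eq1 _ _ (size q)) ?cm_ge0 -?cmX ?wN ?cm1//.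
  exact: leq_ltn_trans ks.
have s0 : 0 < (size q)%:R :> R by rewrite ltr0n (leq_ltn_trans _ ks).
rewrite -(ler_pM2l s0).
have -> : (size q)%:R * (cm q`_k * rho ^+ k) = cm ((size q)%:R * (q`_k * rho%:C ^+ k)).
  rewrite !cmM cmX cm_real ger0_norm//; congr (_ * _).
  have -> : (size q)%:R = (size q)%:R%:C :> C by rewrite rmorph_nat.
  by rewrite cm_real ger0_norm.
rewrite sumE; apply: le_trans (cm_sum _ _ _) _.
rewrite mulr_natl -[X in _ *+ X](card_ord (size q)) -sumr_const; apply: ler_sum => j _.
rewrite cmM cmX cw expr1n mulr1 qM// cmM cmX cw expr1n mulr1 cm_real ger0_norm//.
Qed.

(** By [cauchy_coef] the coefficients of index at least 2 are dominated by a geometric series of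
    ratio [1 / rho <= 1 / 2]. *)
Lemma cauchy_taylor (q : {poly C}) (rho M : R) : 2 <= rho ->
  (forall t, cm t <= rho -> cm q.[t] <= M) ->
  cm (q.[1] - q`_0 - q`_1) <= 2 * M / rho ^+ 2.
Proof.
move=> rho2 qM; have rho0 : 0 < rho by lra.
have M0 : 0 <= M by apply: le_trans (qM 0 _); rewrite ?cm_ge0// cm0 ltW.
rewrite (horner_coef_wide _ (leq_addr 2 (size q))).
rewrite addn2 !big_ord_recl /= !expr1n !mulr1.
have -> (a b c : C) : a + (b + c) - a - b = c by ring.
apply: le_trans (cm_sum _ _ _) _.
apply: (@le_trans _ _ (\sum_(i < size q) M / rho ^+ 2 * 2^-1 ^+ i)).
  apply: ler_sum => i _; rewrite expr1n mulr1.
  have := @cauchy_coef q rho M i.+2 (ltW rho0) qM.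
  rewrite -ler_pdivlMr ?exprn_gt0// => /le_trans; apply.
  have -> : M / rho ^+ i.+2 = M / rho ^+ 2 * rho^-1 ^+ i.
    by rewrite -add2n exprD invfM mulrA exprVn.
  rewrite ler_wpM2l ?divr_ge0 ?exprn_ge0 ?(ltW rho0)//.
  by apply: lerXn2r; rewrite ?nnegrE ?invr_ge0 ?(ltW rho0)// lef_pV2 ?posrE.
rewrite -mulr_sumr [2 * M]mulrC -[leRHS]mulrA [X in _ <= _ * X]mulrC mulrA.
rewrite ler_wpM2l ?divr_ge0 ?exprn_ge0 ?(ltW rho0)//.
have -> m : \sum_(i < m) (2^-1 : R) ^+ i = 2 - 2 * 2^-1 ^+ m.
  elim: m => [|m IH]; first by rewrite big_ord0 expr0; ring.
  by rewrite big_ord_recr /= IH exprS; field.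
by rewrite gerBl mulr_ge0 ?exprn_ge0 ?invr_ge0.
Qed.

(** The limit of each of the real and imaginary parts is the supremum of the lower bounds
    [x m - e m]; adding the two errors gives the factor 2. *)
Lemma cm_complete (a : nat -> C) (e : nat -> R) :
  (forall eta, 0 < eta -> exists m, e m <= eta) ->
  (forall m k, (m <= k)%N -> cm (a m - a k) <= e m) ->
  exists l, forall m, cm (a m - l) <= 2 * e m.
Proof.
move=> e0 ae.
have real (x : nat -> R) : (forall m k, (m <= k)%N -> `|x m - x k| <= e m) ->
    exists l, forall m, `|x m - l| <= e m.
  move=> xe.
  have le m k : x m - e m <= x k + e k.
    case: (leqP m k) => [mk|/ltnW km].
      have := xe _ _ mk; have := le_trans (normr_ge0 _) (xe _ _ (leqnn k)).
      by rewrite ler_norml => ? /andP[? ?]; lra.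
    have := xe _ _ km; have := le_trans (normr_ge0 _) (xe _ _ (leqnn m)).
    by rewrite ler_norml => ? /andP[? ?]; lra.
  pose E := [set x m - e m | m in [set: nat]].
  have supE : has_sup E.
    split; first by exists (x 0%N - e 0%N), 0%N.
    by exists (x 0%N + e 0%N) => _ [m _ <-].
  exists (sup E) => m; rewrite ler_norml; apply/andP; split.
    have : sup E <= x m + e m by apply: ge_sup => [|_ [k _ <-]] //; case: supE.
    by lra.
  have : x m - e m <= sup E by apply: ub_le_sup; [case: supE|exists m].
  by lra.
have ReB z w : complex.Re (z - w) = complex.Re z - complex.Re w by case: z; case: w.
have ImB z w : complex.Im (z - w) = complex.Im z - complex.Im w by case: z; case: w.
have [m k mk|p hp] := real (fun m => complex.Re (a m)).
  by rewrite -ReB; apply: le_trans (Re_le_cm _) (ae m k mk).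
have [m k mk|q hq] := real (fun m => complex.Im (a m)).
  by rewrite -ImB; apply: le_trans (Im_le_cm _) (ae m k mk).
exists (p +i* q) => m; apply: le_trans (cm_le_ReIm _) _.
by rewrite ReB ImB /=; have := hp m; have := hq m; lra.
Qed.

End CauchyEstimates.

(** * Complex differentiability from estimates on complex lines *)

Lemma differentiable_littleo (K : numFieldType) (V W : normedModType K) (f : V -> W)
    (l : {linear V -> W}) z : continuous l ->
  (forall e : K, 0 < e -> \forall v \near 0, `|f (v + z) - (f z + l v)| <= e * `|v|) ->
  differentiable f z.
Proof.
move=> lc lo.
have lo' : f \o shift z = cst (f z) + l +o_ 0 id by apply/eqaddoP => e e0; exact: lo.
by apply/diff_locallyP; rewrite (diff_unique lc lo').
Qed.

Section PolyFunctions.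
Context {R : realType} {n : nat}.
Notation C := R[i].
Notation V := 'rV[R[i]]_n.
Implicit Types (z w v : V) (p q f g : V -> C).

Inductive polyfun : (V -> C) -> Prop :=
| polyfun_cst c : polyfun (fun=> c)
| polyfun_coord j : polyfun (fun z => z ord0 j)
| polyfunD p q : polyfun p -> polyfun q -> polyfun (fun z => p z + q z)
| polyfunM p q : polyfun p -> polyfun q -> polyfun (fun z => p z * q z).

Lemma polyfunB p q : polyfun p -> polyfun q -> polyfun (fun z => p z - q z).
Proof.
move=> pp pq; have -> : (fun z => p z - q z) = (fun z => p z + (-1) * q z).
  by apply/funext => z; rewrite mulN1r.
by apply: polyfunD => //; apply: polyfunM => //; apply: polyfun_cst.
Qed.

(** The differential read off from complex lines: [l v] is the linear coefficient of a one-variable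
    polynomial, so that one-variable Cauchy estimates bound it. *)
Definition line_deriv p z (l : V -> C) :=
  (forall (a : C) v w, l (a *: v + w) = a * l v + l w) /\
  forall v, exists q : {poly C}, (forall t, p (z + t *: v) = q.[t]) /\ q`_1 = l v.

Lemma polyfun_line p z : polyfun p -> exists l, line_deriv p z l.
Proof.
elim=> {p} [c|j|p q _ [l [lL lq]] _ [m [mL mq]]|p q _ [l [lL lq]] _ [m [mL mq]]].
- exists (fun=> 0); split=> [a v w|v]; first by rewrite mulr0 addr0.
  by exists c%:P; split=> [t|]; rewrite ?hornerC ?coefC.
- exists (fun v => v ord0 j); split=> [a v w|v]; first by rewrite !mxE.
  exists ((z ord0 j)%:P + (v ord0 j)%:P * 'X); split=> [t|].
    by rewrite !mxE hornerD hornerM !hornerC hornerX mulrC.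
  by rewrite coefD coefC coefCM coefX mulr1 add0r.
- exists (fun v => l v + m v); split=> [a v w|v].
    by rewrite lL mL mulrDr addrACA.
  have [r [rE <-]] := lq v; have [s [sE <-]] := mq v.
  by exists (r + s); split=> [t|]; rewrite ?hornerD ?coefD ?rE ?sE.
- exists (fun v => p z * m v + q z * l v); split=> [a v w|v].
    by rewrite lL mL; ring.
  have [r [rE <-]] := lq v; have [s [sE <-]] := mq v.
  exists (r * s); split=> [t|]; first by rewrite hornerM rE sE.
  have := rE 0; have := sE 0; rewrite !horner_coef0 scale0r addr0 => -> ->.
  by rewrite coefM !big_ord_recl big_ord0 /= addr0 [X in _ + X]mulrC.
Qed.

Definition unifpoly (r : R) f := forall eps, 0 < eps -> exists2 p, polyfun p &
  forall z, nrm z <= r -> cm (f z - p z) <= eps.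

Lemma line_derivB p q z l m : line_deriv p z l -> line_deriv q z m ->
  line_deriv (fun z => p z - q z) z (fun v => l v - m v).
Proof.
move=> [lL lp] [mL mq]; split=> [a v w|v]; first by rewrite lL mL; ring.
have [r [rE <-]] := lp v; have [s [sE <-]] := mq v.
by exists (r - s); split=> [t|]; rewrite ?hornerD ?hornerN ?coefB ?rE ?sE.
Qed.

(** On the line through [z] in direction [v], the one-variable estimates hold on the disc of radius
    [rho / nrm v]; the first coefficient gives the bound on [l], the value at [t = 1] the
    remainder. *)
Lemma line_deriv_taylor p z l (rho M : R) : line_deriv p z l -> 0 < rho ->
  (forall w, nrm w <= nrm z + rho -> cm (p w) <= M) ->
  (forall v, cm (l v) <= M / rho * nrm v)
  /\ forall v, nrm v <= rho / 2 -> cm (p (z + v) - p z - l v) <= 2 * M / rho ^+ 2 * nrm v ^+ 2.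
Proof.
move=> [lL lq] rho0 pM.
have l0 : l 0 = 0.
  by have := lL (-1) 0 0; rewrite scaler0 addr0 mulN1r addNr.
have M0 : 0 <= M.
  by apply: le_trans (pM z _); rewrite ?cm_ge0// lerDl ltW.
have nz v : v != 0 -> 0 < nrm v.
  move=> v0; rewrite lt_def nrm_ge0 andbT; apply: contra v0 => /eqP v0.
  apply/eqP/rowP => j; rewrite mxE; apply/eqP; rewrite -cm_eq0 eq_le cm_ge0 andbT -v0.
  exact: cm_le_nrm.
have bd v (t : C) : 0 < nrm v -> cm t <= rho / nrm v -> cm (p (z + t *: v)) <= M.
  move=> v0 tv; apply: pM; apply: le_trans (nrmD _ _) _; rewrite lerD2l.
  by apply: le_trans (nrmZ _ _) _; rewrite -ler_pdivlMr.
split=> v.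
  have [->|/nz v0] := eqVneq v 0; first by rewrite l0 cm0 nrm0 mulr0.
  have [q [qE <-]] := lq v.
  have qM t : cm t <= rho / nrm v -> cm q.[t] <= M by rewrite -qE; exact: bd.
  have rv : 0 < rho / nrm v by rewrite divr_gt0.
  have := @cauchy_coef R q (rho / nrm v) M 1 (ltW rv) qM.
  by rewrite expr1 -ler_pdivlMr// invf_div mulrA mulrAC.
have [->|/nz v0] := eqVneq v 0.
  by rewrite l0 addr0 subrr subr0 cm0 nrm0 expr0n mulr0.
move=> vr; have [q [qE <-]] := lq v.
have qM t : cm t <= rho / nrm v -> cm q.[t] <= M by rewrite -qE; exact: bd.
have rv : 2 <= rho / nrm v by rewrite ler_pdivlMr// mulrC -ler_pdivlMr.
have := cauchy_taylor rv qM; rewrite -horner_coef0 -!qE scale1r scale0r addr0.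
by rewrite expr_div_n invf_div mulrA mulrAC.
Qed.

Lemma polyfun_bounded p (M : R) : polyfun p -> exists2 B, 0 <= B & forall z, nrm z <= M -> cm (p z) <= B.
Proof.
elim=> {p} [c|j|p q _ [A A0 pA] _ [B B0 qB]|p q _ [A A0 pA] _ [B B0 qB]].
- by exists (cm c); rewrite ?cm_ge0.
- by exists (Num.max M 0) => [|z zM]; rewrite le_max ?lexx ?orbT// (le_trans (cm_le_nrm z j) zM).
- exists (A + B) => [|z zM]; first by rewrite addr_ge0.
  by apply: le_trans (cmD _ _) _; rewrite lerD ?pA ?qB.
- exists (A * B) => [|z zM]; first by rewrite mulr_ge0.
  by rewrite cmM ler_pM ?cm_ge0 ?pA ?qB.
Qed.

Lemma polyfun_lip p (M : R) : polyfun p -> exists2 L, 0 <= L &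
  forall z w, nrm z <= M -> nrm w <= M -> cm (p z - p w) <= L * nrm (z - w).
Proof.
elim=> {p} [c|j|p q _ [A A0 pA] _ [B B0 qB]|p q pp [A A0 pA] pq [B B0 qB]].
- by exists 0 => // z w _ _; rewrite subrr cm0 mul0r.
- exists 1 => // z w _ _; rewrite mul1r.
  by have := cm_le_nrm (z - w) j; rewrite !mxE.
- exists (A + B) => [|z w zM wM]; first by rewrite addr_ge0.
  by rewrite opprD addrACA mulrDl; apply: le_trans (cmD _ _) _; rewrite lerD ?pA ?qB.
- have [P P0 pP] := polyfun_bounded M pp; have [Q Q0 qQ] := polyfun_bounded M pq.
  exists (A * Q + P * B) => [|z w zM wM]; first by rewrite addr_ge0 ?mulr_ge0.
  have -> : p z * q z - p w * q w = (p z - p w) * q z + p w * (q z - q w) by ring.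
  apply: le_trans (cmD _ _) _; rewrite !cmM mulrDl lerD//.
    by rewrite mulrAC ler_pM ?cm_ge0 ?pA ?qQ.
  by rewrite -mulrA ler_pM ?cm_ge0 ?pP ?qB.
Qed.

Lemma polyfun_differentiable p z : polyfun p -> differentiable p z.
Proof.
elim=> {p} [c|j|p q _ dp _ dq|p q _ dp _ dq].
- exact: differentiable_cst.
- exact: differentiable_coord.
- exact: differentiableD.
- exact: differentiableM.
Qed.

Lemma nrm_le_norm v : (nrm v)%:C <= `|v|.
Proof.
have coord j : `|v ord0 j| <= `|v|.
  rewrite [leRHS]mx_normE -[leLHS]nngE num_le.
  exact: (le_bigmax _ (fun ij : 'I_1 * 'I_n => `|v ij.1 ij.2|%:nng) (ord0, j)).
have := normr_ge0 v; move: coord; case: (`|v|) => a b coord.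
rewrite !lecE /= => /andP[/eqP b0 a0]; rewrite b0 eqxx /=.
by apply/nrm_leP => // j; have := coord j; rewrite normcE lecE /= => /andP[].
Qed.

Lemma quadratic_differentiable f z (l : V -> C) (M rho : R) : 0 < rho ->
  (forall (a : C) v w, l (a *: v + w) = a * l v + l w) ->
  (exists A, forall v, cm (l v) <= A * nrm v) ->
  (forall v, nrm v <= rho -> cm (f (z + v) - f z - l v) <= M * nrm v ^+ 2) ->
  differentiable f z.
Proof.
move=> rho0 lL [A lA] fl.
pose lin : {linear V -> C} := HB.pack l (GRing.isLinear.Build C V C *:%R l lL).
have lc : continuous lin.
  move=> v U /nbhs_cmP[e e0 eU]; apply/(@nbhs_nrmP R n v); exists (e / (`|A| + 1)).
    by rewrite divr_gt0// ltr_wpDl.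
  move=> w; rewrite ltr_pdivlMr ?ltr_wpDl// => vw; apply: eU.
  rewrite -linearB; apply: le_lt_trans (lA _) _; apply: le_lt_trans vw.
  rewrite mulrC ler_wpM2l ?nrm_ge0//; have := ler_norm A; lra.
apply: (differentiable_littleo lc) => e0 /lt_complex0[e0' e0E].
apply/(@nbhs_nrmP R n 0); exists (Num.min rho (complex.Re e0 / (`|M| + 1))).
  by rewrite lt_min rho0 divr_gt0// ltr_wpDl.
move=> v; rewrite sub0r nrmN lt_min => /andP[vr vM] /=.
have -> : f (v + z) - (f z + l v) = f (z + v) - f z - l v by rewrite [v + z]addrC opprD addrA.
rewrite e0E normcE; apply: le_trans (_ : (complex.Re e0 * nrm v)%:C <= _); last first.
  by rewrite real_complexM ler_wpM2l ?nrm_le_norm// lecR ltW.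
rewrite lecR; apply: le_trans (fl v (ltW vr)) _.
rewrite expr2 mulrA ler_wpM2r ?nrm_ge0//.
move: vM; rewrite ltr_pdivlMr ?ltr_wpDl// => /ltW; apply: le_trans.
rewrite mulrC ler_wpM2l ?nrm_ge0//; have := ler_norm M; lra.
Qed.

Lemma exp2V_small (K eta : R) : 0 < eta -> exists m, K * 2^-1 ^+ m <= eta.
Proof.
move=> eta0; have q0 : 0 <= `|K| / eta by rewrite divr_ge0// ltW.
exists (Num.truncn (`|K| / eta)).+1; set m := (Num.truncn _).+1.
apply: (@le_trans _ _ (`|K| * 2^-1 ^+ m)).
  by apply: ler_wpM2r; rewrite ?ler_norm// exprn_ge0// invr_ge0.
rewrite exprVn ler_pdivrMr ?exprn_gt0// mulrC -ler_pdivrMr//; apply: ltW.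
have /andP[_ lt] := truncn_itv q0; apply: lt_le_trans lt _.
by rewrite -natrX ler_nat ltnW// ltn_expl.
Qed.

(* The differentials of the approximating polynomials converge, and Cauchy's estimates on complex
   lines bound their second order remainders uniformly. *)
Lemma unifpoly_differentiable (r : R) f z : unifpoly r f -> nrm z < r -> differentiable f z.
Proof.
move=> fr zr; set rho := r - nrm z; have rho0 : 0 < rho by rewrite subr_gt0.
have rE : nrm z + rho = r by rewrite /rho addrC subrK.
pose e m : R := 2^-1 ^+ m.
have e0 m : 0 < e m by rewrite exprn_gt0// invr_gt0.
have e1 m : e m <= 1 by rewrite exprn_ile1 ?invr_ge0 ?invf_le1 ?ler1n.
have e_le m k : (m <= k)%N -> e k <= e m.
  by move=> mk; rewrite ler_wiXn2l ?invr_ge0 ?invf_le1 ?ler1n.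
have /choice[p pP] m : exists p, polyfun p /\ forall w, nrm w <= r -> cm (f w - p w) <= e m.
  by have [p pp pf] := fr _ (e0 m); exists p.
have /choice[l lP] m : exists l, line_deriv (p m) z l by apply: polyfun_line; exact: (pP m).1.
have [B B0 pB] := polyfun_bounded r (pP 0%N).1.
(* On the ball both [p 0] and [p m] are within 1 of [f], hence [B + 2]. *)
have pM m w : nrm w <= nrm z + rho -> cm (p m w) <= B + 2.
  rewrite rE => wr; have := (pP m).2 w wr; have := (pP 0%N).2 w wr; have := pB w wr.
  have := cm_dist (p m w) 0 (f w); have := cm_dist (f w) 0 (p 0%N w).
  rewrite !subr0 (cmB (p m w)); have := e1 m; have := e1 0%N; lra.
have pd m k w : (m <= k)%N -> nrm w <= nrm z + rho -> cm (p m w - p k w) <= 2 * e m.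
  rewrite rE => mk wr; have := (pP m).2 w wr; have := (pP k).2 w wr.
  by have := cm_dist (p m w) (p k w) (f w); rewrite (cmB (p m w) (f w)); have := e_le _ _ mk; lra.
have ld v m k : (m <= k)%N -> cm (l m v - l k v) <= 2 * e m / rho * nrm v.
  move=> mk; have [+ _] := line_deriv_taylor (line_derivB (lP m) (lP k)) rho0 (fun w => @pd m k w mk).
  exact.
have /choice[L lL] v : exists L, forall m, cm (l m v - L) <= 2 * (2 * e m / rho * nrm v).
  apply: cm_complete; last exact: ld.
  move=> eta eta0; have [m hm] := exp2V_small (2 / rho * nrm v) eta0.
  by exists m; move: hm; rewrite -/(e m); apply: le_trans; rewrite le_eqVlt; apply/orP; left; apply/eqP; ring.
have lim0 (x : C) (K : R) : (forall m, cm x <= K * e m) -> x = 0.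
  move=> xK; apply/eqP; rewrite -cm_eq0 eq_le cm_ge0 andbT.
  by apply/ler_addgt0Pr => eta eta0; rewrite add0r; have [m] := exp2V_small K eta0; apply: le_trans.
apply: (@quadratic_differentiable f z L (2 * (B + 2) / rho ^+ 2) (rho / 2)).
- by rewrite divr_gt0.
- move=> a v w; apply/eqP; rewrite -subr_eq0; apply/eqP.
  apply: (lim0 _ (4 / rho * (nrm (a *: v + w) + cm a * nrm v + nrm w))) => m.
  have -> : L (a *: v + w) - (a * L v + L w) =
     - (l m (a *: v + w) - L (a *: v + w)) + a * (l m v - L v) + (l m w - L w).
    by rewrite (lP m).1; ring.
  apply: le_trans (cmD _ _) _; apply: le_trans (lerD (cmD _ _) (lexx _)) _.
  rewrite cmN cmM.
  have := lL (a *: v + w) m; have := ler_wpM2l (cm_ge0 a) (lL v m); have := lL w m.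
  set x := cm (l m w - _); set y := cm a * cm _; set x' := cm (_ - _) => h1 h2 h3.
  apply: le_trans (lerD (lerD h3 h2) h1) _; rewrite le_eqVlt; apply/orP; left; apply/eqP; ring.
- exists ((B + 2) / rho + 4 / rho) => v.
  have [+ _] := line_deriv_taylor (lP 0%N) rho0 (pM 0%N); move=> /(_ v) h1.
  have := lL v 0%N; have := cm_dist (L v) 0 (l 0%N v); rewrite !subr0 (cmB (L v)).
  have -> : 2 * (2 * e 0%N / rho * nrm v) = 4 / rho * nrm v by rewrite /e expr0; ring.
  rewrite mulrDl.
  by move: h1; lra.
- move=> v vr.
  apply/ler_addgt0Pr => eta eta0.
  have [m hm] := exp2V_small (2 + 4 / rho * nrm v) eta0.
  have [_ +] := line_deriv_taylor (lP m) rho0 (pM m); move=> /(_ v vr) h1.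
  have zr' : nrm z <= r by exact: ltW.
  have zvr : nrm (z + v) <= r by apply: le_trans (nrmD _ _) _; rewrite -rE lerD2l; lra.
  have -> : f (z + v) - f z - L v = (p m (z + v) - p m z - l m v)
     + ((f (z + v) - p m (z + v)) - (f z - p m z) + (l m v - L v)) by ring.
  apply: le_trans (cmD _ _) _; apply: lerD => //; apply: le_trans _ hm.
  apply: le_trans (cmD _ _) _; apply: le_trans (lerD (cmD _ _) (lexx _)) _; rewrite cmN.
  apply: le_trans (lerD (lerD ((pP m).2 _ zvr) ((pP m).2 _ zr')) (lL v m)) _.
  rewrite -/(e m); rewrite le_eqVlt; apply/orP; left; apply/eqP; ring.
Qed.

End PolyFunctions.

(** * Rational approximation on a polydisc and a piece of a null set *)

Section UniformPolynomialLimits.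
Context {R : realType} {n : nat}.
Notation C := R[i].
Notation V := 'rV[R[i]]_n.
Implicit Types (z w v : V) (p q f g h : V -> C) (r M : R).

Lemma unifpoly_polyfun r p : polyfun p -> unifpoly r p.
Proof. by move=> pp e e0; exists p => // z _; rewrite subrr cm0 ltW. Qed.

Lemma unifpoly_bounded r f : unifpoly r f ->
  exists2 B, 0 <= B & forall z, nrm z <= r -> cm (f z) <= B.
Proof.
move=> fr; have [p pp pf] := fr 1 ltr01; have [B B0 pB] := polyfun_bounded r pp.
exists (B + 1) => [|z zr]; first by rewrite addr_ge0.
have := pf z zr; have := pB z zr; have := cmD (f z - p z) (p z); rewrite subrK; lra.
Qed.

Lemma unifpolyD r f g : unifpoly r f -> unifpoly r g -> unifpoly r (fun z => f z + g z).
Proof.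
move=> fr gr e e0; have e20 : 0 < e / 2 by rewrite divr_gt0.
have [p pp pf] := fr _ e20; have [q pq qg] := gr _ e20.
exists (fun z => p z + q z) => [|z zr]; first exact: polyfunD.
by rewrite opprD addrACA; apply: le_trans (cmD _ _) _; rewrite [leRHS]splitr lerD ?pf ?qg.
Qed.

Lemma unifpolyM r f g : unifpoly r f -> unifpoly r g -> unifpoly r (fun z => f z * g z).
Proof.
move=> fr gr e e0.
have [A A0 fA] := unifpoly_bounded fr; have [B B0 gB] := unifpoly_bounded gr.
have K0 : 0 < A + B + 2 by rewrite ltr_wpDl// addr_ge0.
pose d := Num.min 1 (e / (A + B + 2)).
have d0 : 0 < d by rewrite lt_min ltr01 divr_gt0.
have d1 : d <= 1 by rewrite ge_min lexx.
have dK : d * (A + B + 2) <= e by rewrite -ler_pdivlMr// ge_min lexx orbT.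
have [p pp pf] := fr _ d0; have [q pq qg] := gr _ d0.
exists (fun z => p z * q z) => [|z zr]; first exact: polyfunM.
have -> : f z * g z - p z * q z = (f z - p z) * g z + (f z - (f z - p z)) * (g z - q z) by ring.
apply: le_trans (cmD _ _) _; rewrite !cmM.
have h1 : cm (f z - p z) * cm (g z) <= d * B by rewrite ler_pM ?cm_ge0 ?pf ?gB.
have h2 : cm (f z - (f z - p z)) * cm (g z - q z) <= (A + 1) * d.
  rewrite ler_pM ?cm_ge0 ?qg//; apply: le_trans (cmD _ _) _; rewrite cmN lerD ?fA//.
  exact: le_trans (pf z zr) d1.
by apply: le_trans (lerD h1 h2) _; nra.
Qed.

Lemma unifpoly_lim r f :
  (forall eps, 0 < eps -> exists2 g, unifpoly r g & forall z, nrm z <= r -> cm (f z - g z) <= eps) ->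
  unifpoly r f.
Proof.
move=> H e e0; have e20 : 0 < e / 2 by rewrite divr_gt0.
have [g gr fg] := H _ e20; have [p pp pg] := gr _ e20; exists p => // z zr.
by apply: le_trans (cm_dist _ _ (g z)) _; rewrite [leRHS]splitr lerD ?fg ?pg.
Qed.

Lemma expr_small (t eta : R) : 0 <= t -> t < 1 -> 0 < eta -> exists N, t ^+ N <= eta.
Proof.
move=> t0 t1 eta0; have t1' : `|t| < 1 by rewrite ger0_norm.
have /cvgr0Pnorm_le /(_ eta eta0) [N _ /(_ N (leqnn N)) /=] := cvg_expr t1'.
by rewrite ger0_norm ?exprn_ge0// => ?; exists N.
Qed.

(* Geometric series: a pole outside a disc containing the values of [h] is harmless. *)
Lemma unifpoly_inv r h (mu c : C) (s : R) : unifpoly r h ->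
  (forall z, nrm z <= r -> cm (h z - c) <= s) -> s < cm (mu - c) ->
  unifpoly r (fun z => (h z - mu)^-1).
Proof.
move=> hr hs smu.
have [[z0 z0r]|nz] := pselect (exists z, nrm z <= r); last first.
  move=> e e0; exists (fun=> 0); first exact: polyfun_cst.
  by move=> z zr; case: nz; exists z.
have s0 : 0 <= s by apply: le_trans (hs z0 z0r); exact: cm_ge0.
have m0 : 0 < cm (mu - c) by apply: le_lt_trans smu.
have mn : mu - c != 0 by rewrite -cm_gt0.
pose t z := (h z - c) / (mu - c).
pose th := s / cm (mu - c).
have th0 : 0 <= th by rewrite divr_ge0// ltW.
have th1 : th < 1 by rewrite ltr_pdivrMr// mul1r.
have tth z : nrm z <= r -> cm (t z) <= th.
  by move=> zr; rewrite cmM cmV ler_wpM2r ?invr_ge0 ?cm_ge0// hs.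
have tr : unifpoly r t.
  apply: unifpolyM; last by apply: unifpoly_polyfun; apply: polyfun_cst.
  by apply: unifpolyD => //; apply: unifpoly_polyfun; apply: polyfun_cst.
have sr N : unifpoly r (fun z => - (mu - c)^-1 * \sum_(j < N) t z ^+ j).
  apply: unifpolyM; first by apply: unifpoly_polyfun; apply: polyfun_cst.
  elim: N => [|N IH].
    have -> : (fun z : V => \sum_(j < 0) t z ^+ j) = fun=> 0.
      by apply/funext => z; rewrite big_ord0.
    by apply: unifpoly_polyfun; apply: polyfun_cst.
  have -> : (fun z : V => \sum_(j < N.+1) t z ^+ j) = fun z => 1 + (\sum_(j < N) t z ^+ j) * t z.
    apply/funext => z; rewrite big_ord_recl expr0 mulr_suml; congr (_ + _).
    by apply: eq_bigr => j _; rewrite exprSr.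
  apply: unifpolyD; first by apply: unifpoly_polyfun; apply: polyfun_cst.
  exact: unifpolyM.
apply: unifpoly_lim => e e0.
pose K := cm (mu - c) * (1 - th).
have K0 : 0 < K by rewrite mulr_gt0// subr_gt0.
have [N tN] := expr_small th0 th1 (mulr_gt0 e0 K0).
exists (fun z => - (mu - c)^-1 * \sum_(j < N) t z ^+ j) => // z zr.
have t1 : cm (1 - t z) >= 1 - th.
  by have := cm_dist 1 0 (t z); rewrite !subr0 cm1; have := tth z zr; lra.
have t1n : 1 - t z != 0 by rewrite -cm_gt0; apply: lt_le_trans t1; rewrite subr_gt0.
have hE : h z - mu = - (mu - c) * (1 - t z).
  have tE : t z * (mu - c) = h z - c by rewrite /t divfK.
  rewrite [RHS](_ : _ = t z * (mu - c) - (mu - c)); last by ring.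
  by rewrite tE; ring.
have -> : (h z - mu)^-1 - - (mu - c)^-1 * (\sum_(j < N) t z ^+ j)
   = - ((mu - c)^-1 * (t z ^+ N / (1 - t z))).
  have -> : \sum_(j < N) t z ^+ j = (1 - t z ^+ N) / (1 - t z).
    apply/eqP; rewrite eq_sym (can2_eq (divfK t1n) (mulfK t1n)).
    by rewrite -opprB subrX1 -mulNr opprB mulrC.
  by rewrite hE invfM invrN; field; rewrite mn t1n.
rewrite cmN !cmM !cmV cmX.
apply: (@le_trans _ _ ((cm (mu - c))^-1 * (th ^+ N / (1 - th)))).
  rewrite ler_pM2l ?invr_gt0//; apply: ler_pM; rewrite ?invr_ge0 ?exprn_ge0 ?cm_ge0//.
    by apply: lerXn2r; rewrite ?nnegrE ?cm_ge0// tth.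
  by rewrite lef_pV2 ?posrE ?cm_gt0// subr_gt0.
by rewrite mulrCA -invfM ler_pdivrMr.
Qed.

End UniformPolynomialLimits.

(** * Rational functions without poles on [G] *)

Section Admissible.
Context {R : realType} {n : nat}.
Notation C := R[i].
Notation V := 'rV[R[i]]_n.
Context (G : set 'rV[R[i]]_n).
Implicit Types (z w v : V) (p q f g h : V -> C) (r M : R).

Hypothesis G_null : forall M, null2V (G `&` [set z | nrm z <= M]).
Hypothesis G_compact : forall M, gauge_compact (G `&` [set z | nrm z <= M]).

(** Values at the zeros of [q] are left free, since the convention [x / 0 = 0] is not compatible
    with bringing sums to a common denominator. *)
Definition quotpoly h := exists p q, [/\ polyfun p, polyfun q,
  forall z, G z -> q z != 0 & forall z, q z != 0 -> h z = p z / q z].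

Definition admissible r h := quotpoly h /\ unifpoly r h.

(** By the Lipschitz bound, [|q|] drops at most by half on the ball assigned to each centre, and
    finitely many centres suffice. *)
Lemma polyfun_lower q M : polyfun q -> (forall z, G z -> q z != 0) ->
  exists2 d, 0 < d & forall z, G z -> nrm z <= M -> d <= cm (q z).
Proof.
move=> pq q0; have [L L0 qL] := polyfun_lip M pq.
have L1 : 0 < 2 * (L + 1) by rewrite mulr_gt0// ltr_wpDl.
have [z [Gz _]|s [sG cov]] := @G_compact M (fun y => cm (q y) / (2 * (L + 1))).
  by rewrite divr_gt0// cm_gt0 q0.
have [y ys|m m0 ms] := seq_gt0_lower (s := s) (f := fun y => cm (q y)).
  by rewrite cm_gt0 q0//; have [] := sG y ys.
exists (m / 2) => [|z Gz zM]; first by rewrite divr_gt0.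
have [y ys] := cov z (conj Gz zM); have [Gy yM] := sG y ys.
rewrite ltr_pdivlMr// => zy; have := ms y ys; have := qL z y zM yM.
have := cm_dist (q y) 0 (q z); rewrite !subr0 (cmB (q y)).
have := nrm_ge0 (z - y); nra.
Qed.

Definition lip_on M f := exists2 L, 0 <= L & forall z w, G z -> G w ->
  nrm z <= M -> nrm w <= M -> cm (f z - f w) <= L * nrm (z - w).

Lemma quotpoly_bounded h M : quotpoly h ->
  exists2 B, 0 <= B & forall z, G z -> nrm z <= M -> cm (h z) <= B.
Proof.
move=> [p [q [pp pq q0 hE]]]; have [d d0 qd] := polyfun_lower M pq q0.
have [B B0 pB] := polyfun_bounded M pp.
exists (B / d) => [|z Gz zM]; first by rewrite divr_ge0// ltW.
rewrite hE ?q0// cmM cmV; apply: ler_pM; rewrite ?invr_ge0 ?cm_ge0 ?pB//.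
by rewrite lef_pV2 ?posrE ?cm_gt0 ?q0// qd.
Qed.

Lemma quotpoly_lip h M : quotpoly h -> lip_on M h.
Proof.
move=> [p [q [pp pq q0 hE]]]; have [d d0 qd] := polyfun_lower M pq q0.
have [A A0 pA] := polyfun_bounded M pp; have [B B0 qB] := polyfun_bounded M pq.
have [L L0 pL] := polyfun_lip M pp; have [K K0 qK] := polyfun_lip M pq.
exists ((L * B + A * K) / d ^+ 2) => [|z w Gz Gw zM wM].
  by rewrite divr_ge0 ?exprn_ge0 ?(ltW d0)// addr_ge0 ?mulr_ge0.
have qz := q0 z Gz; have qw := q0 w Gw; rewrite !hE//.
have -> : p z / q z - p w / q w = ((p z - p w) * q w - p w * (q z - q w)) / (q z * q w).
  by field; rewrite qz qw.
rewrite cmM cmV [leRHS]mulrAC; apply: ler_pM; rewrite ?invr_ge0 ?cm_ge0//.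
  apply: le_trans (cmD _ _) _; rewrite cmN !cmM mulrDl; apply: lerD.
    by rewrite mulrAC ler_pM ?cm_ge0 ?pL ?qB.
  by rewrite -mulrA ler_pM ?cm_ge0 ?pA ?qK.
rewrite lef_pV2 ?posrE ?exprn_gt0 ?cm_gt0 ?mulf_neq0// cmM expr2.
by rewrite ler_pM ?(ltW d0)// qd.
Qed.

Lemma quotpoly_polyfun p : polyfun p -> quotpoly p.
Proof.
move=> pp; exists p, (fun=> 1); split=> // [|z _]; first exact: polyfun_cst.
by rewrite divr1.
Qed.

Lemma quotpolyD f g : quotpoly f -> quotpoly g -> quotpoly (fun z => f z + g z).
Proof.
move=> [p [q [pp pq q0 fE]]] [p' [q' [pp' pq' q'0 gE]]].
exists (fun z => p z * q' z + p' z * q z), (fun z => q z * q' z); split.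
- by apply: polyfunD; apply: polyfunM.
- exact: polyfunM.
- by move=> z Gz; rewrite mulf_neq0 ?q0 ?q'0.
- move=> z; rewrite mulf_eq0 negb_or => /andP[qz q'z].
  by rewrite fE// gE//; field; rewrite qz q'z.
Qed.

Lemma quotpolyM f g : quotpoly f -> quotpoly g -> quotpoly (fun z => f z * g z).
Proof.
move=> [p [q [pp pq q0 fE]]] [p' [q' [pp' pq' q'0 gE]]].
exists (fun z => p z * p' z), (fun z => q z * q' z); split; try exact: polyfunM.
- by move=> z Gz; rewrite mulf_neq0 ?q0 ?q'0.
- move=> z; rewrite mulf_eq0 negb_or => /andP[qz q'z].
  by rewrite fE// gE//; field; rewrite qz q'z.
Qed.

Lemma quotpoly_inv h (mu : C) : quotpoly h -> (forall z, G z -> h z != mu) ->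
  quotpoly (fun z => (h z - mu)^-1).
Proof.
move=> [p [q [pp pq q0 hE]]] hmu.
exists (fun z => q z * q z), (fun z => q z * (p z - mu * q z)); split.
- exact: polyfunM.
- apply: polyfunM => //; apply: polyfunB => //; apply: polyfunM => //; exact: polyfun_cst.
- move=> z Gz; rewrite mulf_neq0 ?q0//; apply: contraNneq (hmu z Gz) => e.
  by rewrite hE ?q0// (subr0_eq e) mulfK ?q0.
- move=> z; rewrite mulf_eq0 negb_or => /andP[qz pz].
  by rewrite hE//; field; rewrite qz pz.
Qed.

(* [h @` G] is a countable union of null sets, by the local Lipschitz bounds. *)
Lemma quotpoly_generic h (mu : C) (delta : R) : quotpoly h -> 0 < delta ->
  exists2 mu', cm (mu' - mu) < delta & forall z, G z -> h z != mu'.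
Proof.
move=> hq d0.
have N2 k : null2 [set u | exists2 z, (G `&` [set z | nrm z <= k%:R]) z & u = h z].
  have [L L0 hL] := quotpoly_lip k%:R hq.
  by apply: (null2_lip_image (L := L)) => // z w [Gz zk] [Gw wk]; exact: hL.
have [mu' [mud mun]] := null2_generic mu N2 d0; exists mu' => // z Gz.
apply/eqP => e; apply: (mun (Num.truncn (nrm z)).+1); exists z => //; split=> //=.
by apply/ltW; have /andP[] := truncn_itv (nrm_ge0 z).
Qed.

End Admissible.

(** * Composition of approximable functions with Lipschitz functions *)

Section Approximable.
Context {R : realType} {n : nat}.
Notation C := R[i].
Notation V := 'rV[R[i]]_n.
Context (G : set 'rV[R[i]]_n).
Implicit Types (z w v : V) (p q f g h : V -> C) (r M : R) (phi psi : V -> R).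

Hypothesis G_null : forall M, null2V (G `&` [set z | nrm z <= M]).
Hypothesis G_compact : forall M, gauge_compact (G `&` [set z | nrm z <= M]).

Context (r M : R).

Definition approx_domain z := nrm z <= r \/ (G z /\ nrm z <= M).

Definition approximable f := forall eps, 0 < eps -> exists2 h, admissible G r h &
  forall z, approx_domain z -> cm (f z - h z) <= eps.

Lemma admissible_polyfun p : polyfun p -> admissible G r p.
Proof. by move=> pp; split; [exact: quotpoly_polyfun|exact: unifpoly_polyfun]. Qed.

Lemma admissibleD f g : admissible G r f -> admissible G r g -> admissible G r (fun z => f z + g z).
Proof. by move=> [? ?] [? ?]; split; [exact: quotpolyD|exact: unifpolyD]. Qed.

Lemma admissibleM f g : admissible G r f -> admissible G r g -> admissible G r (fun z => f z * g z).
Proof. by move=> [? ?] [? ?]; split; [exact: quotpolyM|exact: unifpolyM]. Qed.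

Lemma admissible_bounded h : admissible G r h ->
  exists2 B, 0 <= B & forall z, approx_domain z -> cm (h z) <= B.
Proof.
move=> [hq hr]; have [A A0 hA] := quotpoly_bounded G_compact M hq.
have [B B0 hB] := unifpoly_bounded hr.
exists (A + B) => [|z [zr|[Gz zM]]]; first by rewrite addr_ge0.
  by apply: le_trans (hB z zr) _; rewrite lerDr.
by apply: le_trans (hA z Gz zM) _; rewrite lerDl.
Qed.

Lemma approximable_admissible h : admissible G r h -> approximable h.
Proof. by move=> hr e e0; exists h => // z _; rewrite subrr cm0 ltW. Qed.

Lemma approximable_polyfun p : polyfun p -> approximable p.
Proof. by move=> pp; apply: approximable_admissible; exact: admissible_polyfun. Qed.

Lemma approximable_bounded f : approximable f ->
  exists2 B, 0 <= B & forall z, approx_domain z -> cm (f z) <= B.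
Proof.
move=> fa; have [h ha hf] := fa 1 ltr01; have [B B0 hB] := admissible_bounded ha.
exists (B + 1) => [|z Xz]; first by rewrite addr_ge0.
have := hf z Xz; have := hB z Xz; have := cmD (f z - h z) (h z); rewrite subrK; lra.
Qed.

Lemma approximable_lim f :
  (forall eps, 0 < eps -> exists2 g, approximable g & forall z, approx_domain z -> cm (f z - g z) <= eps) ->
  approximable f.
Proof.
move=> H e e0; have e20 : 0 < e / 2 by rewrite divr_gt0.
have [g ga fg] := H _ e20; have [h ha gh] := ga _ e20; exists h => // z Xz.
by apply: le_trans (cm_dist _ _ (g z)) _; rewrite [leRHS]splitr lerD ?fg ?gh.
Qed.

Lemma approximable_ext f g : (forall z, approx_domain z -> f z = g z) -> approximable f -> approximable g.
Proof. by move=> fg fa e e0; have [h ha hf] := fa e e0; exists h => // z Xz; rewrite -fg// hf. Qed.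

Lemma approximableD f g : approximable f -> approximable g -> approximable (fun z => f z + g z).
Proof.
move=> fa ga e e0; have e20 : 0 < e / 2 by rewrite divr_gt0.
have [h ha fh] := fa _ e20; have [k ka gk] := ga _ e20.
exists (fun z => h z + k z) => [|z Xz]; first exact: admissibleD.
by rewrite opprD addrACA; apply: le_trans (cmD _ _) _; rewrite [leRHS]splitr lerD ?fh ?gk.
Qed.

Lemma approximableM f g : approximable f -> approximable g -> approximable (fun z => f z * g z).
Proof.
move=> fa ga e e0.
have [A A0 fA] := approximable_bounded fa; have [B B0 gB] := approximable_bounded ga.
have K0 : 0 < A + B + 2 by rewrite ltr_wpDl// addr_ge0.
pose d := Num.min 1 (e / (A + B + 2)).
have d0 : 0 < d by rewrite lt_min ltr01 divr_gt0.
have d1 : d <= 1 by rewrite ge_min lexx.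
have dK : d * (A + B + 2) <= e by rewrite -ler_pdivlMr// ge_min lexx orbT.
have [p pa pf] := fa _ d0; have [q qa qg] := ga _ d0.
exists (fun z => p z * q z) => [|z Xz]; first exact: admissibleM.
have -> : f z * g z - p z * q z = (f z - p z) * g z + (f z - (f z - p z)) * (g z - q z) by ring.
apply: le_trans (cmD _ _) _; rewrite !cmM.
have h1 : cm (f z - p z) * cm (g z) <= d * B by rewrite ler_pM ?cm_ge0 ?pf ?gB.
have h2 : cm (f z - (f z - p z)) * cm (g z - q z) <= (A + 1) * d.
  rewrite ler_pM ?cm_ge0 ?qg//; apply: le_trans (cmD _ _) _; rewrite cmN lerD ?fA//.
  exact: le_trans (pf z Xz) d1.
apply: le_trans (lerD h1 h2) _; clear -dK d0 A0 B0; nra.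
Qed.

Lemma approximable_inv f (mu c : C) (d s : R) : approximable f -> 0 < d ->
  (forall z, approx_domain z -> d <= cm (f z - mu)) ->
  (forall z, nrm z <= r -> cm (f z - c) <= s) -> s < cm (mu - c) ->
  approximable (fun z => (f z - mu)^-1).
Proof.
move=> fa d0 fd fs smu e e0.
(* [d / 4] keeps [h - mu'] at least [d / 2] in modulus, [e * d ^+ 2 / 4] controls the error after
   division, and the last term keeps the moved pole [mu'] out of the disc that holds the values of
   [h] on the ball. *)
pose k := Num.min (Num.min (d / 4) (e * d ^+ 2 / 4)) ((cm (mu - c) - s) / 4).
have k0 : 0 < k by rewrite !lt_min !divr_gt0 ?subr_gt0 ?mulr_gt0 ?exprn_gt0.
have [k1 k2 k3] : [/\ k <= d / 4, k <= e * d ^+ 2 / 4 & k <= (cm (mu - c) - s) / 4].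
  by rewrite !ge_min !lexx !orbT.
have [h ha fh] := fa _ k0; have [hq hr] := ha.
have [mu' mumu' hmu'] := quotpoly_generic G_null G_compact mu hq k0.
exists (fun z => (h z - mu')^-1) => [|z Xz].
  split; first exact: quotpoly_inv.
  apply: (@unifpoly_inv _ _ r h mu' c (s + k)) => // [z zr|].
    have := cm_dist (h z) c (f z); have := fs z zr; have := fh z (or_introl zr).
    rewrite (cmB (h z) (f z)); lra.
  have := cm_dist mu c mu'; rewrite (cmB mu mu'); lra.
have fz := fd z Xz; have fhz := fh z Xz.
have hz : d / 2 <= cm (h z - mu').
  have := cm_dist (f z) mu (h z); have := cm_dist (h z) mu mu'; lra.
have fn : f z - mu != 0 by rewrite -cm_gt0; lra.
have hn : h z - mu' != 0 by rewrite -cm_gt0; lra.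
have -> : (f z - mu)^-1 - (h z - mu')^-1 = ((h z - f z) + (mu - mu')) / ((f z - mu) * (h z - mu')).
  by field; rewrite fn hn.
rewrite cmM cmV ler_pdivrMr ?cm_gt0 ?mulf_neq0//.
apply: (@le_trans _ _ (e * (d * (d / 2)))).
  apply: le_trans (cmD _ _) _; rewrite (cmB (h z)) (cmB mu).
  by have := ltW mumu'; move: k2; rewrite expr2; lra.
rewrite ler_pM2l// cmM; apply: ler_pM => //; rewrite ?divr_ge0 ?ltW//.
Qed.

Lemma approximable_sum_inv f (c : C) (d s : R) (I : finType) (P : pred I) (a l : I -> C) :
  approximable f -> 0 < d ->
  (forall z i, approx_domain z -> P i -> d <= cm (f z - l i)) ->
  (forall z, nrm z <= r -> cm (f z - c) <= s) -> (forall i, P i -> s < cm (l i - c)) ->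
  approximable (fun z => \sum_(i | P i) a i / (f z - l i)).
Proof.
move=> fa d0 fd fs sl.
rewrite (_ : (fun z => _) = fun z => \sum_(i <- [seq i <- enum I | P i]) a i / (f z - l i)); last first.
  by apply/funext => z; rewrite big_filter big_enum_cond.
have : all P [seq i <- enum I | P i] by apply: filter_all.
elim: [seq i <- enum I | P i] => [_|i t IH /= /andP[Pi Pt]].
  apply: (@approximable_ext (fun=> 0)) => [z _|]; first by rewrite big_nil.
  by apply: approximable_polyfun; exact: polyfun_cst.
apply: (@approximable_ext (fun z => a i * (f z - l i)^-1 + \sum_(i <- t) a i / (f z - l i))).
  by move=> z _; rewrite big_cons.
apply: approximableD; last exact: IH.
apply: approximableM; first by apply: approximable_polyfun; exact: polyfun_cst.
by apply: (@approximable_inv f (l i) c d s) => // [z Xz|]; [exact: fd|exact: sl].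
Qed.

(** The poles found in the plane stay away from [N] and [D], hence from the values of [f]. They also
    avoid the disc about [c] that holds the values on the ball, since this disc is contained in the
    union of [N] and [D]; [approximable_inv] asks for both. *)
Lemma approximable_comp f (u : C -> R) (L rho s : R) (c : C) (N D : set C) :
  approximable f -> 0 <= L -> dist_lip u L -> null2 N -> 0 < rho ->
  (forall z w : C, D z -> cm (z - w) < rho -> u w = 0) ->
  (exists B, forall z : C, N z \/ D z -> cm z <= B) ->
  (forall z, approx_domain z -> N (f z) \/ D (f z)) ->
  (forall z, nrm z <= r -> cm (f z - c) <= s) ->
  (forall w : C, cm (w - c) <= s -> N w \/ D w) ->
  approximable (fun z => (u (f z))%:C).
Proof.
move=> fa L0 uL N2 rho0 uD [B NDB] fND fs cND.
apply: approximable_lim => e e0.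
have [I [P [a [l [d [d0 dl app]]]]]] := cauchy_approx L0 uL N2 rho0 uD NDB e0.
exists (fun z => \sum_(i | P i) a i / (f z - l i)) => [|z Xz]; last exact/app/fND.
apply: (@approximable_sum_inv f c d s) => // [z i Xz Pi|i Pi].
  by apply: dl => //; exact: fND.
rewrite ltNge; apply/negP => li; have := dl _ _ (cND _ li) Pi.
by rewrite subrr cm0 leNgt d0.
Qed.

Lemma null2_add1 (N : set C) (c : C) : null2 N -> null2 (N `|` [set c]).
Proof.
move=> N2 e e0; have e20 : 0 < e / 2 by rewrite divr_gt0.
have [s [s0 sN se]] := N2 _ e20.
have q0 : 0 < Num.sqrt (e / 2) by rewrite sqrtr_gt0.
exists ((c, Num.sqrt (e / 2)) :: s); split.
- by move=> p; rewrite inE => /orP[/eqP->|/s0].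
- move=> z [Nz|/= ->].
    by have [p ps zp] := sN z Nz; exists p => //; rewrite inE ps orbT.
  by exists (c, Num.sqrt (e / 2)); rewrite ?mem_head//= subrr cm0.
- by rewrite big_cons /= sqr_sqrtr ?(ltW e20)// [leRHS]splitr lerD2l.
Qed.

Lemma null2_image f : lip_on G M f ->
  null2 [set u | exists2 z, (G `&` [set z | nrm z <= M]) z & u = f z].
Proof.
move=> [L L0 fL]; apply: (null2_lip_image (G_null M) (L := L)) => z w [? ?] [? ?]; exact: fL.
Qed.

(** The ball contributes the single value [c], so all values lie in a null set: [D] is empty, the
    disc degenerates to [s = 0], and [u] need not vanish anywhere. *)
Lemma approximable_comp_const f (u : C -> R) (L : R) (c : C) :
  approximable f -> lip_on G M f -> (forall z, nrm z <= r -> f z = c) ->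
  0 <= L -> dist_lip u L -> approximable (fun z => (u (f z))%:C).
Proof.
move=> fa fl fc L0 uL; have [B B0 fB] := approximable_bounded fa.
apply: (@approximable_comp f u L 1 0 c
  ([set u | exists2 z, (G `&` [set z | nrm z <= M]) z & u = f z] `|` [set c]) set0) => //.
- by apply: null2_add1; exact: null2_image.
- exists (B + cm c) => z [[[w [Gw wM] ->]|/= ->]|//].
    by apply: le_trans (fB w (or_intror (conj Gw wM))) _; rewrite lerDl cm_ge0.
  by rewrite lerDr.
- move=> z [zr|[Gz zM]]; left; first by right; exact: fc.
  by left; exists z.
- by move=> z zr; rewrite fc// subrr cm0.
- move=> w wc; left; right; apply/eqP.
  by rewrite -subr_eq0 -cm_eq0 eq_le wc cm_ge0.
Qed.

Definition annulus (a b : R) (w : C) : R := Num.max 0 (Num.min (cm w - a) (b - cm w)).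

Lemma annulus_lip a b : dist_lip (annulus a b) 1.
Proof.
move=> z w; rewrite mul1r ler_norml /annulus; have := cm_dist z 0 w; have := cm_dist w 0 z.
rewrite !subr0 (cmB w z); have := cm_ge0 (z - w).
case: (leP (cm z - a) (b - cm z)) => ?; case: (leP (cm w - a) (b - cm w)) => ?;
  (case: (leP 0 (_ - _)) => ?); (case: (leP 0 (_ - _)) => ?) => *; apply/andP; split; lra.
Qed.

(** A coordinate need not be constant on the ball, but its values there stay in the disc [D] of
    radius [r], and the annulus function vanishes within [a - r] of that disc. *)
Lemma approximable_annulus j (a b : R) : r < a ->
  approximable (fun z => (annulus a b (z ord0 j))%:C).
Proof.
move=> ra; pose f z : C := z ord0 j.
have pf : polyfun f by exact: polyfun_coord.
have fl : lip_on G M f by apply: (quotpoly_lip G_compact); exact: quotpoly_polyfun.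
apply: (@approximable_comp f (annulus a b) 1 (a - r) r 0
  [set u | exists2 z, (G `&` [set z | nrm z <= M]) z & u = f z] [set w | cm w <= r]) => //.
- exact: approximable_polyfun.
- exact: annulus_lip.
- exact: null2_image.
- by rewrite subr_gt0.
- move=> z w /= zr zw; rewrite /annulus; apply/max_idPl; rewrite ge_min; apply/orP; left.
  by have := cm_dist w 0 z; rewrite !subr0 (cmB w z); lra.
- exists (`|M| + `|r|) => z [[w [_ /= wM] ->]|/= zr].
    by apply: le_trans (cm_le_nrm w j) _; have := ler_norm M; have := normr_ge0 r; lra.
  by have := ler_norm r; have := normr_ge0 M; lra.
- move=> z [zr|[Gz zM]]; last by left; exists z.
  by right; apply: le_trans (cm_le_nrm z j) zr.
- by move=> z zr; rewrite subr0; apply: le_trans (cm_le_nrm z j) zr.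
- by move=> w; rewrite subr0; right.
Qed.

End Approximable.

(** * Stone-Weierstrass *)

Section Lattice.
Context {R : realType} {n : nat}.
Notation C := R[i].
Notation V := 'rV[R[i]]_n.
Context (G : set 'rV[R[i]]_n).
Implicit Types (z w v : V) (f g h : V -> C) (phi psi : V -> R).

Hypothesis G_null : forall M, null2V (G `&` [set z | nrm z <= M]).
Hypothesis G_compact : forall M, gauge_compact (G `&` [set z | nrm z <= M]).

Context (r M : R).

(** The Lipschitz bound makes the image of the piece of [G] null and constancy reduces the ball to
    one value; both survive composition with Lipschitz functions, so the class is stable. *)
Definition approx_const f := [/\ approximable G r M f, lip_on G M f &
  exists c, forall z, nrm z <= r -> f z = c].

Definition rapprox_const phi := approx_const (fun z => (phi z)%:C).

Lemma approx_constD f g : approx_const f -> approx_const g -> approx_const (fun z => f z + g z).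
Proof.
move=> [fa [L L0 fL] [c fc]] [ga [K K0 gK] [d gd]]; split.
- exact: approximableD.
- exists (L + K) => [|z w Gz Gw zM wM]; first by rewrite addr_ge0.
  by rewrite opprD addrACA mulrDl; apply: le_trans (cmD _ _) _; rewrite lerD ?fL ?gK.
- by exists (c + d) => z zr; rewrite fc ?gd.
Qed.

Lemma lip_on_bounded f : approximable G r M f ->
  exists2 B, 0 <= B & forall z, G z -> nrm z <= M -> cm (f z) <= B.
Proof.
move=> fa; have [B B0 fB] := approximable_bounded G_compact fa.
by exists B => // z Gz zM; apply: fB; right.
Qed.

Lemma lip_onM f g : approximable G r M f -> approximable G r M g ->
  lip_on G M f -> lip_on G M g -> lip_on G M (fun z => f z * g z).
Proof.
move=> fa ga [L L0 fL] [K K0 gK].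
have [A A0 fA] := lip_on_bounded fa; have [B B0 gB] := lip_on_bounded ga.
exists (L * B + A * K) => [|z w Gz Gw zM wM]; first by rewrite addr_ge0 ?mulr_ge0.
have -> : f z * g z - f w * g w = (f z - f w) * g z + f w * (g z - g w) by ring.
apply: le_trans (cmD _ _) _; rewrite !cmM mulrDl; apply: lerD.
  by rewrite mulrAC ler_pM ?cm_ge0 ?fL ?gB.
by rewrite -mulrA ler_pM ?cm_ge0 ?fA ?gK.
Qed.

Lemma approx_const_cst c : approx_const (fun=> c).
Proof.
split; [|by exists 0 => // z w _ _ _ _; rewrite subrr cm0 mul0r|by exists c].
by apply: approximable_polyfun; exact: polyfun_cst.
Qed.

Lemma approx_const_comp f (u : C -> R) (L : R) : approx_const f -> 0 <= L -> dist_lip u L ->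
  rapprox_const (fun z => u (f z)).
Proof.
move=> [fa fl [c fc]] L0 uL; split.
- exact: (approximable_comp_const G_null G_compact fa fl fc L0 uL).
- have [K K0 fK] := fl; exists (L * K) => [|z w Gz Gw zM wM]; first by rewrite mulr_ge0.
  rewrite -real_complexB cm_real; apply: le_trans (uL _ _) _.
  by rewrite -mulrA ler_wpM2l// fK.
- by exists (u c)%:C => z zr; rewrite fc.
Qed.

Lemma rapprox_constD phi psi : rapprox_const phi -> rapprox_const psi -> rapprox_const (fun z => phi z + psi z).
Proof.
move=> a b; have := approx_constD a b.
rewrite /rapprox_const; have -> // : (fun z => (phi z)%:C + (psi z)%:C) = (fun z => (phi z + psi z)%:C).
by apply/funext => z; rewrite real_complexD.
Qed.

Lemma rapprox_const_comp phi (u : R -> R) (L : R) : rapprox_const phi -> 0 <= L ->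
  (forall x y, `|u x - u y| <= L * `|x - y|) -> rapprox_const (fun z => u (phi z)).
Proof.
move=> a L0 uL.
suff uRe : dist_lip (fun w : C => u (complex.Re w)) L by exact: (approx_const_comp a L0 uRe).
move=> x y; apply: le_trans (uL _ _) _; rewrite ler_wpM2l//.
have -> : complex.Re x - complex.Re y = complex.Re (x - y) by case: x; case: y.
exact: Re_le_cm.
Qed.

Lemma rapprox_constZ phi (a : R) : rapprox_const phi -> rapprox_const (fun z => a * phi z).
Proof.
move=> h; apply: (@rapprox_const_comp phi (fun x => a * x) `|a| h) => // x y.
by rewrite -mulrBr normrM.
Qed.

Lemma rapprox_const_cst (a : R) : rapprox_const (fun=> a).
Proof. exact: approx_const_cst. Qed.

Lemma rapprox_const_max phi psi : rapprox_const phi -> rapprox_const psi -> rapprox_const (fun z => Num.max (phi z) (psi z)).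
Proof.
move=> hp hq.
have hd : rapprox_const (fun z => phi z + (-1) * psi z) by apply: rapprox_constD => //; exact: rapprox_constZ.
have ha : rapprox_const (fun z => `|phi z + (-1) * psi z|).
  by apply: (rapprox_const_comp (L := 1) hd) => // x y; rewrite mul1r ler_dist_dist.
have -> : (fun z => Num.max (phi z) (psi z)) =
    fun z => 2^-1 * (phi z + psi z + `|phi z + (-1) * psi z|).
  by apply/funext => z; rewrite maxr_absE mulN1r mulrC.
exact: rapprox_constZ (rapprox_constD (rapprox_constD hp hq) ha).
Qed.

Lemma rapprox_const_min phi psi : rapprox_const phi -> rapprox_const psi -> rapprox_const (fun z => Num.min (phi z) (psi z)).
Proof.
move=> hp hq;
have -> : (fun z => Num.min (phi z) (psi z)) = fun z => -1 * Num.max (-1 * phi z) (-1 * psi z).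
  by apply/funext => z; rewrite !mulN1r oppr_max !opprK.
exact: rapprox_constZ (rapprox_const_max (rapprox_constZ _ hp) (rapprox_constZ _ hq)).
Qed.

(* Coordinates multiplied by a cut-off vanishing on the ball of radius [r] become constant there,
   so they can be composed with arbitrary Lipschitz functions. *)
Lemma approx_const_annulus_coord j k (a b : R) : r < a ->
  approx_const (fun z => (annulus a b (z ord0 j))%:C * z ord0 k) /\ rapprox_const (fun z => annulus a b (z ord0 j)).
Proof.
move=> ra.
have van z : nrm z <= r -> annulus a b (z ord0 j) = 0.
  move=> zr; rewrite /annulus; apply/max_idPl; rewrite ge_min; apply/orP; left.
  by have := le_trans (cm_le_nrm z j) zr; lra.
have aa := approximable_annulus G_null G_compact M j b ra.
have al : lip_on G M (fun z => (annulus a b (z ord0 j))%:C).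
  exists 1 => // z w _ _ _ _; rewrite mul1r -real_complexB cm_real.
  apply: le_trans (annulus_lip _ _ _ _) _; rewrite mul1r.
  by have := cm_le_nrm (z - w) j; rewrite !mxE.
have pk : polyfun (fun z : V => z ord0 k) by exact: polyfun_coord.
have ak : approximable G r M (fun z => z ord0 k) by exact: approximable_polyfun.
split; split=> //.
- exact: approximableM.
- by apply: lip_onM => //; apply: (quotpoly_lip G_compact); exact: quotpoly_polyfun.
- by exists 0 => z zr; rewrite van// mul0r.
- by exists 0 => z zr; rewrite van.
Qed.

Lemma Re_lip : dist_lip (fun w : C => complex.Re w) 1.
Proof.
by move=> [a b] [c d] /=; rewrite mul1r; exact: (Re_le_cm ((a - c) +i* (b - d))).
Qed.

Lemma Im_lip : dist_lip (fun w : C => complex.Im w) 1.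
Proof.
by move=> [a b] [c d] /=; rewrite mul1r; exact: (Im_le_cm ((a - c) +i* (b - d))).
Qed.

(** Some coordinate [j] of [z] exceeds [r1] in modulus, so the cut-off [annulus r1 b] of that
    coordinate is positive at [z]. If nothing separated the points, the cut-off and its products
    with all coordinates would agree at both, and division would give [z = w]. *)
Lemma rapprox_const_separate r1 z w : r < r1 -> (r1 < nrm z) -> z <> w ->
  exists2 phi, rapprox_const phi & phi z != phi w.
Proof.
move=> rr1 r1z zw; apply: contrapT => nsep.
have same phi : rapprox_const phi -> phi z = phi w.
  by move=> hp; apply/eqP; apply: contra_notT nsep => h; exists phi.
have [j zj] : exists j, r1 < cm (z ord0 j).
  apply: contrapT => nj; have le j : cm (z ord0 j) <= r1.
    by rewrite leNgt; apply/negP => lt; apply: nj; exists j.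
  (* For [r1 < 0] there can be no coordinate at all, so [z = w]; this settles dimension 0. *)
  have [r10|r10] := leP 0 r1.
    by move: r1z; rewrite ltNge => /negP; apply; apply/nrm_leP.
  apply: zw; apply/rowP => k; exfalso.
  by have := le k; have := cm_ge0 (z ord0 k); lra.
pose b := nrm z + 1.
have u0 : 0 < annulus r1 b (z ord0 j).
  rewrite /annulus lt_max lt_min; apply/orP; right.
  by have := cm_le_nrm z j; rewrite /b => ?; apply/andP; split; lra.
apply: zw; apply/rowP => k.
have [gk ga] := approx_const_annulus_coord j k b rr1.
have ea := same _ ga.
have eR := same _ (approx_const_comp gk ler01 Re_lip).
have eI := same _ (approx_const_comp gk ler01 Im_lip).
have un : (annulus r1 b (z ord0 j))%:C != 0 by rewrite -cm_gt0 cm_real normr_gt0 gt_eqF.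
apply: (mulfI un); rewrite [in RHS]ea.
by apply/eqP; rewrite eq_complex; apply/andP; split; apply/eqP.
Qed.

(** Two points with distinct values of [f] cannot both lie in the ball where [f] vanishes. One of
    them is outside, so they can be separated, and an affine map adjusts the values. *)
Lemma rapprox_const_interpolate r1 (f : V -> R) z w : r < r1 -> (forall v, nrm v <= r1 -> f v = 0) ->
  exists phi, [/\ rapprox_const phi, phi z = f z & phi w = f w].
Proof.
move=> rr1 f0; have [e|ne] := eqVneq (f z) (f w).
  by exists (fun=> f z); split=> //; exact: rapprox_const_cst.
have zw : z <> w by move=> e; rewrite e eqxx in ne.
have [phi hphi sep] : exists2 phi, rapprox_const phi & phi z != phi w.
  have [zr|zr] := leP (nrm z) r1; last exact: (rapprox_const_separate rr1 zr).
  have [wr|wr] := leP (nrm w) r1; first by rewrite !f0// eqxx in ne.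
  have [phi hp sep] := rapprox_const_separate rr1 wr (nesym zw).
  by exists phi => //; rewrite eq_sym.
have d0 : phi z - phi w != 0 by rewrite subr_eq0.
exists (fun v => (f z - f w) / (phi z - phi w) * (phi v + - phi w) + f w); split.
- by apply: rapprox_constD; [apply: rapprox_constZ; apply: rapprox_constD => //|]; exact: rapprox_const_cst.
- by rewrite divfK// subrK.
- by rewrite subrr mulr0 add0r.
Qed.

(** The functions concerned are constant on the ball, so its centre stands for all of it, and
    compactness is used only on the piece of [G]. For [r < 0] the ball is empty and the centre is
    left out. *)
Lemma approx_domain_cover (Q : V -> V -> Prop) :
  (forall y z, nrm y <= r -> nrm z <= r -> Q y z) ->
  (forall y, G y -> nrm y <= M -> exists2 rho, 0 < rho &
     forall z, G z -> nrm z <= M -> nrm (z - y) < rho -> Q y z) ->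
  exists s : seq V, (forall y, y \in s -> approx_domain G r M y) /\
    forall z, approx_domain G r M z -> exists2 y, y \in s & Q y z.
Proof.
move=> Q1 Q2.
have /choice[rho rhoP] y : exists rho, G y -> nrm y <= M -> 0 < rho /\
     forall z, G z -> nrm z <= M -> nrm (z - y) < rho -> Q y z.
  have [[Gy yM]|nGy] := pselect (G y /\ nrm y <= M); last first.
    by exists 0 => Gy yM; case: nGy.
  by have [e e0 eQ] := Q2 y Gy yM; exists e.
have [y [Gy yM]|s [sG cov]] := @G_compact M rho; first by have [] := rhoP y Gy yM.
exists (if 0 <= r then 0 :: s else s); split=> [y|z [zr|[Gz zM]]].
- case: (leP 0 r) => r0; last by move=> /sG[? ?]; right.
  by rewrite inE => /orP[/eqP->|/sG[? ?]]; [left; rewrite nrm0|right].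
- exists 0; first by rewrite (le_trans (nrm_ge0 z) zr) mem_head.
  by apply: Q1 => //; rewrite nrm0 (le_trans (nrm_ge0 z) zr).
- have [y ys zy] := cov z (conj Gz zM); have [Gy yM] := sG y ys.
  exists y; first by case: ifP => _; rewrite ?inE ys ?orbT.
  by have [_] := rhoP y Gy yM; apply.
Qed.

Definition cont_on (f : V -> R) := forall y, G y -> forall e, 0 < e ->
  exists2 d, 0 < d & forall z, G z -> nrm (z - y) < d -> `|f z - f y| < e.

Lemma cont_diff_rapprox_const (f : V -> R) phi y e : cont_on f -> rapprox_const phi -> G y -> nrm y <= M -> 0 < e ->
  exists2 d, 0 < d & forall z, G z -> nrm z <= M -> nrm (z - y) < d ->
    `|(f z - phi z) - (f y - phi y)| < e.
Proof.
move=> fc [_ [L L0 pL] _] Gy yM e0; have e20 : 0 < e / 2 by rewrite divr_gt0.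
have [d d0 fd] := fc y Gy _ e20; have L1 : 0 < L + 1 by rewrite ltr_wpDl.
exists (Num.min d (e / 2 / (L + 1))) => [|z Gz zM].
  by rewrite lt_min d0 divr_gt0.
rewrite lt_min => /andP[zd]; rewrite ltr_pdivlMr// => zL.
have h1 := fd z Gz zd; have := pL z y Gz Gy zM yM; rewrite -real_complexB cm_real => h2.
have -> : f z - phi z - (f y - phi y) = (f z - f y) - (phi z - phi y) by ring.
apply: le_lt_trans (ler_normB _ _) _; have := nrm_ge0 (z - y); nra.
Qed.

(** The lattice argument: interpolants at pairs [(x, y)] are joined by maxima over finitely many
    [y], then by minima over finitely many [x]. The maxima keep the exact value at [x], on which the
    second covering relies. *)
Lemma stone_weierstrass r1 (f : V -> R) (eps : R) : r < r1 ->
  (forall v, nrm v <= r1 -> f v = 0) -> cont_on f -> 0 < eps ->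
  exists2 phi, rapprox_const phi & forall z, approx_domain G r M z -> `|f z - phi z| <= eps.
Proof.
move=> rr1 f0 fc eps0.
have cst_f y z : nrm y <= r -> nrm z <= r -> f y = f z.
  by move=> yr zr; rewrite !f0//; apply/ltW; apply: le_lt_trans rr1.
have cst_phi phi y z : rapprox_const phi -> nrm y <= r -> nrm z <= r -> phi y = phi z.
  move=> [_ _ [c hc]] yr zr.
  by have := hc y yr; rewrite -(hc z zr) => /eqP; rewrite eq_complex /= => /andP[/eqP].
have above x : exists2 psi, rapprox_const psi & psi x = f x /\ forall z, approx_domain G r M z -> f z - eps <= psi z.
  have /choice[phi phiP] y : exists phi, [/\ rapprox_const phi, phi x = f x & phi y = f y].
    exact: (rapprox_const_interpolate _ _ rr1 f0).
  have [|y Gy yM|s [_ cov]] := @approx_domain_cover (fun y z => f z - eps <= phi y z).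
  - move=> y z yr zr; have [h _ e] := phiP y.
    by rewrite -(cst_f y z)// -(cst_phi _ y z h)// e gerBl ltW.
  - have [h _ e] := phiP y; have [d d0 hd] := cont_diff_rapprox_const fc h Gy yM eps0.
    exists d => // z Gz zM zd; have := hd z Gz zM zd.
    by rewrite e subrr subr0 => /ltr_normlW; lra.
  have [psi hpsi [psix psis]] : exists2 psi, rapprox_const psi & psi x = f x /\ forall y, y \in s -> forall z, phi y z <= psi z.
    elim: s {cov} => [|y s [psi hpsi [psix psis]]].
      by have [h e _] := phiP x; exists (phi x).
    have [h e _] := phiP y; exists (fun z => Num.max (phi y z) (psi z)); first exact: rapprox_const_max.
    split=> [|y']; first by rewrite e psix maxxx.
    by rewrite inE => /orP[/eqP->|/psis le] z; rewrite le_max ?lexx ?le ?orbT.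
  exists psi => //; split=> // z Xz; have [y ys le] := cov z Xz.
  by apply: le_trans le _; exact: psis.
have /choice[psi psiP] x : exists psi, rapprox_const psi /\ (psi x = f x /\ forall z, approx_domain G r M z -> f z - eps <= psi z).
  by have [psi h1 h2] := above x; exists psi.
have [|y Gy yM|s [sX cov]] := @approx_domain_cover (fun y z => psi y z <= f z + eps).
- move=> y z yr zr; have [h [e _]] := psiP y.
  by rewrite -(cst_f y z)// -(cst_phi _ y z h)// e lerDl ltW.
- have [h [e _]] := psiP y; have [d d0 hd] := cont_diff_rapprox_const fc h Gy yM eps0.
  exists d => // z Gz zM zd; have := hd z Gz zM zd.
  by rewrite e subrr subr0 distrC => /ltr_normlW; lra.
have [phi hphi [lo hi]] : exists2 phi, rapprox_const phi &
    (forall z, approx_domain G r M z -> f z - eps <= phi z) /\ forall y, y \in s -> forall z, phi z <= psi y z.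
  elim: s {cov sX} => [|y s [phi hphi [lo hi]]].
    by have [h [_ lo]] := psiP 0; exists (psi 0).
  have [h [_ loy]] := psiP y; exists (fun z => Num.min (psi y z) (phi z)); first exact: rapprox_const_min.
  split=> [z Xz|y']; first by rewrite le_min lo ?loy.
  by rewrite inE => /orP[/eqP->|/hi le] z; rewrite ge_min ?lexx ?le ?orbT.
exists phi => // z Xz; have [y ys le] := cov z Xz.
have := lo z Xz; have := hi y ys z; rewrite ler_norml => h1 h2; apply/andP; split; lra.
Qed.

Lemma approx_vanishing r1 f (eps : R) : r < r1 ->
  (forall v, nrm v <= r1 -> f v = 0) ->
  cont_on (fun z => complex.Re (f z)) -> cont_on (fun z => complex.Im (f z)) -> 0 < eps ->
  exists2 h, admissible G r h & forall z, approx_domain G r M z -> cm (f z - h z) <= eps.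
Proof.
move=> rr1 f0 cR cI eps0; have e0 : 0 < eps / 4 by rewrite divr_gt0.
have [v vr|phi hp p_app] := stone_weierstrass rr1 _ cR e0; first by rewrite f0.
have [v vr|psi hq q_app] := stone_weierstrass rr1 _ cI e0; first by rewrite f0.
have [pa _ _] := hp; have [qa _ _] := hq.
have ai : approximable G r M (fun=> 'i) by apply: approximable_polyfun; exact: polyfun_cst.
have := approximableD pa (approximableM G_compact ai qa).
have e20 : 0 < eps / 2 by rewrite divr_gt0.
move=> /(_ _ e20)[h ha hE]; exists h => // z Xz.
apply: le_trans (cm_dist _ _ ((phi z)%:C + 'i * (psi z)%:C)) _.
have := p_app z Xz; have := q_app z Xz; have := hE z Xz.
set k := cm (_ - h z) => h1 h2 h3.
suff : cm (f z - ((phi z)%:C + 'i * (psi z)%:C)) <= eps / 2 by lra.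
apply: le_trans (cm_le_ReIm _) _.
have -> : complex.Re (f z - ((phi z)%:C + 'i * (psi z)%:C)) = complex.Re (f z) - phi z.
  by case: (f z) => a b /=; ring.
have -> : complex.Im (f z - ((phi z)%:C + 'i * (psi z)%:C)) = complex.Im (f z) - psi z.
  by case: (f z) => a b /=; ring.
lra.
Qed.

End Lattice.

(** * Exhaustion by polydiscs *)

Lemma near_eq_differentiable (K : numFieldType) (V W : normedModType K) (f g : V -> W) z :
  (\forall w \near z, f w = g w) -> differentiable f z -> differentiable g z.
Proof.
move=> fg df; apply: (@differentiable_littleo _ _ _ g ('d f z) z); first exact: diff_continuous.
move=> e e0; have /eqaddoP /(_ e e0) := diff_locally df.
have fgz := nbhs_singleton fg.
move: fg; rewrite (near_shift 0) subr0 => fg; apply: filterS2 fg => v /=.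
by rewrite fctE /= -fgz => ->.
Qed.

Section Exhaustion.
Context {R : realType} {n : nat}.
Notation C := R[i].
Notation V := 'rV[R[i]]_n.
Context (G : set 'rV[R[i]]_n).
Implicit Types (z w v : V) (s f g h : V -> C) (eps : V -> R).

Hypothesis G_null : forall M, null2V (G `&` [set z | nrm z <= M]).
Hypothesis G_compact : forall M, gauge_compact (G `&` [set z | nrm z <= M]).

Definition ccont f := forall y, G y -> forall e : R, 0 < e ->
  exists2 d, 0 < d & forall z, G z -> nrm (z - y) < d -> cm (f z - f y) < e.

Lemma ccontD f g : ccont f -> ccont g -> ccont (fun z => f z + g z).
Proof.
move=> fc gc y Gy e e0; have e20 : 0 < e / 2 by rewrite divr_gt0.
have [d d0 fd] := fc y Gy _ e20; have [b b0 gb] := gc y Gy _ e20.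
exists (Num.min d b) => [|z Gz]; first by rewrite lt_min d0.
rewrite lt_min => /andP[zd zb]; rewrite opprD addrACA.
apply: le_lt_trans (cmD _ _) _; have := fd z Gz zd; have := gb z Gz zb; lra.
Qed.

Lemma ccontN f : ccont f -> ccont (fun z => - f z).
Proof.
move=> fc y Gy e e0; have [d d0 fd] := fc y Gy e e0.
by exists d => // z Gz zd; rewrite -opprD cmN fd.
Qed.

Lemma quotpoly_ccont h : quotpoly G h -> ccont h.
Proof.
move=> hq y Gy e e0; have [L L0 hL] := quotpoly_lip G_compact (nrm y + 1) hq.
have L1 : 0 < L + 1 by rewrite ltr_wpDl.
exists (Num.min 1 (e / (L + 1))) => [|z Gz]; first by rewrite lt_min ltr01 divr_gt0.
rewrite lt_min => /andP[z1]; rewrite ltr_pdivlMr// => ze.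
have zy : nrm z <= nrm y + 1.
  by have := nrmD (z - y) y; rewrite subrK; lra.
have yy : nrm y <= nrm y + 1 by lra.
apply: le_lt_trans (hL z y Gz Gy zy yy) _; have := nrm_ge0 (z - y); nra.
Qed.

Definition cutoff (a : R) z : R := Num.max 0 (Num.min 1 (nrm z - a)).

Lemma cutoff_ge0 a z : 0 <= cutoff a z. Proof. by rewrite le_max lexx. Qed.
Lemma cutoff_le1 a z : cutoff a z <= 1.
Proof. by rewrite ge_max ler01 ge_min lexx. Qed.
Lemma cutoff_eq0 a z : nrm z <= a -> cutoff a z = 0.
Proof. by move=> za; apply/max_idPl; rewrite ge_min subr_le0 za orbT. Qed.
Lemma cutoff_eq1 a z : a + 1 <= nrm z -> cutoff a z = 1.
Proof.
by move=> za; rewrite /cutoff (min_idPl _) ?(max_idPr _)//; lra.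
Qed.
Lemma cutoff_lip a z w : `|cutoff a z - cutoff a w| <= nrm (z - w).
Proof.
have nb := nrm_ge0 (z - w).
apply: max_dist; first by rewrite subrr normr0.
apply: min_dist; first by rewrite subrr normr0.
have := nrm_dist z 0 w; have := nrm_dist w 0 z; rewrite !subr0 (nrmB w z) ler_norml.
by move=> ? ?; apply/andP; split; lra.
Qed.

Lemma ccont_cutoff a f : ccont f -> ccont (fun z => (cutoff a z)%:C * f z).
Proof.
move=> fc y Gy e e0; have e20 : 0 < e / 2 by rewrite divr_gt0.
have [d d0 fd] := fc y Gy _ e20; have K0 : 0 < cm (f y) + 1 by rewrite ltr_wpDl ?cm_ge0.
exists (Num.min d (e / 2 / (cm (f y) + 1))) => [|z Gz]; first by rewrite lt_min d0 divr_gt0.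
rewrite lt_min => /andP[zd]; rewrite ltr_pdivlMr// => zK.
have -> : (cutoff a z)%:C * f z - (cutoff a y)%:C * f y =
  (cutoff a z)%:C * (f z - f y) + (cutoff a z - cutoff a y)%:C * f y.
  by rewrite real_complexB; ring.
apply: le_lt_trans (cmD _ _) _; rewrite !cmM !cm_real ger0_norm ?cutoff_ge0//.
have h1 := fd z Gz zd; have h2 := cutoff_lip a z y.
have h3 : cutoff a z * cm (f z - f y) <= cm (f z - f y).
  by rewrite ler_piMl ?cm_ge0 ?cutoff_le1.
have h4 : `|cutoff a z - cutoff a y| * cm (f y) <= nrm (z - y) * cm (f y).
  by rewrite ler_wpM2r ?cm_ge0.
by have := nrm_ge0 (z - y); lra.
Qed.

Lemma ccont_Re f : ccont f -> cont_on G (fun z => complex.Re (f z)).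
Proof.
move=> fc y Gy e e0; have [d d0 fd] := fc y Gy e e0; exists d => // z Gz zd.
have -> : complex.Re (f z) - complex.Re (f y) = complex.Re (f z - f y) by case: (f z); case: (f y).
exact: le_lt_trans (Re_le_cm _) (fd z Gz zd).
Qed.

Lemma ccont_Im f : ccont f -> cont_on G (fun z => complex.Im (f z)).
Proof.
move=> fc y Gy e e0; have [d d0 fd] := fc y Gy e e0; exists d => // z Gz zd.
have -> : complex.Im (f z) - complex.Im (f y) = complex.Im (f z - f y) by case: (f z); case: (f y).
exact: le_lt_trans (Im_le_cm _) (fd z Gz zd).
Qed.

(** Between [k - 3] and [k - 2] lies the margin that [approx_vanishing] needs. From [k - 1] on the
    cut-off is 1, so on [G] between [k - 1] and [k] the correction approximates [f] itself. For
    [k < 3] the ball is empty. *)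
Lemma approx_step (k : nat) (delta : R) f : 0 < delta -> ccont f ->
  exists h, [/\ admissible G (k%:R - 3) h,
    forall z, nrm z <= k%:R - 3 -> cm (h z) <= delta
  & forall z, G z -> nrm z <= k%:R -> cm ((cutoff (k%:R - 2) z)%:C * f z - h z) <= delta].
Proof.
move=> d0 fc.
have lt : k%:R - 3 < k%:R - 2 :> R by lra.
have van v : nrm v <= k%:R - 2 -> (cutoff (k%:R - 2) v)%:C * f v = 0.
  by move=> vk; rewrite cutoff_eq0// mul0r.
have cc := ccont_cutoff (k%:R - 2) fc.
have [h ha hE] := approx_vanishing G_null G_compact k%:R lt van (ccont_Re cc) (ccont_Im cc) d0.
exists h; split=> // [z zk|z Gz zk]; last by apply: hE; right.
by have := hE z (or_introl zk); rewrite van ?sub0r ?cmN//; lra.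
Qed.

Lemma eps_lower eps (M : R) : cont_on G eps -> (forall z, G z -> 0 < eps z) ->
  exists2 m, 0 < m & forall z, G z -> nrm z <= M -> m <= eps z.
Proof.
move=> ec e0.
have /choice[rho rhoP] y : exists d, G y -> 0 < d /\ forall z, G z -> nrm (z - y) < d -> `|eps z - eps y| < eps y / 2.
  have [Gy|nGy] := pselect (G y); last by exists 0.
  have e2 : 0 < eps y / 2 by rewrite divr_gt0 ?e0.
  by have [d d0 ed] := ec y Gy _ e2; exists d.
have [y [Gy _]|s [sG cov]] := @G_compact M rho; first by have [] := rhoP y Gy.
have [y ys|m m0 ms] := seq_gt0_lower (s := s) (f := eps); first by apply: e0; have [] := sG y ys.
exists (m / 2) => [|z Gz zM]; first by rewrite divr_gt0.
have [y ys zy] := cov z (conj Gz zM); have [Gy _] := sG y ys.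
have [_ /(_ z Gz zy)] := rhoP y Gy; have := ms y ys.
by rewrite ltr_norml => h /andP[h1 _]; lra.
Qed.

Lemma tangential_series f eps : ccont f -> cont_on G eps -> (forall z, G z -> 0 < eps z) ->
  exists s : nat -> V -> C,
  [/\ forall N, quotpoly G (s N),
      forall N, unifpoly (N%:R - 3) (fun z => s N.+1 z - s N z),
      forall N z, nrm z <= N%:R - 3 -> cm (s N.+1 z - s N z) <= 2^-1 ^+ N
    & forall z, G z -> exists m, forall N, (m <= N)%N -> cm (f z - s N z) <= eps z / 2].
Proof.
move=> fc ec e0.
have /choice[delta deltaP] k : exists d, [/\ 0 < d, d <= 2^-1 ^+ k &
    forall z, G z -> nrm z <= k%:R -> d <= eps z * 2^-1 ^+ k.+2].
  have [m m0 me] := @eps_lower eps k%:R ec e0.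
  have q0 : 0 < 2^-1 ^+ k.+2 :> R by rewrite exprn_gt0// invr_gt0.
  exists (Num.min 1 m * 2^-1 ^+ k.+2); split.
  - by rewrite mulr_gt0// lt_min ltr01.
  - apply: (@le_trans _ _ (1 * 2^-1 ^+ k.+2)); first by rewrite ler_pM2r// ge_min lexx.
    by rewrite mul1r ler_wiXn2l ?invr_ge0 ?invf_le1 ?ler1n//; lia.
  - by move=> z Gz zk; rewrite ler_pM2r// ge_min me ?orbT.
have d_gt0 k : 0 < delta k by have [] := deltaP k.
(* Continuity of [g] sits behind the existential so that the choice is total and the recursion can
   call it before [s N] is known to be continuous. *)
have stepP (k : nat) g : exists h, ccont g -> [/\ admissible G (k%:R - 3) h,
    forall z, nrm z <= k%:R - 3 -> cm (h z) <= delta k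
  & forall z, G z -> nrm z <= k%:R -> cm ((cutoff (k%:R - 2) z)%:C * g z - h z) <= delta k].
  have [gc|ngc] := pselect (ccont g); last by exists (fun=> 0).
  by have [h hP] := approx_step k (d_gt0 k) gc; exists h.
have /choice[step {}stepP] (kg : nat * (V -> C)) := stepP kg.1 kg.2.
pose s := fix s (N : nat) : V -> C := if N is N'.+1
  then fun z => s N' z + step (N', fun z => f z - s N' z) z else fun=> 0.
have sS N z : s N.+1 z = s N z + step (N, fun z => f z - s N z) z by [].
have sq N : quotpoly G (s N).
  elim: N => [|N IH]; first by apply: quotpoly_polyfun; exact: polyfun_cst.
  have [|[hq _] _ _] := stepP (N, fun z => f z - s N z).
    by apply: ccontD => //; apply: ccontN; exact: quotpoly_ccont.
  exact: quotpolyD.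
have hP N := stepP (N, fun z => f z - s N z) (ccontD fc (ccontN (quotpoly_ccont (sq N)))).
have hE N : (fun z => s N.+1 z - s N z) = step (N, fun z => f z - s N z).
  by apply/funext => z; rewrite sS addrC addKr.
exists s; split=> // [N|N z zN|z Gz].
- by rewrite hE; have [[]] := hP N.
- rewrite sS addrC addKr; have [_ /(_ z zN) /= h _] := hP N; apply: le_trans h _.
  by have [] := deltaP N.
pose m := (Num.truncn (nrm z)).+1.
have /andP[mz zm] := truncn_itv (nrm_ge0 z).
have ez := e0 z Gz.
exists m.+1 => N mN; have -> : N = (m + (N - m.+1)).+1 by lia.
move: (N - m.+1)%N => j {N mN}.
suff : cm (f z - s (m + j).+1 z) <= eps z * (2^-1 - 2^-1 ^+ j.+2).
  move=> /le_trans; apply; have : 0 <= 2^-1 ^+ j.+2 :> R by rewrite exprn_ge0// invr_ge0.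
  by have := ltW ez; nra.
have zmj (i : nat) : nrm z <= (m + i)%:R.
  by apply: le_trans (ltW zm) _; rewrite ler_nat leq_addr.
have rec (i : nat) : cm (f z - s (m + i).+1 z) <=
   (1 - cutoff ((m + i)%:R - 2) z) * cm (f z - s (m + i)%N z) + eps z * 2^-1 ^+ i.+2.
  have [_ _ /(_ z Gz (zmj i)) /= h] := hP (m + i)%N.
  have [_ _ /(_ z Gz (zmj i)) d_le] := deltaP (m + i)%N.
  have -> : f z - s (m + i).+1 z = (1 - cutoff ((m + i)%:R - 2) z)%:C * (f z - s (m + i)%N z) +
    ((cutoff ((m + i)%:R - 2) z)%:C * (f z - s (m + i)%N z) - step ((m + i)%N, fun z => f z - s (m + i)%N z) z).
    by rewrite sS real_complexB; ring.
  apply: le_trans (cmD _ _) _; rewrite cmM cm_real ger0_norm ?subr_ge0 ?cutoff_le1//.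
  rewrite lerD2l; apply: le_trans h _; apply: le_trans d_le _.
  by rewrite ler_pM2l// ler_wiXn2l ?invr_ge0 ?invf_le1 ?ler1n//; lia.
(* Since [m - 1 <= nrm z], the cut-off is 1 at step [m]: the whole previous error is erased and a
   new one of at most [eps z / 4] takes its place. Later steps multiply the error by at most 1 and
   add [eps z / 8], [eps z / 16] and so on. *)
elim: j => [|j IH].
  apply: le_trans (rec 0%N) _; rewrite cutoff_eq1; last first.
    by rewrite addn0 /m mulrSr; lra.
  rewrite subrr mul0r add0r ler_pM2l// !exprS expr0; lra.
apply: le_trans (rec j.+1) _; rewrite addnS.
have c1 : (1 - cutoff ((m + j).+1%:R - 2) z) * cm (f z - s (m + j).+1 z) <= cm (f z - s (m + j).+1 z).
  by rewrite ler_piMl ?cm_ge0// gerBl cutoff_ge0.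
have e2 : 2^-1 ^+ j.+2 = 2 * 2^-1 ^+ j.+3 :> R by rewrite [in RHS]exprS mulrA divff// mul1r.
by move: IH; rewrite e2; lra.
Qed.

End Exhaustion.

(** * The limit of the series and its poles *)

Section Limit.
Context {R : realType} {n : nat}.
Notation C := R[i].
Notation V := 'rV[R[i]]_n.
Implicit Types (z w v : V) (p q f g h : V -> C).

Lemma unifpoly_mono (r r' : R) f : r' <= r -> unifpoly r f -> unifpoly r' f.
Proof.
move=> rr' fr e e0; have [p pp pf] := fr e e0; exists p => // z zr.
by apply: pf; apply: le_trans rr'.
Qed.

(** On the line from [z] to [z0] the polynomial [q] has one variable. If it vanished near [z], the
    Cauchy estimates with [M = 0] would kill all its coefficients, hence its value at [z0]. *)
Lemma polyfun_germ_neq0 q z0 z : polyfun q -> q z0 != 0 -> ~ (\forall w \near z, q w = 0).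
Proof.
move=> pq qz0 /nbhs_nrmP[e e0 qe].
have [l [_ lq]] := polyfun_line z pq; have [P [PE _]] := lq (z0 - z).
pose rho := e / 2 / (nrm (z0 - z) + 1).
have n0 := nrm_ge0 (z0 - z).
have rho0 : 0 < rho by rewrite !divr_gt0// ltr_wpDl.
have P0 : P = 0.
  apply/polyP => k; rewrite coef0; apply/eqP; rewrite -cm_eq0 eq_le cm_ge0 andbT.
  rewrite -(pmulr_lle0 _ (exprn_gt0 k rho0)).
  apply: cauchy_coef; first exact: ltW.
  move=> t tr; rewrite -PE qe ?cm0// opprD addrA subrr sub0r nrmN.
  apply: le_lt_trans (nrmZ _ _) _.
  apply: (@le_lt_trans _ _ (rho * nrm (z0 - z))); first by rewrite ler_wpM2r.
  apply: (@le_lt_trans _ _ (e / 2)); last by lra.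
  apply: (@le_trans _ _ (rho * (nrm (z0 - z) + 1))); first by rewrite ler_pM2l//; lra.
  by rewrite /rho divfK// gt_eqF//; lra.
by move: qz0; have := PE 1; rewrite P0 horner0 scale1r addrC subrK => ->; rewrite eqxx.
Qed.

Lemma near_nrm_lt z (r : R) : nrm z < r -> \forall w \near z, nrm w < r.
Proof.
move=> zr; apply/nbhs_nrmP; exists (r - nrm z); first by rewrite subr_gt0.
by move=> w zw; have := nrmD (w - z) z; rewrite subrK nrmB; lra.
Qed.

Lemma near_polyfun_neq0 q z : polyfun q -> q z != 0 -> \forall w \near z, q w != 0.
Proof.
move=> pq qz; have [L L0 qL] := polyfun_lip (nrm z + 1) pq.
have L1 : 0 < L + 1 by rewrite ltr_wpDl.
have c0 : 0 < cm (q z) by rewrite cm_gt0.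
apply/nbhs_nrmP; exists (Num.min 1 (cm (q z) / (L + 1))); first by rewrite lt_min ltr01 divr_gt0.
move=> w; rewrite lt_min ltr_pdivlMr// => /andP[zw1 zwL].
have zz : nrm z <= nrm z + 1 by lra.
have ww : nrm w <= nrm z + 1 by have := nrmD (w - z) z; rewrite subrK nrmB; lra.
rewrite -cm_gt0; have := qL z w zz ww; have := cm_dist (q z) 0 (q w); rewrite !subr0.
have := nrm_ge0 (z - w); nra.
Qed.

(** Around a point [F] is the rational [s N] plus a holomorphic tail, for [N] large; multiplying by
    the denominator of [s N] gives a holomorphic numerator. *)
Lemma holomorphic_meromorphic_series (G : set V) (s : nat -> V -> C) z0 : G z0 ->
  (forall N, quotpoly G (s N)) ->
  (forall N, unifpoly (N%:R - 3) (fun z => s N.+1 z - s N z)) ->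
  (forall N z, nrm z <= N%:R - 3 -> cm (s N.+1 z - s N z) <= 2^-1 ^+ N) ->
  exists F : V -> C, [/\ meromorphic F, singularities F `&` G = set0 &
    forall z N, nrm z <= N%:R - 4 -> cm (s N z - F z) <= 4 * 2^-1 ^+ N].
Proof.
move=> Gz0 sq sr sb.
have cauchy z N j : nrm z <= N%:R - 3 -> cm (s N z - s (N + j)%N z) <= 2 * 2^-1 ^+ N - 2 * 2^-1 ^+ (N + j).
  move=> zN; elim: j => [|j IH]; first by rewrite addn0 !subrr cm0.
  have := cm_dist (s N z) (s (N + j.+1)%N z) (s (N + j)%N z).
  rewrite addnS (cmB (s (N + j)%N z)) => h1.
  have := sb (N + j)%N z; rewrite natrD => /(_ _) h2.
  have e2 : 2^-1 ^+ (N + j) = 2 * 2^-1 ^+ (N + j).+1 :> R by rewrite [in RHS]exprS mulrA divff// mul1r.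
  have {}h2 : cm (s (N + j).+1 z - s (N + j)%N z) <= 2^-1 ^+ (N + j).
    by apply: h2; apply: le_trans zN _; rewrite lerD2r lerDl.
  by move: e2 IH h1 h2; lra.
have e_ge0 N : 0 <= 2^-1 ^+ N :> R by rewrite exprn_ge0// invr_ge0.
have /choice[F FP] z : exists l, forall N, nrm z <= N%:R - 4 -> cm (s N z - l) <= 4 * 2^-1 ^+ N.
  (* [K] is large enough for the estimate [cauchy] at [z], yet [nrm z <= N%:R - 4] implies [K <= N].
     This rounding is why the radius drops from [N - 3] to [N - 4]. *)
  pose K := (Num.truncn (nrm z) + 4)%N.
  have /andP[Kz zK] := truncn_itv (nrm_ge0 z).
  have zK3 : nrm z <= K%:R - 3 by rewrite /K natrD; move: zK; rewrite mulrSr; lra.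
  have [|m k mk|l lP] := @cm_complete R (fun j => s (K + j)%N z) (fun j => 2 * 2^-1 ^+ (K + j)).
  - move=> eta eta0; have [m hm] := @exp2V_small R (2 * 2^-1 ^+ K) eta eta0.
    by exists m; move: hm; rewrite -mulrA -exprD.
  - have zKm : nrm z <= (K + m)%:R - 3 by apply: le_trans zK3 _; rewrite lerD2r ler_nat leq_addr.
    have -> : (K + k = K + m + (k - m))%N by lia.
    by apply: le_trans (cauchy z (K + m)%N (k - m)%N zKm) _; rewrite gerBl mulr_ge0.
  exists l => N zN.
  have KN : (K <= N)%N.
    by rewrite -(ler_nat R) /K natrD; lra.
  have := lP (N - K)%N; rewrite subnKC//.
  by rewrite mulrA -natrM.
pose tail (N : nat) z := F z - s N z.
have tailP N : unifpoly (N%:R - 4) (tail N).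
  apply: unifpoly_lim => e e0.
  have [j hj] := @exp2V_small R (4 * 2^-1 ^+ N) e e0.
  exists (fun z => s (N + j)%N z - s N z) => [|z zN]; last first.
    have -> : tail N z - (s (N + j)%N z - s N z) = - (s (N + j)%N z - F z) by rewrite /tail; ring.
    rewrite cmN; apply: le_trans (FP z _ _) _; last by rewrite exprD mulrA.
    by apply: le_trans zN _; rewrite lerD2r ler_nat leq_addr.
  elim: j {hj} => [|j IH].
    have -> : (fun z => s (N + 0)%N z - s N z) = fun=> 0 by apply/funext => z; rewrite addn0 subrr.
    by apply: unifpoly_polyfun; exact: polyfun_cst.
  have -> : (fun z => s (N + j.+1)%N z - s N z) =
     fun z => (s (N + j).+1 z - s (N + j)%N z) + (s (N + j)%N z - s N z).
    by apply/funext => z; rewrite addnS addrA subrK.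
  apply: unifpolyD => //; apply: unifpoly_mono (sr (N + j)%N).
  by rewrite natrD; have := ler0n R j; lra.
have local z : exists p q g (r : R), [/\ polyfun p, polyfun q, forall w, G w -> q w != 0,
    nrm z < r & (forall w, nrm w < r -> differentiable g w) /\ forall w, q w != 0 -> F w = g w + p w / q w].
  pose N := (Num.truncn (nrm z) + 5)%N.
  have [p [q [pp pq q0 sE]]] := sq N.
  exists p, q, (tail N), (N%:R - 4); split=> //.
    by have /andP[_] := truncn_itv (nrm_ge0 z); rewrite /N natrD mulrSr; lra.
  split=> w; first exact: unifpoly_differentiable (tailP N).
  by move=> qw; rewrite /tail -sE// subrK.
exists F; split=> // [z|].
  have [p [q [g [r [pp pq q0 zr [gd FE]]]]]] := local z.
  exists (fun w => p w + g w * q w), q; split.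
  - near=> w; apply: differentiableD; first exact: polyfun_differentiable.
    apply: differentiableM; last exact: polyfun_differentiable.
    by apply: gd; near: w; exact: near_nrm_lt.
  - by near=> w; exact: polyfun_differentiable.
  (* The denominator is nonzero at the point [z0] of [G], so its germ vanishes nowhere
     identically. *)
  - exact: polyfun_germ_neq0 pq (q0 z0 Gz0).
  - by near=> w => qw; rewrite FE// mulrDl mulfK// addrC.
apply/seteqP; split=> // z [/= nz Gz]; apply: nz.
have [p [q [g [r [pp pq q0 zr [gd FE]]]]]] := local z.
have H : \forall w \near z, nrm w < r /\ q w != 0.
  by near=> w; split; near: w; [exact: near_nrm_lt|apply: near_polyfun_neq0 => //; exact: q0].
rewrite /holomorphic_at; near=> w.
have [wr qw] : nrm w < r /\ q w != 0 by near: w.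
apply: (@near_eq_differentiable _ _ _ (fun w => g w + p w / q w)).
  by have := near_polyfun_neq0 pq qw; apply: filterS => v /FE ->.
apply: differentiableD; first exact: gd.
apply: differentiableM; first exact: polyfun_differentiable.
by apply: differentiableV => //; exact: polyfun_differentiable.
Unshelve. all: by end_near. Qed.

Lemma within_ccont (G : set V) f : {within G, continuous f} -> ccont G f.
Proof.
move=> /subspace_continuousP fc y Gy e e0.
have : nbhs (f y) [set u | cm (f y - u) < e] by apply/nbhs_cmP; exists e.
move=> /(fc y Gy) /nbhs_nrmP[d d0 H].
exists d => // z Gz zd; rewrite cmB; apply: H => //; rewrite nrmB//.
Qed.

Lemma within_cont_on (G : set V) (f : V -> R) : {within G, continuous f} -> cont_on G f.
Proof.
move=> /subspace_continuousP fc y Gy e e0.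
have : nbhs (f y) (ball (f y) e) by exact: nbhsx_ballx.
move=> /(fc y Gy) /nbhs_nrmP[d d0 H].
exists d => // z Gz zd; rewrite distrC; apply: H => //; rewrite nrmB//.
Qed.

Lemma meromorphic_cst (c : C) : meromorphic (fun _ : V => c).
Proof.
move=> z; exists (fun=> c), (fun=> 1); split.
- by near=> w; exact: differentiable_cst.
- by near=> w; exact: differentiable_cst.
- by move=> /nbhs_singleton /eqP; rewrite oner_eq0.
- by near=> w => _; rewrite divr1.
Unshelve. all: by end_near. Qed.

End Limit.

Theorem proposition3 (R : realType) (n : nat) (Gamma : set 'rV[complex R]_n)
    (Gamma_closed : closed Gamma) (Gamma_area0 : area Gamma = 0%E) :
  tangential_meromorphic_approximation Gamma.
Proof.
move=> f eps fc ec e0.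
(* With [Gamma] empty nothing would keep the denominators from being identically zero, so a constant
   is used instead. *)
have [[z0 Gz0]|nG] := pselect (exists z, Gamma z); last first.
  exists (fun=> 0); split=> [||z Gz].
  - exact: meromorphic_cst.
  - by apply/seteqP; split=> // z [_ Gz]; apply: nG; exists z.
  - by case: nG; exists z.
have Gnull M := @area0_null2 R n Gamma M Gamma_closed Gamma_area0.
have Gcpt M : gauge_compact (Gamma `&` [set z | nrm z <= M]).
  by apply: compact_gauge; exact: compact_closed_nrm.
have [s [sq sr sb sf]] := tangential_series Gnull Gcpt (within_ccont fc) (within_cont_on ec) e0.
have [F [Fm Fs FE]] := holomorphic_meromorphic_series Gz0 sq sr sb.
exists F; split=> // z Gz; rewrite normcE ltcR.
have [m hm] := sf z Gz.
have e4 : 0 < eps z / 4 by rewrite divr_gt0 ?e0.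
have [k hk] := @exp2V_small R 4 _ e4.
(* [m] secures the error [eps z / 2] of [s N], [k] the distance [eps z / 4] from [s N] to the limit,
   and the last summand puts [z] in the ball of radius [N - 4]. *)
pose N := (m + (k + (Num.truncn (nrm z) + 5)))%N.
have zN : nrm z <= N%:R - 4.
  have /andP[_ zt] := truncn_itv (nrm_ge0 z).
  have : (Num.truncn (nrm z) + 5)%:R <= N%:R :> R by rewrite ler_nat /N; lia.
  by move: zt; rewrite mulrSr natrD; lra.
have h1 : cm (f z - s N z) <= eps z / 2 by apply: hm; rewrite /N; lia.
have h2 : cm (s N z - F z) <= eps z / 4.
  apply: le_trans (FE z N zN) _; apply: le_trans hk; rewrite ler_pM2l//.
  by rewrite ler_wiXn2l ?invr_ge0 ?invf_le1 ?ler1n// /N; lia.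
have := cm_dist (f z) (F z) (s N z); have := e0 z Gz; lra.
Qed.
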